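(* Consider the action $\alpha:\mathbb Q_+^\times\to\operatorname{Aut}\mathcal T(\mathbb Q_+)$ such that $\alpha_a(T_r)=T_{ar}$ for $a\in\mathbb Q_+^\times$, $r\in\mathbb Q_+$. Let $\psi$ be the homomorphism of $\mathcal T(\mathbb Q_+)$ onto $\mathbb C$ such that $\psi(T_r)=1$ for $r\in\mathbb Q_+$. Then there is a homomorphism $\mathrm{id}\ltimes\psi$ of $\mathbb Q_+^\times\ltimes_\alpha\mathcal T(\mathbb Q_+)$ onto $C^*(\mathbb Q_+^\times)=\mathbb Q_+^\times\ltimes_{\mathrm{id}}\mathbb C$. For $\gamma\in(\mathbb Q_+^\times)^\wedge$, let $\epsilon_\gamma$ be the character of $C^*(\mathbb Q_+^\times)$ such that $\epsilon_\gamma(u_a)=\gamma(a)$. (1) The map $\gamma\mapsto\ker\big(\epsilon_\gamma\circ(\mathrm{id}\ltimes\psi)\big)$ is a homeomorphism of the compact space $(\mathbb Q_+^\times)^\wedge$ onto a closed subset $F$ of $\operatorname{Prim}\big(\mathbb Q_+^\times\ltimes_\alpha\mathcal T(\mathbb Q_+)\big)$; the ideal of $\mathbb Q_+^\times\ltimes_\alpha\mathcal T(\mathbb Q_+)$ with hull $F$ is $\ker(\mathrm{id}\ltimes\psi)$. (2) The other primitive ideals are $O:=\{0\}$ and $I:=\mathbb Q_+^\times\ltimes_\alpha\mathcal C(\mathbb Q_+)$. (3) The set $\{O\}$ is open and dense in $\operatorname{Prim}\big(\mathbb Q_+^\times\ltimes_\alpha\mathcal T(\mathbb Q_+)\big)$,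 and the set $\{I\}$ is open and dense in $\operatorname{Prim}\big(\mathbb Q_+^\times\ltimes_\alpha\mathcal T(\mathbb Q_+)\big)\setminus\{O\}$. (4) Both $I$ and $\ker(\mathrm{id}\ltimes\psi)/I$ are simple.
   Context: $\mathbb Q_+$ is the additive semigroup of non-negative rationals and $\mathbb Q_+^\times$ the discrete multiplicative group of positive rationals, with compact dual $(\mathbb Q_+^\times)^\wedge$. $\mathcal T(\mathbb Q_+)$ is the $C^*$-algebra generated by the isometries $T_r$ ($r\in\mathbb Q_+$) on $\ell^2(\mathbb Q_+)$ with $T_r\epsilon_s=\epsilon_{r+s}$; it is universal for isometric representations of $\mathbb Q_+$. $\mathcal C(\mathbb Q_+)$ is the commutator ideal of $\mathcal T(\mathbb Q_+)$; it is $\alpha$-invariant, and $\mathbb Q_+^\times\ltimes_\alpha\mathcal C(\mathbb Q_+)$ is regarded as an ideal of $\mathbb Q_+^\times\ltimes_\alpha\mathcal T(\mathbb Q_+)$. For an action $\alpha$ of a discrete group $G$ on a $C^*$-algebra $A$, $G\ltimes_\alpha A=\overline{\operatorname{span}}\{u_ga:g\in G,a\in A\}$ denotes the (full) crossed product, with $\alpha_g(a)=u_gau_g^*$; for an equivariant homomorphism $\psi$, $\mathrm{id}\ltimes\psi$ is the homomorphism $u_ga\mapsto u_g\psi(a)$. $\operatorname{Prim}$ carries the hull-kernel topology; the ideal with hull $F$ is the intersection of the primitive ideals in $F$. *)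

(* Defs.v *)
(* The complex numbers are R[i], for R : realType. *)
From HB Require Import structures.
From mathcomp Require Import all_boot all_order all_algebra.
From mathcomp Require Import all_classical all_reals all_analysis.
From mathcomp Require Import complex.

Set Implicit Arguments.
Unset Strict Implicit.
Unset Printing Implicit Defensive.

Import Order.TTheory GRing.Theory Num.Theory numFieldNormedType.Exports.

Local Open Scope classical_set_scope.
Local Open Scope ring_scope.

HB.mixin Record isHilbert (R : realType) H of CompleteNormedModule R[i] H := {
  hdot : H -> H -> R[i];
  hdot_linearl : forall (a : R[i]) (x y z : H),
    hdot (a *: x + y) z = a * hdot x z + hdot y z;
  hdotC : forall x y : H, hdot y x = ((hdot x y)^*)%C;
  hdot_norm : forall x : H, hdot x x = `|x| ^+ 2
}.

#[short(type="hilbertType")]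
HB.structure Definition Hilbert (R : realType) :=
  {H of isHilbert R H & CompleteNormedModule R[i] H}.

(* Unital C*-algebras.  The non-unital ones of interest are ideals, and are
   handled as closed subsets.  The product is part of the mixin because a
   structure below both nzRingType and normedZmodType cannot be added to the
   hierarchy (it would have to precede numDomainType). *)
HB.mixin Record isCStarAlgebra (R : realType) A of
    CompleteNormedModule R[i] A := {
  cmul : A -> A -> A;
  cone : A;
  star : A -> A;
  cmulA : associative cmul;
  cmul1l : left_id cone cmul;
  cmul1r : right_id cone cmul;
  cmul_linearl : forall (a : R[i]) (x y z : A),
    cmul (a *: x + y) z = a *: cmul x z + cmul y z;
  cmul_linearr : forall (a : R[i]) (x y z : A),
    cmul z (a *: x + y) = a *: cmul z x + cmul z y;
  starK : involutive star;
  star_semilinear : forall (a : R[i]) (x y : A),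
    star (a *: x + y) = (a^*)%C *: star x + star y;
  starM : forall x y : A, star (cmul x y) = cmul (star y) (star x);
  cnormM : forall x y : A, `|cmul x y| <= `|x| * `|y|;
  cnorm_star : forall x : A, `|cmul (star x) x| = `|x| ^+ 2
}.

#[short(type="cstarAlgType")]
HB.structure Definition CStarAlgebra (R : realType) :=
  {A of isCStarAlgebra R A & CompleteNormedModule R[i] A}.

Notation "x *c y" := (cmul x y) (at level 40, left associativity).
Notation "x ^*c" := (star x) (at level 2, format "x ^*c").

Section complex_cstar.
Variable R : realType.
Local Notation C := R[i].

HB.instance Definition _ := NormedModule.copy R[i] (R[i])^o.

Lemma normc_ge_Im_aux (x : R[i]) : ((`|complex.Im x|)%:C <= `|x|)%C.
Proof.
rewrite normc_def lecR -sqrtr_sqr ler_sqrt ?addr_ge0 ?sqr_ge0//.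
by rewrite lerDr sqr_ge0.
Qed.

Lemma normc_le_ReIm_aux (x : R[i]) : (`|x| <= (`|complex.Re x| + `|complex.Im x|)%:C)%C.
Proof.
rewrite normc_def lecR -[leRHS]ger0_norm ?addr_ge0// -sqrtr_sqr.
rewrite ler_sqrt ?sqr_ge0// sqrrD !real_normK ?num_real//.
by rewrite addrAC lerDl mulrn_wge0// mulr_ge0.
Qed.

Lemma complex_part_cvg (p : {additive C -> R}) (F : set_system C) :
  (forall x : C, ((`|p x|)%:C <= `|x|)%C) ->
  ProperFilter F -> cauchy F -> cvg (p @ F).
Proof.
move=> pl FF /(@cauchyP R[i] C) Fc; apply: R_complete.
apply/(@cauchyP R R) => e e0.
have e0' : 0 < (e%:C)%C :> R[i] by rewrite ltcR.
have [x Fx] := Fc _ e0'.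
exists (p x); move: Fx; rewrite /= -!ball_normE /=; apply: filterS => y /=.
rewrite -raddfB -ltcR; exact: le_lt_trans.
Qed.

Lemma complex_complete (F : set_system C) :
  ProperFilter F -> cauchy F -> cvg F.
Proof.
move=> FF Fc.
have /cvg_ex[/= a Fa] := complex_part_cvg (p := @complex.Re R)
   (@normc_ge_Re R) FF Fc.
have /cvg_ex[/= b Fb] := complex_part_cvg (p := @complex.Im R)
   normc_ge_Im_aux FF Fc.
apply/cvg_ex; exists (a +i* b)%C.
apply/cvgrPdist_lt => e e0.
have eE : e = ((complex.Re e)%:C)%C.
  by move: e0; case: e => r s; rewrite ltcE /= => /andP[/eqP -> _].
have r0 : 0 < complex.Re e / 2.
  by rewrite divr_gt0//; move: e0; rewrite eE ltcR.
have /cvgrPdist_lt/(_ _ r0) Fa' := Fa.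
have /cvgrPdist_lt/(_ _ r0) Fb' := Fb.
near=> z; apply: le_lt_trans (normc_le_ReIm_aux _) _.
rewrite eE ltcR [ltRHS]splitr.
have -> : complex.Re ((a +i* b)%C - z) = a - complex.Re z by rewrite raddfB.
have -> : complex.Im ((a +i* b)%C - z) = b - complex.Im z by rewrite raddfB.
by apply: ltrD; near: z.
Unshelve. all: by end_near. Qed.

HB.instance Definition _ := Uniform_isComplete.Build C complex_complete.

Fact complex_mulA : associative (fun x y : C => x * y).
Proof. exact: mulrA. Qed.
Fact complex_mul1 : left_id (1 : C) (fun x y : C => x * y).
Proof. exact: mul1r. Qed.
Fact complex_mulr1 : right_id (1 : C) (fun x y : C => x * y).
Proof. exact: mulr1. Qed.
Fact complex_mul_linearl (a : R[i]) (x y z : C) :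
  (a *: x + y) * z = a *: (x * z) + y * z.
Proof. by rewrite mulrDl scalerAl. Qed.
Fact complex_mul_linearr (a : R[i]) (x y z : C) :
  z * (a *: x + y) = a *: (z * x) + z * y.
Proof. by rewrite mulrDr; congr (_ + _); exact: mulrCA. Qed.
Fact complex_star_semilinear (a : R[i]) (x y : C) :
  conjc (a *: x + y) = conjc a *: (conjc x : C) + conjc y.
Proof. by rewrite rmorphD rmorphM. Qed.
Fact complex_starM (x y : C) : conjc (x * y) = conjc y * conjc x.
Proof. by rewrite rmorphM mulrC. Qed.
Fact complex_normM (x y : C) : `|x * y| <= `|x| * `|y|.
Proof. by rewrite normrM. Qed.
Fact complex_norm_star (x : C) : `|(conjc x : C) * x| = `|x| ^+ 2.
Proof. by rewrite normrM normcJ. Qed.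

HB.instance Definition _ := isCStarAlgebra.Build R C
  complex_mulA complex_mul1 complex_mulr1 complex_mul_linearl
  complex_mul_linearr (@conjcK R) complex_star_semilinear complex_starM
  complex_normM complex_norm_star.

End complex_cstar.

Section subspaces.
Variable R : realType.

Definition linear_subspace (V : lmodType R[i]) (M : set V) :=
  M 0 /\ forall (a : R[i]) x y, M x -> M y -> M (a *: x + y).

Definition closed_subspace (V : normedModType R[i]) (M : set V) :=
  closed M /\ linear_subspace M.

Definition closed_span (V : normedModType R[i]) : set V -> set V :=
  smallest (@closed_subspace V).

End subspaces.

Section cstar_algebras.
Variable R : realType.
Implicit Types A B Q : cstarAlgType R.

Definition star_hom A B (f : A -> B) :=
  [/\ linear f, f cone = cone, (forall x y, f (x *c y) = f x *c f y)
    & forall x, f x^*c = (f x)^*c].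

Definition ker A B (f : A -> B) : set A := [set x | f x = 0].

Definition sub_cstar_algebra A (S : set A) :=
  [/\ closed_subspace S, (forall x y, S x -> S y -> S (x *c y))
    & forall x, S x -> S x^*c].

(* J is a closed two-sided ideal of the C*-algebra S, a closed *-subalgebra
   of A *)
Definition closed_ideal_in A (S J : set A) :=
  [/\ J `<=` S, closed_subspace J
    & forall x y, S x -> J y -> J (x *c y) /\ J (y *c x)].

Definition simple_cstar A (S : set A) :=
  (exists2 x, S x & x != 0) /\
  forall J, closed_ideal_in S J -> J = [set 0] \/ J = S.

Definition commutator_ideal A : set A :=
  smallest (closed_ideal_in [set: A])
    [set z | exists x y, z = x *c y - y *c x].

(* q : A -> Q is (isomorphic to) the quotient map of A by the closed ideal J *)
Definition is_quotient A Q (J : set A) (q : A -> Q) :=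
  [/\ star_hom q, range q = setT & ker q = J].

End cstar_algebras.

Section representations.
Variables (R : realType) (A : cstarAlgType R).

Definition is_representation (H : hilbertType R) (pi : A -> H -> H) :=
  [/\ (forall x, linear (pi x)) /\ (forall x, continuous (pi x)),
      forall h, linear (pi^~ h),
      forall x y h, pi (x *c y) h = pi x (pi y h)
    & forall x h k, hdot (pi x h) k = hdot h (pi x^*c k)].

Definition irreducible_representation (H : hilbertType R) (pi : A -> H -> H) :=
  [/\ is_representation pi, (exists x h, pi x h != 0)
    & forall M : set H, closed_subspace M ->
        (forall x h, M h -> M (pi x h)) -> M = [set 0] \/ M = setT].

Definition primitive (P : set A) :=
  exists (H : hilbertType R) (pi : A -> H -> H),
    irreducible_representation pi /\ P = [set x | forall h, pi x h = 0].

Record prim := Prim { prim_ideal : set A; primP : primitive prim_ideal }.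

(* the intersection of the primitive ideals in F; the hull-kernel closure of F
   is the set of those P containing hk_kernel F *)
Definition hk_kernel (F : set prim) : set A := \bigcap_(P in F) prim_ideal P.

Definition hk_hull (J : set A) : set prim := [set P | J `<=` prim_ideal P].

Definition hk_open (U : set prim) := hk_hull (hk_kernel (~` U)) `<=` ~` U.

Lemma linear_fun0 (V W : lmodType R[i]) (f : V -> W) : linear f -> f 0 = 0.
Proof. by move=> /(_ (-1) 0 0); rewrite scaler0 addr0 scaleN1r addNr. Qed.

Lemma prim_mull (P : prim) x y : prim_ideal P y -> prim_ideal P (x *c y).
Proof.
case: P => P /= [H [pi [[[[pil _] _ piM _] _ _] ->]]] /= y0 h.
by rewrite piM y0; exact: linear_fun0.
Qed.

Lemma prim_mulr (P : prim) x y : prim_ideal P x -> prim_ideal P (x *c y).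
Proof.
case: P => P /= [H [pi [[[_ _ piM _] _ _] ->]]] /= x0 h.
by rewrite piM x0.
Qed.

Lemma prim_proper (P : prim) : exists x, ~ prim_ideal P x.
Proof.
case: P => P /= [H [pi [[_ [x [h xh]] _] ->]]] /=; exists x => /(_ h) x0.
by rewrite x0 eqxx in xh.
Qed.

Lemma prim_prime (P : prim) x y :
  (forall c, prim_ideal P (y *c c *c x)) ->
  prim_ideal P x \/ prim_ideal P y.
Proof.
case: P => P /= [H [pi [[[[pil pic] pill piM _] _ irr] ->]]] /= yx.
pose M := [set k | forall c, pi (y *c c) k = 0].
have /irr[|M0|MT] : closed_subspace M.
  split.
    rewrite (_ : M = \bigcap_c (pi (y *c c) @^-1` [set 0])).
      apply: closed_bigI => c _.
      have /continuous_closedP := pic (y *c c); apply.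
      exact/accessible_closed_set1/hausdorff_accessible/norm_hausdorff.
    by apply/seteqP; split=> k /= Mk c => [_|]; exact: Mk.
  split=> [c|a k l Mk Ml c]; first exact: linear_fun0.
  by rewrite pil Mk Ml scaler0 addr0.
- by move=> x' k Mk c; rewrite -piM -cmulA; exact: Mk.
- left=> h; have : M (pi x h) by move=> c; rewrite -piM; exact: yx.
  by rewrite M0.
- right=> h; have : M h by rewrite MT.
  by move=> /(_ cone); rewrite cmul1r.
Qed.

Lemma hk_openT : hk_open setT.
Proof.
move=> P kP _; have [x Px] := prim_proper P; apply: Px.
by apply: kP => Q; rewrite setCT.
Qed.

Lemma hk_openI : setI_closed hk_open.
Proof.
move=> U V oU oV P /= kP [UP VP].
have [x kx Px] : exists2 x, hk_kernel (~` U) x & ~ prim_ideal P x.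
  apply: contrapT => /forall2NP nx; apply: (oU P _ UP) => x kx.
  by have [//|/contrapT] := nx x.
have [y ky Py] : exists2 y, hk_kernel (~` V) y & ~ prim_ideal P y.
  apply: contrapT => /forall2NP nx; apply: (oV P _ VP) => y ky.
  by have [//|/contrapT] := nx y.
have [|//|//] := @prim_prime P x y.
move=> c; apply: kP => Q; rewrite setCI => -[nU|nV].
- by apply: prim_mull; exact: kx.
- by rewrite -cmulA; apply: prim_mulr; exact: ky.
Qed.

Lemma hk_open_bigcup (I : Type) (f : I -> set prim) :
  (forall i, hk_open (f i)) -> hk_open (\bigcup_i f i).
Proof.
move=> of_ P /= kP [i _ fiP]; apply: (of_ i P _ fiP) => x kx.
by apply: kP => Q /= nQ; apply: kx => /= fQ; apply: nQ; exists i.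
Qed.

HB.instance Definition _ := gen_eqMixin prim.
HB.instance Definition _ := gen_choiceMixin prim.
HB.instance Definition _ :=
  isOpenTopological.Build prim hk_openT hk_openI hk_open_bigcup.

End representations.

Section crossed_products.
Variables (R : realType) (G : groupType).
Implicit Types A B D : cstarAlgType R.
Local Open Scope group_scope.

(* Each alpha g is an automorphism, with inverse alpha g^-1. *)
Definition is_action A (alpha : G -> A -> A) :=
  [/\ forall g, star_hom (alpha g), alpha 1 = id
    & forall g h, alpha (g * h) = alpha g \o alpha h].

Definition unitary_representation D (u : G -> D) :=
  [/\ u 1 = cone, forall g h, u (g * h) = u g *c u h,
      forall g, (u g)^*c *c u g = cone & forall g, u g *c (u g)^*c = cone].

Definition covariant A D (alpha : G -> A -> A) (pi : A -> D) (u : G -> D) :=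
  [/\ star_hom pi, unitary_representation u
    & forall g x, pi (alpha g x) = u g *c pi x *c (u g)^*c].

(* B, with the canonical maps j and u, is the full crossed product of the
   unital C*-algebra A by the discrete group G: it is the closed span of the
   u g j(x), and every covariant pair in a unital C*-algebra D (for instance
   the bounded operators on a Hilbert space) factors through it. *)
Definition is_crossed_product A B (alpha : G -> A -> A) (j : A -> B)
    (u : G -> B) :=
  [/\ covariant alpha j u,
      closed_span [set z | exists g x, z = u g *c j x] = setT
    & forall D (pi : A -> D) (v : G -> D), covariant alpha pi v ->
        exists phi : B -> D,
          [/\ star_hom phi, phi \o j = pi & phi \o u = v]].

(* The ideal of B which is the image of the crossed product of an
   alpha-invariant ideal J of A. *)
Definition crossed_ideal A B (j : A -> B) (u : G -> B) (J : set A) : set B :=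
  closed_span [set z | exists g, exists2 x, J x & z = u g *c j x].

(* The dual group of the discrete group G, with the topology of pointwise
   convergence (which is the compact-open topology). *)
Record dual := Dual {
  dual_fun :> G -> R[i];
  dual_norm1 : forall g, `|dual_fun g|%R = 1%R;
  dualM : forall g h, dual_fun (g * h) = (dual_fun g * dual_fun h)%R
}.

HB.instance Definition _ := gen_eqMixin dual.
HB.instance Definition _ := gen_choiceMixin dual.
HB.instance Definition _ := Topological.copy dual
  (initial_topology (dual_fun : dual -> {ptws G -> R[i]})).

End crossed_products.

Arguments dual R G : clear implicits.

Definition homeo_onto (X Y : topologicalType) (f : X -> Y) (F : set Y) :=
  [/\ injective f, range f = F, continuous f
    & forall U, open U -> exists2 V, open V & f @` U = V `&` F].

(* The additive semigroup of non-negative rationals is {nonneg rat}; the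
   multiplicative group of positive rationals is {posnum rat}. *)
Definition Qpos := {posnum rat}.

Section Qpos_group.
Definition Qpos_one : Qpos := (1 : rat)%:pos.
Definition Qpos_mul (a b : Qpos) : Qpos := (a%:num * b%:num)%:pos.
Definition Qpos_inv (a : Qpos) : Qpos := (a%:num^-1)%:pos.
Fact Qpos_mulA : associative Qpos_mul.
Proof. by move=> a b c; apply/val_inj; rewrite /= mulrA. Qed.
Fact Qpos_mul1 : left_id Qpos_one Qpos_mul.
Proof. by move=> a; apply/val_inj; rewrite /= mul1r. Qed.
Fact Qpos_mulr1 : right_id Qpos_one Qpos_mul.
Proof. by move=> a; apply/val_inj; rewrite /= mulr1. Qed.
Fact Qpos_mulV : left_inverse Qpos_one Qpos_inv Qpos_mul.
Proof. by move=> a; apply/val_inj; rewrite /= mulVf. Qed.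
Fact Qpos_mulrV : right_inverse Qpos_one Qpos_inv Qpos_mul.
Proof. by move=> a; apply/val_inj; rewrite /= mulfV. Qed.
HB.instance Definition _ := Choice.on Qpos.
HB.instance Definition _ := isGroup.Build Qpos
  Qpos_mulA Qpos_mul1 Qpos_mulr1 Qpos_mulV Qpos_mulrV.
End Qpos_group.

Definition Qscale (a : Qpos) (r : {nonneg rat}) : {nonneg rat} :=
  (a%:num * r%:num)%:nng.

Section toeplitz.
Variable R : realType.

Definition orthonormal_basis (H : hilbertType R) (X : choiceType)
    (e : X -> H) :=
  (forall s t, hdot (e s) (e t) = (s == t)%:R) /\ closed_span (range e) = setT.

(* A is generated as a C*-algebra by the T r and faithfully represented on a
   Hilbert space with orthonormal basis (e s), i.e. on l^2 of the non-negative
   rationals, so that T r is the isometry e s |-> e (r + s). *)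
Definition is_toeplitz (A : cstarAlgType R) (T : {nonneg rat} -> A) :=
  smallest (@sub_cstar_algebra R A) (range T) = setT /\
  exists (H : hilbertType R) (e : {nonneg rat} -> H) (pi : A -> H -> H),
    [/\ orthonormal_basis e, is_representation pi, injective pi
      & forall r s, pi (T r) (e s) = e (r%:num + s%:num)%:nng].

End toeplitz.

(* Main.v *)
(* Write V_x for T_x or its adjoint T_{-x}^* according to the sign of x, I0 for
   the crossed product of the commutator ideal, and N for the kernel of
   id x| psi.  Every element b of the crossed product is determined by its
   Fourier coefficients E(u_g^* b), where the conditional expectation E is the
   mean over the dual action; a Folner argument for the positive rationals
   recovers b from them.

   Any nonzero ideal contains I0.  In the natural representation on l^2 of the
   nonnegative rationals, a monomial u_g V_x V_y^* maps a sufficiently small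
   interval [r, r + t) off itself unless it is diagonal.  Compressing b^* b to
   such an interval therefore yields a multiple of its projection, up to a small
   error, so the ideal contains this projection, and all of I0 with it.

   Any ideal properly containing I0 contains N.  Modulo I0 the V_x become
   unitary and u_n V_z u_n^* = V_{nz}.  Averaging the conjugates of b^* b by the
   u_{nc} V_z^* over n <= L kills, up to 1/L and after multiplication by an
   element V_x - 1, everything but a scalar, which is not zero.

   So a primitive ideal is 0, is I0, or contains N.  The first two are the
   kernels of the representations on l^2 of the nonnegative and of all
   rationals, irreducible because suitable elements contract any vector to a
   multiple of a basis vector.  In the last case the representation is
   commutative, hence given by a character.  The topology and the two
   simplicity statements follow from this list of ideals. *)

Require Import Defs.
From HB Require Import structures.
From mathcomp Require Import all_boot all_order all_algebra.
From mathcomp Require Import all_classical all_reals all_analysis.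
From mathcomp Require Import complex.
From mathcomp Require Import ring lra zify.

Set Implicit Arguments.
Unset Strict Implicit.
Unset Printing Implicit Defensive.

Import Order.TTheory GRing.Theory Num.Theory numFieldNormedType.Exports.

Local Open Scope classical_set_scope.
Local Open Scope ring_scope.

(** * Real-valued norms *)

(** The two containment results are proved for closed subspaces [J] that absorb products with [I0],
    respectively with [N], rather than for ideals of the whole algebra. In this form they give the
    simplicity of [I0] and of [N/I0] along with the classification, and they also identify the
    kernels of the two concrete representations. The factor [V_x - 1] in the second averaging
    answers an obstacle: the means of the [V_{ns}] over [n <= L] keep norm 1, since [psi] takes the
    value 1 on them, whereas their products with [V_x - 1] telescope as soon as [x] is an integer
    multiple of [s]. Nothing is lost, because 1 minus the mean of the [V_{nx}] lies in [N] and is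
    almost a unit for [V_x - 1]. Only the universal property of the crossed product is available, so
    homomorphisms must be known to be contractive, and injective ones isometric. Both facts rest on
    square roots, which are limits of a quadratic iteration. The resulting absolute values are used
    again to show that a commutative irreducible representation is a character and to separate
    points of the dual group from closed sets. *)

(* The norm of a complex normed space takes its values in [R[i]]; working with
   its real part gives access to the total order of [R]. *)
Definition nrm (R : realType) (V : normedZmodType R[i]) (x : V) : R :=
  complex.Re `|x|.

Section nrm.
Variable R : realType.

Section zmod.
Variable V : normedZmodType R[i].
Implicit Types x y : V.

Lemma nrmE x : `|x| = ((nrm x)%:C)%C.
Proof. exact/esym/RRe_real/normr_real. Qed.

Lemma nrm_ge0 x : 0 <= nrm x.
Proof. by rewrite -lecR -nrmE; exact: normr_ge0. Qed.

Lemma nrm0 : nrm (0 : V) = 0.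
Proof. by rewrite /nrm normr0. Qed.

Lemma nrm0_eq0 x : nrm x = 0 -> x = 0.
Proof. by move=> x0; apply/eqP; rewrite -normr_eq0 nrmE x0. Qed.

Lemma nrm_gt0 x : x != 0 -> 0 < nrm x.
Proof.
move=> x0; rewrite lt_neqAle nrm_ge0 andbT eq_sym.
by apply: contra x0 => /eqP/nrm0_eq0 ->.
Qed.

Lemma nrmN x : nrm (- x) = nrm x.
Proof. by rewrite /nrm normrN. Qed.

Lemma nrmD x y : nrm (x + y) <= nrm x + nrm y.
Proof. by rewrite -lecR rmorphD /= -!nrmE ler_normD. Qed.

Lemma nrmB x y : nrm (x - y) <= nrm x + nrm y.
Proof. by rewrite -[nrm y]nrmN nrmD. Qed.

Lemma nrm_distC x y : nrm (x - y) = nrm (y - x).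
Proof. by rewrite -nrmN opprB. Qed.

Lemma nrm_tri y x z : nrm (x - z) <= nrm (x - y) + nrm (y - z).
Proof. by have := nrmD (x - y) (y - z); rewrite addrA subrK. Qed.

Lemma nrm_dist x y : `|nrm x - nrm y| <= nrm (x - y).
Proof.
have := nrm_tri y x 0; have := nrm_tri x y 0; rewrite !subr0 (nrm_distC y x).
by rewrite ler_norml; lra.
Qed.

Lemma nrm_sum (I : Type) (r : seq I) (P : pred I) (F : I -> V) :
  nrm (\sum_(i <- r | P i) F i) <= \sum_(i <- r | P i) nrm (F i).
Proof.
apply: (big_ind2 (fun (x : V) (b : R) => nrm x <= b)) => //.
  by rewrite nrm0.
by move=> x a y b xa yb; apply: le_trans (nrmD _ _) _; exact: lerD.
Qed.

End zmod.

Lemma nrm_le (V W : normedZmodType R[i]) (x : V) (y : W) :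
  (nrm x <= nrm y) = (`|x| <= `|y|).
Proof. by rewrite !nrmE lecR. Qed.

Lemma nrm_scale (V : normedModType R[i]) (a : R[i]) (x : V) :
  nrm (a *: x) = nrm a * nrm x.
Proof. by apply/(@complexI R); rewrite rmorphM /= -!nrmE normrZ. Qed.

Lemma nrmcM (a b : R[i]) : nrm (a * b) = nrm a * nrm b.
Proof. by apply/(@complexI R); rewrite rmorphM /= -!nrmE normrM. Qed.

Lemma nrm_real (a : R) : nrm (a%:C)%C = `|a|.
Proof.
by rewrite /nrm normc_def /= expr0n addr0 sqrtr_sqr.
Qed.

Lemma nrm1 : nrm (1 : R[i]) = 1.
Proof. by rewrite /nrm normr1. Qed.

Lemma Re_nrm (a : R[i]) : `|complex.Re a| <= nrm a.
Proof. by rewrite -lecR -nrmE normc_ge_Re. Qed.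

Lemma nrm_real_mul (V : normedModType R[i]) (a : R) (x : V) :
  0 <= a -> nrm ((a%:C)%C *: x) = a * nrm x.
Proof. by move=> a0; rewrite nrm_scale nrm_real ger0_norm. Qed.

Lemma complex_gt0E (e : R[i]) : 0 < e -> exists2 r : R, 0 < r & e = (r%:C)%C.
Proof.
by case: e => a b; rewrite ltcE /= => /andP[/eqP -> a0]; exists a.
Qed.

Lemma closed_nrmP (V : normedModType R[i]) (M : set V) : closed M <->
  forall x, (forall e : R, 0 < e -> exists2 y, M y & nrm (x - y) < e) -> M x.
Proof.
split=> [cM x xM|H x cx].
  apply: cM => U /nbhs_ballP[e /= /complex_gt0E[r r0 ->] eU].
  have [y My xy] := xM _ r0; exists y; split => //; apply: eU.
  by rewrite -ball_normE /= nrmE ltcR.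
apply: H => e e0; have := cx (ball x (e%:C)%C).
have /[swap]/[apply] : nbhs x (ball x (e%:C)%C).
  by apply: nbhsx_ballx; rewrite ltcR.
by move=> [y [My]]; rewrite -ball_normE /= nrmE ltcR => xy; exists y.
Qed.

Lemma nrm_complete (V : completeNormedModType R[i]) (x : nat -> V) :
  (forall e : R, 0 < e -> exists n, forall m, (n <= m)%N -> nrm (x n - x m) < e) ->
  exists l, forall e : R, 0 < e ->
    exists n, forall m, (n <= m)%N -> nrm (l - x m) < e.
Proof.
move=> H.
have : cvg (x @ \oo).
  apply: cauchy_cvg; apply/(@cauchyP R[i] V) => e /complex_gt0E[r r0 ->].
  have [n Hn] := H _ r0; exists (x n); exists n => //= m /= nm.
  by rewrite -ball_normE /= nrmE ltcR Hn.
move=> /cvg_ex[l xl]; exists l => e e0.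
have e0' : 0 < (e%:C)%C :> R[i] by rewrite ltcR.
have /cvgrPdist_lt/(_ _ e0')[n _ Hn] := xl.
by exists n => m nm; have := Hn m nm; rewrite /= nrmE ltcR.
Qed.

End nrm.

Lemma nrm_eq0_le (R : realType) (V : normedZmodType R[i]) (x : V) :
  (forall e : R, 0 < e -> nrm x <= e) -> x = 0.
Proof.
move=> H; apply: nrm0_eq0; apply/le_anti; rewrite nrm_ge0 andbT.
by apply/ler_addgt0Pl => e e0; rewrite addr0 H.
Qed.

(** * Linear combinations, dense spans and bounded extension *)

Lemma small_invS (R : realType) (e : R) : 0 < e ->
  exists n, forall m, (n <= m)%N -> m.+1%:R^-1 < e.
Proof.
move=> e0; exists (Num.truncn e^-1) => m nm.
rewrite -[e]invrK ltf_pV2 ?posrE ?invr_gt0 ?ltr0n//.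
have := truncnS_gt (e^-1); move=> /lt_le_trans; apply.
by rewrite ler_nat ltnS.
Qed.

Section linear.
Variables (K : pzRingType) (V W : lmodType K) (f : V -> W).
Hypothesis lf : linear f.

Lemma lin0 : f 0 = 0.
Proof. by have := lf (-1) 0 0; rewrite scaler0 addr0 scaleN1r addNr. Qed.

Lemma linD x y : f (x + y) = f x + f y.
Proof. by have := lf 1 x y; rewrite !scale1r. Qed.

Lemma linZ a x : f (a *: x) = a *: f x.
Proof. by have := lf a x 0; rewrite lin0 !addr0. Qed.

Lemma linN x : f (- x) = - f x.
Proof. by rewrite -scaleN1r linZ scaleN1r. Qed.

Lemma linB x y : f (x - y) = f x - f y.
Proof. by rewrite linD linN. Qed.

Lemma lin_sum (I : Type) (r : seq I) (P : pred I) (F : I -> V) :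
  f (\sum_(i <- r | P i) F i) = \sum_(i <- r | P i) f (F i).
Proof.
by apply: (big_morph f); [exact: linD | exact: lin0].
Qed.

End linear.

Section lcomb.
Variable R : realType.

(** Formal combinations: indices may repeat in [l] and different lists can have the same value, so a
    map defined on lists has to be shown well defined on values. *)
Definition lcomb (X : Type) (V : lmodType R[i]) (t : X -> V)
  (l : seq (R[i] * X)) : V := \sum_(p <- l) p.1 *: t p.2.

Section lmod.
Variables (X : Type) (V W : lmodType R[i]).
Implicit Types (t : X -> V) (M : set V).

Lemma lcomb_cat t l m : lcomb t (l ++ m) = lcomb t l + lcomb t m.
Proof. by rewrite /lcomb big_cat. Qed.

Lemma lcombZ t a l :
  lcomb t [seq (a * p.1, p.2) | p <- l] = a *: lcomb t l.
Proof.
by rewrite /lcomb big_map scaler_sumr; apply: eq_bigr => p _; rewrite scalerA.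
Qed.

Lemma lcombB t l m :
  lcomb t (l ++ [seq (-1 * p.1, p.2) | p <- m]) = lcomb t l - lcomb t m.
Proof. by rewrite lcomb_cat lcombZ scaleN1r. Qed.

Lemma lcomb1 t x : lcomb t [:: (1, x)] = t x.
Proof. by rewrite /lcomb big_seq1 scale1r. Qed.

Lemma lin_lcomb t (f : V -> W) l : linear f -> f (lcomb t l) = lcomb (f \o t) l.
Proof.
by move=> lf; rewrite /lcomb lin_sum//; apply: eq_bigr => p _; rewrite linZ.
Qed.

Lemma lsubZ M a x : linear_subspace M -> M x -> M (a *: x).
Proof. by move=> [M0 Ml] Mx; have := Ml a _ _ Mx M0; rewrite addr0. Qed.

Lemma lsubD M x y : linear_subspace M -> M x -> M y -> M (x + y).
Proof. by move=> [M0 Ml] Mx My; have := Ml 1 _ _ Mx My; rewrite scale1r. Qed.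

Lemma lsubN M x : linear_subspace M -> M x -> M (- x).
Proof. by move=> lM Mx; rewrite -scaleN1r; exact: lsubZ. Qed.

Lemma lsubB M x y : linear_subspace M -> M x -> M y -> M (x - y).
Proof. by move=> lM Mx My; apply: lsubD => //; exact: lsubN. Qed.

Lemma lsub_sum M (I : eqType) (r : seq I) (P : pred I) (F : I -> V) :
  linear_subspace M -> (forall i, i \in r -> P i -> M (F i)) ->
  M (\sum_(i <- r | P i) F i).
Proof.
move=> lM MF; rewrite big_seq_cond; apply: (big_ind M) => [|x y|i /andP[]].
- by case: lM.
- exact: lsubD.
- exact: MF.
Qed.

End lmod.

Section closed_span.
Variables (X : Type) (V : normedModType R[i]).
Implicit Types (t : X -> V) (M S : set V).

Lemma closed_span_closed S : closed_subspace (closed_span S).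
Proof.
rewrite /closed_span /smallest; split.
  by apply: closed_bigI => M [[]].
split=> [M [[_ []]]//|a x y Sx Sy M SM].
by case: (SM) => -[_ [_ Ml]] _; apply: Ml; [exact: Sx | exact: Sy].
Qed.

Lemma sub_closed_span S : S `<=` closed_span S.
Proof. exact: sub_smallest. Qed.

Lemma closed_span_min S M :
  closed_subspace M -> S `<=` M -> closed_span S `<=` M.
Proof. exact: smallest_sub. Qed.

Lemma closed_subspace_nrm M : linear_subspace M ->
  (forall x, (forall e : R, 0 < e -> exists2 y, M y & nrm (x - y) < e) -> M x) ->
  closed_subspace M.
Proof. by move=> lM cM; split=> //; exact/closed_nrmP. Qed.

Lemma closed_subspace_approx M x : closed_subspace M ->
  (forall e : R, 0 < e -> exists2 y, M y & nrm (x - y) < e) -> M x.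
Proof. by move=> [/closed_nrmP cM _]; exact: cM. Qed.

Lemma closed_span_lcomb t x : closed_span (range t) x ->
  forall e : R, 0 < e -> exists l, nrm (x - lcomb t l) < e.
Proof.
pose M := [set x | forall e : R, 0 < e -> exists l, nrm (x - lcomb t l) < e].
move: x; apply: (@closed_span_min _ M); last first.
  move=> _ [x _ <-] e e0; exists [:: (1, x)].
  by rewrite lcomb1 subrr nrm0.
apply: closed_subspace_nrm.
  split=> [e e0|a x y Mx My e e0].
    by exists [::]; rewrite /lcomb big_nil subrr nrm0.
  have ha : 0 < nrm a + 1 by rewrite ltr_wpDl ?nrm_ge0.
  have [l xl] := Mx (e / 2 / (nrm a + 1)) ltac:(by rewrite !divr_gt0).
  have [m ym] := My (e / 2) ltac:(by rewrite divr_gt0).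
  exists ([seq (a * p.1, p.2) | p <- l] ++ m).
  rewrite lcomb_cat lcombZ opprD addrACA -scalerBr.
  apply: le_lt_trans (nrmD _ _) _; rewrite nrm_scale.
  rewrite [e]splitr ler_ltD//.
  rewrite ltr_pdivlMr// mulrC in xl.
  by apply: le_trans (ltW xl); rewrite ler_wpM2r ?nrm_ge0// lerDl.
move=> x H e e0; have e2 : 0 < e / 2 by rewrite divr_gt0.
have [y My xy] := H _ e2; have [l yl] := My _ e2.
exists l; apply: le_lt_trans (nrm_tri y _ _) _.
by rewrite [e]splitr ltrD.
Qed.

Lemma closed_subspace0 : closed_subspace [set 0 : V].
Proof.
apply: closed_subspace_nrm.
  by split=> // a x y /= -> ->; rewrite scaler0 addr0.
move=> x H /=; apply: nrm_eq0_le => e e0.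
by have [y -> /ltW] := H e e0; rewrite subr0.
Qed.

End closed_span.

Section bounded.
Variables (V W : normedModType R[i]).

Definition bounded_by (c : R) (f : V -> W) :=
  forall x, nrm (f x) <= c * nrm x.

Lemma closed_subspace_preimage (c : R) (f : V -> W) (M : set W) :
  linear f -> bounded_by c f -> closed_subspace M ->
  closed_subspace (f @^-1` M).
Proof.
move=> lf bf cM; have [_ [M0 Ml]] := cM.
apply: closed_subspace_nrm.
  by split=> [|a x y Mx My] /=; rewrite ?lin0 ?lf//; exact: Ml.
move=> x H /=; apply: closed_subspace_approx => // e e0.
have c0 : 0 < `|c| + 1 by rewrite ltr_wpDl.
have [y My xy] := H (e / (`|c| + 1)) ltac:(by rewrite divr_gt0).
exists (f y) => //; rewrite -linB//; apply: le_lt_trans (bf _) _.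
rewrite ltr_pdivlMr// mulrC in xy; apply: le_lt_trans xy.
by rewrite ler_wpM2r ?nrm_ge0//; have := ler_norm c; lra.
Qed.

Lemma closed_subspace_eq (c d : R) (f g : V -> W) :
  linear f -> linear g -> bounded_by c f -> bounded_by d g ->
  closed_subspace [set x | f x = g x].
Proof.
move=> lf lg bf bg; pose h x := f x - g x.
have lh : linear h.
  by move=> a u v; rewrite /h lf lg scalerBr opprD addrACA.
have bh : bounded_by (c + d) h.
  by move=> u; apply: le_trans (nrmB _ _) _; rewrite mulrDl lerD ?bf ?bg.
have -> : [set x | f x = g x] = h @^-1` [set 0].
  by apply/seteqP; split=> x /=; [rewrite /h => ->; exact: subrr | move=> /subr0_eq].
exact: closed_subspace_preimage lh bh (@closed_subspace0 W).
Qed.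

Lemma lin_eq_dense (c d : R) (f g : V -> W) (S : set V) :
  linear f -> linear g -> bounded_by c f -> bounded_by d g ->
  closed_span S = setT -> (forall x, S x -> f x = g x) -> f = g.
Proof.
move=> lf lg bf bg ST fg; apply/funext => x.
have xS : closed_span S x by rewrite ST.
exact: (closed_span_min (closed_subspace_eq lf lg bf bg) fg xS).
Qed.

End bounded.

(** The constants [c] and [d] give continuity only and may be crude; the inequality checked on
    combinations passes to the limit. A rough bound is thus improved to a sharp one. *)
Lemma le_dense (X : Type) (V W U : normedModType R[i]) (t : X -> V) (c d : R)
    (f : V -> W) (g : V -> U) :
  linear f -> linear g -> bounded_by c f -> bounded_by d g ->
  closed_span (range t) = setT ->
  (forall l, nrm (f (lcomb t l)) <= nrm (g (lcomb t l))) ->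
  forall x, nrm (f x) <= nrm (g x).
Proof.
move=> lf lg bf bg ST fg x; apply/ler_addgt0Pr => e e0.
have h0 : 0 < `|c| + `|d| + 1 by rewrite ltr_wpDl// addr_ge0.
have xS : closed_span (range t) x by rewrite ST.
have [l xl] := closed_span_lcomb xS (e := e / (`|c| + `|d| + 1))
  ltac:(by rewrite divr_gt0).
rewrite ltr_pdivlMr// in xl.
set y := lcomb t l in xl *.
have fxy : nrm (f x) <= nrm (f y) + `|c| * nrm (x - y).
  rewrite -[x in f x](subrK y) linD// addrC; apply: le_trans (nrmD _ _) _.
  rewrite lerD2l; apply: le_trans (bf _) _.
  by rewrite ler_wpM2r ?nrm_ge0// ler_norm.
have gxy : nrm (g y) <= nrm (g x) + `|d| * nrm (x - y).
  rewrite -[y in g y](subKr x) linB//; apply: le_trans (nrmB _ _) _.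
  rewrite lerD2l; apply: le_trans (bg _) _.
  by rewrite ler_wpM2r ?nrm_ge0// ler_norm.
have := fg l; rewrite -/y => fgl.
have := nrm_ge0 (x - y); move: fxy gxy xl; rewrite !mulrDr mulr1.
rewrite ![nrm (x - y) * _]mulrC; lra.
Qed.

(** The inequality, taken on differences of lists, makes the assignment of [s x] to [t x] well
    defined and Lipschitz on the span; completeness of [W] extends it to the closure. *)
Lemma bounded_extension (X : Type) (V : normedModType R[i])
    (W : completeNormedModType R[i]) (t : X -> V) (s : X -> W) (c : R) :
  0 <= c -> closed_span (range t) = setT ->
  (forall l, nrm (lcomb s l) <= c * nrm (lcomb t l)) ->
  exists f : V -> W, [/\ linear f, bounded_by c f & forall x, f (t x) = s x].
Proof.
move=> c0 tT H.
(* The closure of the graph of [lcomb t l |-> lcomb s l]. *)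
pose rel x y := forall e : R, 0 < e ->
  exists2 l, nrm (x - lcomb t l) < e & nrm (y - lcomb s l) < e.
have relE x y : rel x y -> nrm y <= c * nrm x.
  move=> xy; apply/ler_addgt0Pr => e e0.
  have [l xl yl] := xy (e / (c + 1)) ltac:(by rewrite divr_gt0// ltr_wpDl).
  have y1 : nrm y <= nrm (y - lcomb s l) + nrm (lcomb s l).
    by rewrite -[y in nrm y](subrK (lcomb s l)) nrmD.
  have x1 : nrm (lcomb t l) <= nrm x + nrm (x - lcomb t l).
    by rewrite -[in leLHS](subKr x (lcomb t l)) nrmB.
  have := ler_wpM2l c0 x1; rewrite mulrDr; have := H l.
  have : c * nrm (x - lcomb t l) <= c * (e / (c + 1)).
    by rewrite ler_wpM2l// ltW.
  have -> : c * (e / (c + 1)) = e - e / (c + 1) by field; lra.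
  by move: y1 yl; lra.
have rel_lin a x y x' y' : rel x y -> rel x' y' -> rel (a *: x + x') (a *: y + y').
  move=> xy xy' e e0.
  have ha : 0 < nrm a + 1 by rewrite ltr_wpDl ?nrm_ge0.
  have [l xl yl] := xy (e / 2 / (nrm a + 1)) ltac:(by rewrite !divr_gt0).
  have [m xm ym] := xy' (e / 2) ltac:(by rewrite divr_gt0).
  exists ([seq (a * p.1, p.2) | p <- l] ++ m);
    rewrite lcomb_cat lcombZ opprD addrACA -scalerBr;
    (apply: le_lt_trans (nrmD _ _) _); rewrite nrm_scale [e]splitr ler_ltD//.
  - rewrite ltr_pdivlMr// mulrC in xl.
    by apply: le_trans (ltW xl); rewrite ler_wpM2r ?nrm_ge0// lerDl.
  - rewrite ltr_pdivlMr// mulrC in yl.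
    by apply: le_trans (ltW yl); rewrite ler_wpM2r ?nrm_ge0// lerDl.
have rel_total x : exists y, rel x y.
  have xS : closed_span (range t) x by rewrite tT.
  have /choice[l lP] : forall n : nat, exists l, nrm (x - lcomb t l) < n.+1%:R^-1.
    by move=> n; apply: closed_span_lcomb => //; rewrite invr_gt0 ltr0n.
  have [e e0|y yP] := @nrm_complete R W (fun n => lcomb s (l n)).
    have e' : 0 < e / 2 / (c + 1) by rewrite !divr_gt0// ltr_wpDl.
    have [n nP] := small_invS e'.
    exists n => m nm; rewrite -lcombB; apply: le_lt_trans (H _) _.
    rewrite lcombB.
    have : nrm (lcomb t (l n) - lcomb t (l m)) < e / (c + 1).
      rewrite (_ : e / (c + 1) = e / 2 / (c + 1) + e / 2 / (c + 1)); last first.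
        by rewrite -mulrDl -splitr.
      apply: le_lt_trans (nrm_tri x _ _) _; rewrite nrm_distC ltrD//.
        by apply: lt_trans (lP n) _; exact: nP.
      by apply: lt_trans (lP m) _; exact: nP.
    move=> h; apply: (@le_lt_trans _ _ (c * (e / (c + 1)))).
      by rewrite ler_wpM2l// ltW.
    by rewrite mulrA ltr_pdivrMr ?ltr_wpDl// mulrC mulrDr mulr1 ltrDl.
  exists y => e e0; have [n nP] := yP _ e0; have [m mP] := small_invS e0.
  exists (l (maxn n m)); last by apply: nP; rewrite leq_maxl.
  by apply: lt_trans (lP _) _; apply: mP; rewrite leq_maxr.
have [f fP] := choice rel_total.
have rel_fun x y y' : rel x y -> rel x y' -> y = y'.
  move=> xy xy'; apply/esym/subr0_eq/nrm0_eq0/le_anti; rewrite nrm_ge0 andbT.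
  have := relE _ _ (rel_lin (-1) _ _ _ _ xy xy').
  by rewrite !scaleN1r addNr nrm0 mulr0 addrC.
exists f; split=> [a x y|x|x].
- by apply: rel_fun (fP _) _; exact: rel_lin.
- exact: relE.
- apply: rel_fun (fP _) _ => e e0; exists [:: (1, x)];
  by rewrite lcomb1 subrr nrm0.
Qed.

End lcomb.

(** * Square roots in C*-algebras and automatic continuity *)

Section cstar_theory.
Variables (R : realType) (A : cstarAlgType R).
Implicit Types (x y z w : A) (a b : R[i]).

Lemma cmulDl x y z : (x + y) *c z = x *c z + y *c z.
Proof. by have := cmul_linearl 1 x y z; rewrite !scale1r. Qed.

Lemma cmulDr x y z : z *c (x + y) = z *c x + z *c y.
Proof. by have := cmul_linearr 1 x y z; rewrite !scale1r. Qed.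

Lemma cmul0l x : (0 : A) *c x = 0.
Proof. by apply: (addrI (0 *c x)); rewrite -cmulDl !addr0. Qed.

Lemma cmul0r x : x *c (0 : A) = 0.
Proof. by apply: (addrI (x *c 0)); rewrite -cmulDr !addr0. Qed.

Lemma cmulZl a x y : (a *: x) *c y = a *: (x *c y).
Proof. by have := cmul_linearl a x 0 y; rewrite !addr0 cmul0l addr0. Qed.

Lemma cmulZr a x y : y *c (a *: x) = a *: (y *c x).
Proof. by have := cmul_linearr a x 0 y; rewrite !addr0 cmul0r addr0. Qed.

Lemma cmulNl x y : (- x) *c y = - (x *c y).
Proof. by rewrite -scaleN1r cmulZl scaleN1r. Qed.

Lemma cmulNr x y : x *c (- y) = - (x *c y).
Proof. by rewrite -scaleN1r cmulZr scaleN1r. Qed.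

Lemma cmulBl x y z : (x - y) *c z = x *c z - y *c z.
Proof. by rewrite cmulDl cmulNl. Qed.

Lemma cmulBr x y z : z *c (x - y) = z *c x - z *c y.
Proof. by rewrite cmulDr cmulNr. Qed.

Lemma linear_cmull x : linear (fun y => x *c y).
Proof. by move=> a y z; rewrite cmul_linearr. Qed.

Lemma linear_cmulr x : linear (fun y => y *c x).
Proof. by move=> a y z; rewrite cmul_linearl. Qed.

Lemma starD x y : (x + y)^*c = x^*c + y^*c.
Proof. by have := star_semilinear 1 x y; rewrite rmorph1 !scale1r. Qed.

Lemma star0 : (0 : A)^*c = 0.
Proof. by apply: (addrI (0^*c)); rewrite -starD !addr0. Qed.

Lemma starZ a x : (a *: x)^*c = (a^*)%C *: x^*c.
Proof. by have := star_semilinear a x 0; rewrite star0 !addr0. Qed.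

Lemma starN x : (- x)^*c = - x^*c.
Proof. by rewrite -scaleN1r starZ rmorphN1 scaleN1r. Qed.

Lemma starB x y : (x - y)^*c = x^*c - y^*c.
Proof. by rewrite starD starN. Qed.

Lemma star1 : (cone : A)^*c = cone.
Proof. by rewrite -[LHS]cmul1l -[X in X *c _]starK -starM cmul1l starK. Qed.

Lemma nrmM x y : nrm (x *c y) <= nrm x * nrm y.
Proof. by rewrite -lecR rmorphM /= -!nrmE cnormM. Qed.

Lemma nrm_starM x : nrm (x^*c *c x) = nrm x ^+ 2.
Proof. by apply/(@complexI R); rewrite rmorphXn /= -!nrmE cnorm_star. Qed.

Lemma nrm_star x : nrm x^*c = nrm x.
Proof.
have H y : nrm y <= nrm y^*c.
  have [->|/nrm_gt0 y0] := eqVneq y 0; first by rewrite nrm0 nrm_ge0.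
  by have := nrmM (y^*c) y; rewrite nrm_starM expr2 ler_pM2r.
by apply/le_anti; rewrite H andbT; have := H x^*c; rewrite starK.
Qed.

Lemma nrm_cone : nrm (cone : A) <= 1.
Proof.
have := nrm_starM cone; rewrite star1 cmul1l => H.
by have := nrm_ge0 (cone : A); nra.
Qed.

Lemma nrm_unitary x : x^*c *c x = cone -> nrm x <= 1.
Proof.
move=> xx; have := nrm_starM x; rewrite xx => /esym H.
by have := nrm_cone; have := nrm_ge0 x; rewrite -H; nra.
Qed.

Lemma bounded_cmull x : bounded_by (nrm x) (fun y => x *c y).
Proof. by move=> y; rewrite nrmM. Qed.

Lemma bounded_cmulr x : bounded_by (nrm x) (fun y => y *c x).
Proof. by move=> y; rewrite mulrC nrmM. Qed.

(* [h + i k] is [sqrt t] times a unitary, with real part [h]. *)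
Lemma nrm_sum_squares (t : R) x y : x^*c = x -> y^*c = y ->
  x *c y = y *c x -> x *c x + y *c y = ((t%:C)%C *: cone) -> 0 <= t ->
  nrm x ^+ 2 <= t.
Proof.
move=> xs ys xy xyt t0; pose w := x + ('i)%C *: y.
have ws : w^*c = x - ('i)%C *: y.
  rewrite /w starD starZ xs ys -scaleNr; congr (_ + _ *: _).
  by apply/eqP; rewrite eq_complex /= oppr0 !eqxx.
have ww : w^*c *c w = ((t%:C)%C *: cone).
  rewrite ws /w cmulDr !cmulBl !cmulZl !cmulZr -xyt scalerA xy.
  by rewrite -expr2 sqr_i scaleN1r opprK addrA subrK.
have w2 : nrm w ^+ 2 <= t.
  rewrite -nrm_starM ww nrm_real_mul//.
  by have := nrm_cone; nra.
have : nrm (w + w^*c) <= 2 * nrm w.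
  by apply: le_trans (nrmD _ _) _; rewrite nrm_star; lra.
rewrite ws /w addrACA subrr addr0 -mulr2n -scaler_nat.
have -> : (2 : R[i]) = ((2 : R)%:C)%C by rewrite rmorph_nat.
rewrite nrm_real_mul// -/w => H.
by have := nrm_ge0 x; nra.
Qed.

Let half : R[i] := ((2^-1 : R)%:C)%C.

(** A fixed point z satisfies (1 - z)^2 = 1 - x, so the limit yields a square root of 1 - x. *)
Fixpoint sqrt_iter x n : A :=
  if n is m.+1 then half *: (x + sqrt_iter x m *c sqrt_iter x m) else 0.

Let halfD : half + half = 1.
Proof.
by rewrite /half -rmorphD /= -mulr2n -(mulr_natl (2^-1)) mulfV// ?pnatr_eq0.
Qed.

Let nrm_half x : nrm (half *: x) = 2^-1 * nrm x.
Proof. by rewrite nrm_real_mul// invr_ge0. Qed.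

(** The same iteration for the scalar 1. On the unit ball the map is not a uniform contraction;
    convergence comes from majorising its increments by those of this increasing bounded
    sequence. *)
Fixpoint sqrt_iter_bound n : R :=
  if n is m.+1 then 2^-1 * (1 + sqrt_iter_bound m ^+ 2) else 0.

Lemma sqrt_iter_bound01 n :
  0 <= sqrt_iter_bound n <= 1 /\ sqrt_iter_bound n <= sqrt_iter_bound n.+1.
Proof.
have H k : 0 <= sqrt_iter_bound k <= 1.
  by elim: k => [|k /andP[]] /=; [lra | nra].
by split=> //=; have := H n; nra.
Qed.

Lemma sqrt_iter_le x n : nrm x <= 1 ->
  nrm (sqrt_iter x n) <= sqrt_iter_bound n /\
  nrm (sqrt_iter x n.+1 - sqrt_iter x n) <=
    sqrt_iter_bound n.+1 - sqrt_iter_bound n.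
Proof.
move=> x1.
have H k : nrm (sqrt_iter x k) <= sqrt_iter_bound k.
  elim: k => [|k IH] /=; first by rewrite nrm0.
  rewrite nrm_half ler_pM2l//; apply: le_trans (nrmD _ _) _.
  rewrite lerD//; apply: le_trans (nrmM _ _) _.
  by rewrite expr2 ler_pM ?nrm_ge0.
split=> //; elim: n => [|n IH].
  rewrite /= cmul0l addr0 subr0 nrm_half; nra.
rewrite [sqrt_iter x n.+2]/= [in X in _ - X]/= -scalerBr nrm_half.
set z := sqrt_iter x n.+1 in IH *; set w := sqrt_iter x n in IH *.
rewrite opprD addrACA subrr add0r.
have -> : z *c z - w *c w = (z - w) *c z + w *c (z - w).
  by rewrite cmulBl cmulBr addrA subrK.
have zb : nrm z <= sqrt_iter_bound n.+1 by exact: H.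
have wb : nrm w <= sqrt_iter_bound n by exact: H.
have h1 := le_trans (nrmM (z - w) z) (ler_pM (nrm_ge0 _) (nrm_ge0 _) IH zb).
have h2 := le_trans (nrmM w (z - w)) (ler_pM (nrm_ge0 _) (nrm_ge0 _) wb IH).
have h3 := nrmD ((z - w) *c z) (w *c (z - w)).
have E : sqrt_iter_bound n.+2 - sqrt_iter_bound n.+1 =
  2^-1 * ((sqrt_iter_bound n.+1 - sqrt_iter_bound n) * sqrt_iter_bound n.+1 +
  sqrt_iter_bound n * (sqrt_iter_bound n.+1 - sqrt_iter_bound n)).
  set r := sqrt_iter_bound n.+1.
  have rE : r = 2^-1 * (1 + sqrt_iter_bound n ^+ 2) by [].
  have -> : sqrt_iter_bound n.+2 = 2^-1 * (1 + r ^+ 2) by [].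
  by rewrite [X in _ - X]rE; field.
by rewrite E ler_pM2l//; apply: le_trans h3 _; exact: lerD.
Qed.

(** The last clause transports to the limit every closed condition preserved by the iteration; it is
    applied to selfadjointness and to commutation with a given element. *)
Lemma sqrt_iter_cvg x : nrm x <= 1 ->
  exists z, [/\ half *: (x + z *c z) = z, nrm z <= 1 &
    forall M : set A, closed M -> M 0 ->
      (forall w, M w -> M (half *: (x + w *c w))) -> M z].
Proof.
move=> x1; pose s := sqrt_iter_bound.
have [e e0|z zP] := @nrm_complete R A (sqrt_iter x).
  have hs : has_sup (range s).
    split; first by exists (s 0%N); exists 0%N.
    exists 1 => _ [n _ <-].
    by have [/andP[]] := sqrt_iter_bound01 n.
  have [_ [n _ <-] ns] := sup_adherent e0 hs; exists n => m nm.
  have sm : s m <= sup (range s) by apply: ub_le_sup; [case: hs | exists m].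
  suff : nrm (sqrt_iter x n - sqrt_iter x m) <= s m - s n.
    by move=> /le_lt_trans; apply; rewrite -/s in ns; lra.
  move: nm => /subnKC <-; elim: (m - n)%N => [|k IH].
    by rewrite addn0 !subrr nrm0.
  rewrite addnS; have [_] := sqrt_iter_le (n + k) x1; rewrite -/s.
  have := nrm_tri (sqrt_iter x (n + k)) (sqrt_iter x n) (sqrt_iter x (n + k).+1).
  by rewrite (nrm_distC (sqrt_iter x (n + k))); lra.
have z1 : nrm z <= 1.
  apply/ler_addgt0Pl => e e0; have [n /(_ n (leqnn _)) nP] := zP _ e0.
  have [h _] := sqrt_iter_le n x1; have [/andP[_ h'] _] := sqrt_iter_bound01 n.
  have := nrmD (z - sqrt_iter x n) (sqrt_iter x n); rewrite subrK; lra.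
exists z; split=> //.
  apply/subr0_eq/nrm_eq0_le => e e0.
  have [n nP] := zP (e / 2) ltac:(by rewrite divr_gt0).
  have h1 := nP n.+1 (leqnSn n); have h0 := nP n (leqnn n).
  set w := sqrt_iter x n in h0.
  have h2 : nrm (half *: (x + z *c z) - sqrt_iter x n.+1) < e / 2.
    rewrite [sqrt_iter x n.+1]/= -/w -scalerBr opprD addrACA subrr add0r.
    have -> : z *c z - w *c w = (z - w) *c z + w *c (z - w).
      by rewrite cmulBl cmulBr addrA subrK.
    have w1 : nrm w <= 1.
      have [h _] := sqrt_iter_le n x1; rewrite -/w in h.
      have [/andP[_ h'] _] := sqrt_iter_bound01 n; lra.
    rewrite nrm_half; apply: le_lt_trans h0.
    have := nrmD ((z - w) *c z) (w *c (z - w)).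
    have := nrmM (z - w) z; have := nrmM w (z - w).
    have := nrm_ge0 (z - w); have := nrm_ge0 z; have := nrm_ge0 w; nra.
  have := nrm_tri (sqrt_iter x n.+1) (half *: (x + z *c z)) z.
  rewrite (nrm_distC (sqrt_iter x n.+1)); lra.
move=> M /closed_nrmP cM M0 MS; apply: cM => e /zP[n /(_ n (leqnn _)) h].
by exists (sqrt_iter x n) => //; elim: n {h} => //= n IH; exact: MS.
Qed.

Lemma closed_star_fixed : closed [set x : A | x^*c = x].
Proof.
apply/closed_nrmP => x H /=; apply/subr0_eq/nrm_eq0_le => e e0.
have [y /= ys xy] := H (e / 2) ltac:(by rewrite divr_gt0).
have := nrm_tri y x^*c x.
have -> : x^*c - y = (x - y)^*c by rewrite starB ys.
rewrite nrm_star.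
by rewrite (nrm_distC y); lra.
Qed.

Lemma closed_commute w : closed [set x : A | w *c x = x *c w].
Proof.
apply/closed_nrmP => x H /=; apply/subr0_eq/nrm_eq0_le => e e0.
have c0 : 0 < 2 * nrm w + 1 by have := nrm_ge0 w; lra.
have [y /= wy xy] := H (e / (2 * nrm w + 1)) ltac:(by rewrite divr_gt0).
have -> : w *c x - x *c w = w *c (x - y) - (x - y) *c w.
  by rewrite cmulBl cmulBr wy opprB addrA subrK.
have := nrmB (w *c (x - y)) ((x - y) *c w).
have := nrmM w (x - y); have := nrmM (x - y) w.
rewrite ltr_pdivlMr// in xy; have := nrm_ge0 (x - y); nra.
Qed.

(** The bound on 1 - y allows the construction to be iterated, and the commutation clause stands for
    the fact that [y] lies in the closed algebra generated by [x] and 1. *)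
Lemma cstar_sqrt x : x^*c = x -> nrm x <= 1 -> exists y,
  [/\ y^*c = y, y *c y = cone - x, nrm (cone - y) <= 1 &
   forall w, w *c x = x *c w -> w *c y = y *c w].
Proof.
move=> xs x1; have [z [zE z1 zM]] := sqrt_iter_cvg x1.
have hr : (half^*)%C = half by rewrite conjc_real.
exists (cone - z); split.
- rewrite starB star1; congr (_ - _).
  apply: (zM _ closed_star_fixed) => [|w /= ws]; first exact: star0.
  by rewrite starZ hr starD xs starM ws.
- have xE : x + z *c z = z + z by rewrite -[LHS]scale1r -halfD scalerDl zE.
  have -> : x = z + z - z *c z by rewrite -xE addrK.
  rewrite cmulBl !cmulBr !cmul1l cmul1r !opprB opprD !addrA.
  by congr (_ - _); rewrite addrAC.
- by rewrite opprB addrC subrK.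
move=> w wx; rewrite cmulBl cmulBr cmul1l cmul1r; congr (_ - _).
have : [set v | w *c v = v *c w] z => [|//].
apply: (zM _ (@closed_commute w)) => [|v /= wv]; first by rewrite /= cmul0l cmul0r.
by rewrite cmulZl cmulZr cmulDl cmulDr wx cmulA wv -cmulA wv cmulA.
Qed.

(* [y *c y] is the absolute value of [x]. *)
Lemma cstar_abs x : x^*c = x -> nrm x <= 1 -> exists y,
  [/\ y^*c = y, y *c y *c (y *c y) = x *c x &
   forall w, w *c x = x *c w -> w *c y = y *c w].
Proof.
move=> xs x1.
have xx1 : nrm (x *c x) <= 1.
  by have := nrmM x x; have := nrm_ge0 x; nra.
have comm w : w *c x = x *c w -> w *c (x *c x) = x *c x *c w.
  by move=> wx; rewrite cmulA wx -cmulA wx cmulA.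
(* Three roots in succession: k of 1 - x^2, then a of 1 - k^2, which is |x|, then b of 1 - (1 - a),
   the root of |x|. *)
have [k [ks kk _ kc]] := cstar_sqrt (x := x *c x) ltac:(by rewrite starM xs) xx1.
have kkn : nrm (k *c k) <= 1.
  have k1 : nrm k ^+ 2 <= 1.
    apply: (@nrm_sum_squares 1 k x) => //.
      by rewrite -kc// cmulA.
    by rewrite kk subrK scale1r.
  by apply: le_trans (nrmM _ _) _; rewrite -expr2.
have [a [as_ aa a1 ac]] := cstar_sqrt (x := k *c k) ltac:(by rewrite starM ks) kkn.
have [b [bs bb _ bc]] := cstar_sqrt (x := cone - a)
  ltac:(by rewrite starB star1 as_) a1.
rewrite subKr in bb; exists b; split => //.
  by rewrite bb aa kk subKr.
move=> w wx; apply: bc; rewrite cmulBl cmulBr cmul1l cmul1r ac//.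
by have := kc _ (comm _ wx) => wk; rewrite cmulA wk -cmulA wk cmulA.
Qed.

End cstar_theory.

Section star_hom.
Variable R : realType.
Implicit Types A B : cstarAlgType R.

Lemma nrm_le_sqr A B (f : A -> B) : star_hom f ->
  (forall x, x^*c = x -> nrm (f x) <= nrm x) -> bounded_by 1 f.
Proof.
move=> [lf f1 fM fs] H x; rewrite mul1r.
have := H (x^*c *c x); rewrite starM starK => /(_ erefl).
rewrite fM fs !nrm_starM.
by have := nrm_ge0 x; have := nrm_ge0 (f x); nra.
Qed.

(** For a selfadjoint contraction h and y^2 = 1 - h^2, the element f(h) + i f(y) is unitary with
    real part f(h); the C*-identity reduces the general case to selfadjoint elements. *)
Lemma star_hom_bounded A B (f : A -> B) : star_hom f -> bounded_by 1 f.
Proof.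
move=> hf; have [lf f1 fM fs] := hf; apply: nrm_le_sqr => // x xs.
have [->|x0] := eqVneq x 0; first by rewrite lin0// !nrm0.
have nx0 := nrm_gt0 x0.
pose h := (((nrm x)^-1)%:C)%C *: x.
have xh : x = ((nrm x)%:C)%C *: h.
  by rewrite /h scalerA -rmorphM /= mulfV ?scale1r// gt_eqF.
have hs : h^*c = h by rewrite /h starZ conjc_real xs.
have h1 : nrm h <= 1.
  by rewrite /h nrm_real_mul ?invr_ge0 ?nrm_ge0// mulVf ?gt_eqF.
have hh1 : nrm (h *c h) <= 1.
  by have := nrmM h h; have := nrm_ge0 h; nra.
have [y [ys yy _ yc]] := cstar_sqrt (x := h *c h) ltac:(by rewrite starM hs) hh1.
have fh : nrm (f h) ^+ 2 <= 1.
  apply: (@nrm_sum_squares _ _ 1 (f h) (f y)) => //.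
  - by rewrite -fs hs.
  - by rewrite -fs ys.
  - by rewrite -!fM yc// cmulA.
  - by rewrite -!fM -linD// yy addrC subrK f1 scale1r.
rewrite [x in f x]xh linZ// nrm_real_mul ?nrm_ge0//.
by have := nrm_ge0 (f h); nra.
Qed.

Lemma star_hom_lin A B (f : A -> B) : star_hom f -> linear f.
Proof. by case. Qed.

Lemma sum_squares0 A (x y : A) : x^*c = x -> y^*c = y -> x *c y = y *c x ->
  x *c x + y *c y = 0 -> x = 0.
Proof.
move=> xs ys xy xy0; apply: nrm0_eq0; apply/eqP; rewrite -sqrf_eq0.
apply/eqP/le_anti; rewrite sqr_ge0 andbT.
by apply: (@nrm_sum_squares _ _ 0 x y) => //; rewrite scale0r.
Qed.

(* If [|f x| < |x|] with [x] selfadjoint, pick [t] strictly between the squares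
   of these norms: [f] maps [t - x^2] to a positive element, so [f] identifies
   [t - x^2] with its absolute value; by injectivity [t - x^2] is positive. *)
Lemma star_hom_isometric A B (f : A -> B) : star_hom f -> injective f ->
  forall x, nrm (f x) = nrm x.
Proof.
move=> hf injf.
have [lf f1 fM fs] := hf.
have bf := star_hom_bounded hf.
suff H x : x^*c = x -> nrm x <= nrm (f x).
  move=> x; apply/le_anti; rewrite -[leRHS]mul1r bf /=.
  have := H (x^*c *c x); rewrite starM starK => /(_ erefl).
  rewrite fM fs !nrm_starM.
  by have := nrm_ge0 x; have := nrm_ge0 (f x); nra.
move=> xs; rewrite leNgt; apply/negP => fx.
have x0 : 0 < nrm x by apply: le_lt_trans fx; exact: nrm_ge0.
pose c := ((nrm x)^-1); have c0 : 0 < c by rewrite invr_gt0.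
pose h := (c%:C)%C *: x.
have hs : h^*c = h by rewrite /h starZ conjc_real xs.
have h1 : nrm h = 1 by rewrite /h nrm_real_mul ?(ltW c0)// /c mulVf ?gt_eqF.
have fh1 : nrm (f h) < 1.
  rewrite /h linZ// nrm_real_mul ?(ltW c0)//.
  by rewrite /c ltr_pdivrMl// mulr1.
have fhs : (f h)^*c = f h by rewrite -fs hs.
clearbody h.
pose t : R := (1 + nrm (f h) ^+ 2) / 2.
have fh0 := nrm_ge0 (f h).
have t0 : 0 < t by rewrite /t; nra.
have t1 : t < 1 by rewrite /t; nra.
have ft : nrm (f h) ^+ 2 <= t by rewrite /t; nra.
pose y : A := (t%:C)%C *: cone - h *c h.
have fyk : exists k : B, [/\ k^*c = k, k *c k = (t^-1%:C)%C *: f y &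
    forall w, w *c f y = f y *c w -> w *c k = k *c w].
  have [||k [ks kk _ kc]] := cstar_sqrt (x := (t^-1%:C)%C *: (f h *c f h)).
  - by rewrite starZ conjc_real starM fhs.
  - rewrite nrm_real_mul ?invr_ge0 ?(ltW t0)// ler_pdivrMl// mulr1.
    by apply: le_trans (nrmM _ _) _; rewrite -expr2.
  exists k; split=> //.
    rewrite kk /y (linB lf) (linZ lf) f1 fM scalerBr scalerA -rmorphM /= mulVf ?gt_eqF//.
    by rewrite scale1r.
  move=> w wy; apply: kc; rewrite cmulZl cmulZr; congr (_ *: _).
  move: wy; rewrite /y (linB lf) (linZ lf) f1 fM cmulBl cmulBr cmulZl cmulZr cmul1l.
  by rewrite cmul1r => /addrI/oppr_inj.
have [k [ks kk kc]] := fyk.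
have ysa : y^*c = y by rewrite /y starB starZ conjc_real star1 starM hs.
(* Halving brings the norm of [y], at most 1 + t, down to at most 1. *)
pose q := (2^-1 : R).
have [||b [bs bb bc]] := cstar_abs (x := (q%:C)%C *: y).
- by rewrite starZ conjc_real ysa.
- rewrite nrm_real_mul ?invr_ge0//.
  rewrite /y; have := nrmB ((t%:C)%C *: cone) (h *c h).
  rewrite nrm_real_mul ?(ltW t0)//.
  have := nrm_cone A; have := nrmM h h; rewrite h1 /q; nra.
pose fb := f b; have fbs : fb^*c = fb by rewrite /fb -fs bs.
have yb : b *c y = y *c b.
  have := bc y; rewrite cmulZl cmulZr => /(_ erefl) <- //.
(* [D] is the difference between [Q] and f(|y/2|), whose squares agree, so D (Q + fb^2) = 0. With Q
   = K^2 this gives (K D)^2 + (fb D)^2 = 0; both terms vanish, hence so do D^2 = K (K D) - fb (fb D)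
   and D. *)
pose Q := (q%:C)%C *: f y; pose D := Q - fb *c fb.
have Qs : Q^*c = Q by rewrite /Q starZ conjc_real -fs ysa.
have Ds : D^*c = D by rewrite /D starB Qs starM fbs.
have fbQ : fb *c Q = Q *c fb by rewrite /Q /fb cmulZl cmulZr -!fM yb.
have fbD : fb *c D = D *c fb.
  by rewrite /D cmulBl cmulBr fbQ cmulA.
have fyD : f y *c D = D *c f y.
  rewrite /D /Q cmulBl cmulBr cmulZl cmulZr; congr (_ - _).
  have ybb : y *c (b *c b) = b *c b *c y by rewrite cmulA -yb -!cmulA yb.
  by rewrite /fb -!fM ybb.
have kD : k *c D = D *c k by rewrite -kc// fyD.
have kb : k *c fb = fb *c k by rewrite -kc// /fb -!fM yb.
have Q2 : Q *c Q = fb *c fb *c (fb *c fb).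
  by rewrite /Q -(linZ lf) /fb -!fM bb.
have sqDD : D *c (Q + fb *c fb) = 0.
  rewrite /D cmulBl !cmulDr Q2.
  have -> : fb *c fb *c Q = Q *c (fb *c fb) by rewrite -cmulA fbQ cmulA fbQ cmulA.
  by rewrite [X in _ - X]addrC subrr.
pose v := Num.sqrt (q * t).
have qt0 : 0 <= q * t by rewrite mulr_ge0 ?(ltW t0)// invr_ge0.
pose K := (v%:C)%C *: k.
have Ks : K^*c = K by rewrite /K starZ conjc_real ks.
have KK : K *c K = Q.
  rewrite /K /Q cmulZl cmulZr scalerA -rmorphM /= -expr2 sqr_sqrtr// kk scalerA.
  by rewrite -rmorphM /= mulfK ?gt_eqF.
have KD : K *c D = D *c K by rewrite /K cmulZl cmulZr kD.
have Kb : K *c fb = fb *c K by rewrite /K cmulZl cmulZr kb.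
have comm2 (X : B) : X *c D = D *c X -> (X *c D) *c (X *c D) = D *c (X *c X) *c D.
  by move=> XD; rewrite {1}XD !cmulA.
have hsum : (K *c D) *c (K *c D) + (fb *c D) *c (fb *c D) = 0.
  by rewrite !comm2// -cmulDl -cmulDr KK sqDD cmul0l.
have KDs : (K *c D)^*c = K *c D by rewrite starM Ds Ks KD.
have bDs : (fb *c D)^*c = fb *c D by rewrite starM Ds fbs fbD.
have KbD : K *c D *c (fb *c D) = fb *c D *c (K *c D).
  have c2 (X Y : B) : Y *c D = D *c Y -> X *c D *c (Y *c D) = X *c Y *c (D *c D).
    by move=> YD; rewrite -!cmulA (cmulA D) -YD -cmulA.
  by rewrite !c2// Kb.
have KD0 : K *c D = 0 by exact: sum_squares0 KDs bDs KbD hsum.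
have bD0 : fb *c D = 0.
  by apply: (sum_squares0 bDs KDs (esym KbD)); rewrite addrC.
have DD0 : D *c D = 0.
  by rewrite {1}/D cmulBl -KK -!cmulA KD0 bD0 !cmul0r subrr.
have D0 : D = 0.
  apply: nrm0_eq0; have := nrm_starM D; rewrite Ds DD0 nrm0 => /esym/eqP.
  by rewrite sqrf_eq0 => /eqP.
(* Injectivity brings positivity back to the source: h^2 + 2 b^2 = t with [b] selfadjoint forces
   |h|^2 <= t < 1, against |h| = 1. *)
have E : (q%:C)%C *: y = b *c b.
  by apply: injf; rewrite linZ// fM; exact/subr0_eq.
have h2 : nrm h ^+ 2 <= t.
  pose b' := ((Num.sqrt 2)%:C)%C *: b.
  apply: (@nrm_sum_squares _ _ t h b') => //.
  - by rewrite /b' starZ conjc_real bs.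
  - rewrite /b' cmulZl cmulZr bc// cmulZl cmulZr; congr (_ *: _).
    by rewrite /y cmulBl cmulBr cmulZl cmulZr cmul1l cmul1r cmulA.
  - rewrite /b' cmulZl cmulZr scalerA -rmorphM /= -expr2 sqr_sqrtr// -E scalerA.
    by rewrite -rmorphM /= mulfV ?pnatr_eq0// scale1r /y addrC subrK.
  - exact: ltW.
by move: h2; rewrite h1 expr1n; lra.
Qed.

End star_hom.

(** * The C*-algebra of bounded operators on a Hilbert space *)

Lemma nrm_complete_filter (R : realType) (V : normedModType R[i]) :
  (forall x : nat -> V,
    (forall e : R, 0 < e ->
      exists n, forall m, (n <= m)%N -> nrm (x n - x m) < e) ->
    exists l, forall e : R, 0 < e ->
      exists n, forall m, (n <= m)%N -> nrm (l - x m) < e) ->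
  forall F : set_system V, ProperFilter F -> cauchy F -> cvg F.
Proof.
move=> H F FF /(@cauchyP R[i] V) Fc.
have /choice[x xP] : forall n : nat, exists x, F (ball x ((n.+1%:R^-1 : R)%:C)%C).
  by move=> n; apply: Fc; rewrite ltcR invr_gt0 ltr0n.
have xx n m : nrm (x n - x m) < n.+1%:R^-1 + m.+1%:R^-1.
  have [z [zn zm]] := filter_ex (filterI (xP n) (xP m)).
  move: zn zm; rewrite -!ball_normE /= !nrmE !ltcR => zn zm.
  by apply: le_lt_trans (nrm_tri z _ _) _; rewrite (nrm_distC z) ltrD.
have [e e0|l lP] := H x.
  have [n nP] := small_invS (e := e / 2) ltac:(by rewrite divr_gt0).
  exists n => m nm; apply: lt_trans (xx n m) _.
  by rewrite [e]splitr ltrD// nP.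
apply/cvg_ex; exists l; apply/cvgrPdist_lt => _ /complex_gt0E[e e0 ->].
have e2 : 0 < e / 2 by rewrite divr_gt0.
have [n nP] := lP _ e2; have [m mP] := small_invS e2.
have := xP (maxn n m); apply: filterS => z.
rewrite -ball_normE /= !nrmE !ltcR => xz.
apply: le_lt_trans (nrm_tri (x (maxn n m)) _ _) _; rewrite [e]splitr ltrD//.
  by rewrite nP// leq_maxl.
by apply: lt_trans xz _; rewrite mP// leq_maxr.
Qed.

Section hilbert.
Variables (R : realType) (H : hilbertType R).
Implicit Types (x y z : H) (a : R[i]).

Lemma hdotDl x y z : hdot (x + y) z = hdot x z + hdot y z.
Proof. by have := hdot_linearl 1 x y z; rewrite scale1r mul1r. Qed.

Lemma hdot0l z : hdot (0 : H) z = 0.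
Proof. by apply: (addrI (hdot 0 z)); rewrite -hdotDl !addr0. Qed.

Lemma hdotZl a x z : hdot (a *: x) z = a * hdot x z.
Proof. by have := hdot_linearl a x 0 z; rewrite !addr0 hdot0l addr0. Qed.

Lemma hdotDr x y z : hdot z (x + y) = hdot z x + hdot z y.
Proof. by rewrite hdotC hdotDl rmorphD /= -!hdotC. Qed.

Lemma hdotZr a x z : hdot z (a *: x) = (a^*)%C * hdot z x.
Proof. by rewrite hdotC hdotZl rmorphM /= -!hdotC. Qed.

Lemma hdot0r z : hdot z (0 : H) = 0.
Proof. by apply: (addrI (hdot z 0)); rewrite -hdotDr !addr0. Qed.

Lemma hdotNl x z : hdot (- x) z = - hdot x z.
Proof. by rewrite -scaleN1r hdotZl mulN1r. Qed.

Lemma hdotNr x z : hdot z (- x) = - hdot z x.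
Proof. by rewrite -scaleN1r hdotZr rmorphN1 mulN1r. Qed.

Lemma hdotBl x y z : hdot (x - y) z = hdot x z - hdot y z.
Proof. by rewrite hdotDl hdotNl. Qed.

Lemma hdotBr x y z : hdot z (x - y) = hdot z x - hdot z y.
Proof. by rewrite hdotDr hdotNr. Qed.

Lemma hdot_suml (I : Type) (r : seq I) (P : pred I) (F : I -> H) z :
  hdot (\sum_(i <- r | P i) F i) z = \sum_(i <- r | P i) hdot (F i) z.
Proof. by apply: (big_morph (hdot^~ z)) => [x y|]; rewrite ?hdotDl ?hdot0l. Qed.

Lemma hdot_sumr (I : Type) (r : seq I) (P : pred I) (F : I -> H) z :
  hdot z (\sum_(i <- r | P i) F i) = \sum_(i <- r | P i) hdot z (F i).
Proof. by apply: (big_morph (hdot z)) => [x y|]; rewrite ?hdotDr ?hdot0r. Qed.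

Lemma hdot_nrm x : hdot x x = ((nrm x ^+ 2)%:C)%C.
Proof. by rewrite hdot_norm nrmE rmorphXn. Qed.

Lemma mul_conj a : a * (a^*)%C = ((nrm a ^+ 2)%:C)%C.
Proof. by rewrite -sqr_normc nrmE rmorphXn. Qed.

Lemma cauchy_schwarz x y : nrm (hdot x y) <= nrm x * nrm y.
Proof.
have [->|/nrm_gt0 y0] := eqVneq y 0; first by rewrite hdot0r !nrm0 mulr0.
pose a := hdot x y; pose n := nrm y ^+ 2.
have : hdot ((n%:C)%C *: x - a *: y) ((n%:C)%C *: x - a *: y) =
    ((n * (n * nrm x ^+ 2 - nrm a ^+ 2))%:C)%C.
  rewrite hdotBl !hdotBr !hdotZl !hdotZr !hdot_nrm -/n (hdotC x y) -/a conjc_real.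
  move: (mul_conj a); move: (nrm a ^+ 2) (nrm x ^+ 2) => r s E.
  have -> : ((n * (n * s - r))%:C)%C = (n%:C)%C * ((n%:C)%C * (s%:C)%C - (r%:C)%C).
    by rewrite !(rmorphM, rmorphB).
  by rewrite -E; ring.
rewrite hdot_nrm => /complexI E.
have : 0 <= n * (n * nrm x ^+ 2 - nrm a ^+ 2) by rewrite -E sqr_ge0.
rewrite pmulr_rge0 ?exprn_gt0// subr_ge0 /n -exprMn -/a.
rewrite ler_sqr ?nnegrE ?mulr_ge0 ?nrm_ge0//.
by rewrite mulrC.
Qed.

Lemma hdot_eq0 x : (forall y, hdot x y = 0) -> x = 0.
Proof.
move=> /(_ x); rewrite hdot_nrm => /(@complexI _ _ 0)/eqP.
by rewrite sqrf_eq0 => /eqP/nrm0_eq0.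
Qed.

Lemma hdot_inj x y : (forall z, hdot x z = hdot y z) -> x = y.
Proof.
by move=> xy; apply/subr0_eq/hdot_eq0 => z; rewrite hdotBl xy subrr.
Qed.

Lemma hdot_injr x y : (forall z, hdot z x = hdot z y) -> x = y.
Proof. by move=> xy; apply: hdot_inj => z; rewrite hdotC xy -hdotC. Qed.

(** The adjoint is required from the start instead of being derived by Riesz representation;
    linearity follows from its existence. *)
Definition bop_spec (f : H -> H) := (exists c, bounded_by c f) /\
  exists g : H -> H, forall x y, hdot (f x) y = hdot x (g y).

Lemma adjoint_linear (f g : H -> H) :
  (forall x y, hdot (f x) y = hdot x (g y)) -> linear f.
Proof.
move=> fg a x y; apply: hdot_inj => z.
by rewrite hdotDl hdotZl !fg hdotDl hdotZl.
Qed.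

Lemma adjoint_sym (f g : H -> H) :
  (forall x y, hdot (f x) y = hdot x (g y)) ->
  forall x y, hdot (g x) y = hdot x (f y).
Proof. by move=> fg x y; rewrite hdotC -fg -hdotC. Qed.

Lemma adjoint_bounded (c : R) (f g : H -> H) : 0 <= c -> bounded_by c f ->
  (forall x y, hdot (f x) y = hdot x (g y)) -> bounded_by c g.
Proof.
move=> c0 bf fg x; have [->|/nrm_gt0 gx0] := eqVneq (g x) 0.
  by rewrite nrm0 mulr_ge0// nrm_ge0.
have : nrm (hdot (f (g x)) x) <= nrm (f (g x)) * nrm x by exact: cauchy_schwarz.
rewrite fg hdot_nrm nrm_real ger0_norm ?sqr_ge0// => h1.
have := ler_wpM2r (nrm_ge0 x) (bf (g x)).
by move=> /(le_trans h1); rewrite expr2 mulrAC ler_pM2r.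
Qed.

Record bop := BOp { bfun :> H -> H; bopP : bop_spec bfun }.

Lemma bop_eq (f g : bop) : (forall x, f x = g x) -> f = g.
Proof.
move: f g => [f fP] [g gP] /= /funext fg; subst g; congr BOp.
exact: Prop_irrelevance.
Qed.

HB.instance Definition _ := gen_eqMixin bop.
HB.instance Definition _ := gen_choiceMixin bop.

Lemma bop_bounded (f : bop) : exists2 c, 0 <= c & bounded_by c f.
Proof.
have [[c fc] _] := bopP f; exists `|c| => // x.
by apply: le_trans (fc x) _; rewrite ler_wpM2r ?nrm_ge0// ler_norm.
Qed.

Definition badj_fun (f : bop) : H -> H := projT1 (cid (proj2 (bopP f))).

Lemma badj_funP (f : bop) x y : hdot (f x) y = hdot x (badj_fun f y).
Proof. exact: (projT2 (cid (proj2 (bopP f)))). Qed.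

Lemma bop_linear (f : bop) : linear f.
Proof. by apply: adjoint_linear; exact: badj_funP. Qed.

Lemma bop_zero_spec : bop_spec (fun=> 0).
Proof.
split; first by exists 0 => x; rewrite nrm0 mul0r.
by exists (fun=> 0) => x y; rewrite hdot0l hdot0r.
Qed.

Lemma bop_add_spec (f g : bop) : bop_spec (fun x => f x + g x).
Proof.
have [c c0 fc] := bop_bounded f; have [d d0 gd] := bop_bounded g.
split.
  exists (c + d) => x; apply: le_trans (nrmD _ _) _.
  by rewrite mulrDl lerD ?fc ?gd.
exists (fun x => badj_fun f x + badj_fun g x) => x y.
by rewrite hdotDl !badj_funP hdotDr.
Qed.

Lemma bop_scale_spec a (f : bop) : bop_spec (fun x => a *: f x).
Proof.
have [c c0 fc] := bop_bounded f; split.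
  exists (nrm a * c) => x.
  by rewrite nrm_scale -mulrA ler_wpM2l ?nrm_ge0.
exists (fun x => (a^*)%C *: badj_fun f x) => x y.
by rewrite hdotZl !badj_funP hdotZr conjcK.
Qed.

Lemma bop_comp_spec (f g : bop) : bop_spec (fun x => f (g x)).
Proof.
have [c c0 fc] := bop_bounded f; have [d d0 gd] := bop_bounded g.
split.
  exists (c * d) => x; apply: le_trans (fc _) _.
  by rewrite -mulrA ler_wpM2l.
exists (fun x => badj_fun g (badj_fun f x)) => x y.
by rewrite !badj_funP.
Qed.

Lemma bop_id_spec : bop_spec id.
Proof. by split; [exists 1 => x; rewrite mul1r | exists id]. Qed.

Lemma bop_adj_spec (f : bop) : bop_spec (badj_fun f).
Proof.
have [c c0 fc] := bop_bounded f; split.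
  by exists c; apply: adjoint_bounded c0 fc _; exact: badj_funP.
by exists f; apply: adjoint_sym; exact: badj_funP.
Qed.

Definition bop_add f g := BOp (bop_add_spec f g).
Definition bop_scale a f := BOp (bop_scale_spec a f).
Definition bop_opp f := bop_scale (-1) f.

Fact bop_addA : associative bop_add.
Proof. by move=> f g h; apply: bop_eq => x /=; rewrite addrA. Qed.
Fact bop_addC : commutative bop_add.
Proof. by move=> f g; apply: bop_eq => x /=; rewrite addrC. Qed.
Fact bop_add0 : left_id (BOp bop_zero_spec) bop_add.
Proof. by move=> f; apply: bop_eq => x /=; rewrite add0r. Qed.
Fact bop_addN : left_inverse (BOp bop_zero_spec) bop_opp bop_add.
Proof. by move=> f; apply: bop_eq => x /=; rewrite scaleN1r addNr. Qed.

HB.instance Definition _ := GRing.isZmodule.Build bop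
  bop_addA bop_addC bop_add0 bop_addN.

Fact bop_scaleA a b f : bop_scale a (bop_scale b f) = bop_scale (a * b) f.
Proof. by apply: bop_eq => x /=; rewrite scalerA. Qed.
Fact bop_scale1 : left_id 1 bop_scale.
Proof. by move=> f; apply: bop_eq => x /=; rewrite scale1r. Qed.
Fact bop_scaleDr : right_distributive bop_scale +%R.
Proof. by move=> a f g; apply: bop_eq => x /=; rewrite scalerDr. Qed.
Fact bop_scaleDl f : {morph bop_scale^~ f : a b / a + b}.
Proof. by move=> a b; apply: bop_eq => x /=; rewrite scalerDl. Qed.

HB.instance Definition _ := GRing.Zmodule_isLmodule.Build R[i] bop
  bop_scaleA bop_scale1 bop_scaleDr bop_scaleDl.

Lemma bopDE (f g : bop) x : (f + g) x = f x + g x. Proof. by []. Qed.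
Lemma bopZE a (f : bop) x : (a *: f) x = a *: f x. Proof. by []. Qed.
Lemma bop0E x : (0 : bop) x = 0. Proof. by []. Qed.
Lemma bopNE (f : bop) x : (- f) x = - f x. Proof. exact: scaleN1r. Qed.
Lemma bopBE (f g : bop) x : (f - g) x = f x - g x.
Proof. by rewrite bopDE bopNE. Qed.
Lemma bop_sumE (I : Type) (r : seq I) (P : pred I) (F : I -> bop) x :
  (\sum_(i <- r | P i) F i) x = \sum_(i <- r | P i) F i x.
Proof. by apply: (big_morph (fun f : bop => f x)). Qed.

Definition bnorm (f : bop) : R := inf [set c | 0 <= c /\ bounded_by c f].

Let bnorm_has_inf (f : bop) : has_inf [set c | 0 <= c /\ bounded_by c f].
Proof.
split; first by have [c c0 fc] := bop_bounded f; exists c.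
by exists 0 => c [].
Qed.

Lemma bnorm_le (f : bop) c : 0 <= c -> bounded_by c f -> bnorm f <= c.
Proof.
by move=> c0 fc; apply: ge_inf; [have [] := bnorm_has_inf f | split].
Qed.

Lemma bnorm_ge0 (f : bop) : 0 <= bnorm f.
Proof. by apply: lb_le_inf; [have [] := bnorm_has_inf f | move=> c []]. Qed.

Lemma bnormP (f : bop) : bounded_by (bnorm f) f.
Proof.
move=> x; apply/ler_addgt0Pr => e e0.
have d0 : 0 < e / (nrm x + 1) by rewrite divr_gt0// ltr_wpDl ?nrm_ge0.
have [c [c0 fc] cf] := inf_adherent d0 (bnorm_has_inf f).
apply: le_trans (fc x) _; have := nrm_ge0 x.
rewrite -/(bnorm f) in cf => x0.
have : c * nrm x <= (bnorm f + e / (nrm x + 1)) * nrm x.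
  by rewrite ler_wpM2r// ltW.
have : e / (nrm x + 1) * nrm x <= e.
  by rewrite mulrAC ler_pdivrMr ?ltr_wpDl// ler_wpM2l ?(ltW e0)// lerDl.
rewrite mulrDl; lra.
Qed.

Definition bop_norm (f : bop) : R[i] := ((bnorm f)%:C)%C.

Fact bop_normD (f g : bop) : bop_norm (f + g) <= bop_norm f + bop_norm g.
Proof.
rewrite /bop_norm -rmorphD lecR bnorm_le ?addr_ge0 ?bnorm_ge0// => x.
rewrite bopDE; apply: le_trans (nrmD _ _) _.
by rewrite mulrDl lerD// bnormP.
Qed.

Fact bop_normZ a (f : bop) : bop_norm (a *: f) = `|a| * bop_norm f.
Proof.
have le b g : bnorm (b *: g) <= nrm b * bnorm g.
  rewrite bnorm_le ?mulr_ge0 ?bnorm_ge0 ?nrm_ge0// => x.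
  by rewrite bopZE nrm_scale -mulrA ler_wpM2l ?nrm_ge0// bnormP.
rewrite /bop_norm nrmE -rmorphM; congr (_%:C)%C; apply/le_anti; rewrite le /=.
have [->|a0] := eqVneq a 0; first by rewrite nrm0 mul0r bnorm_ge0.
have := le a^-1 (a *: f); rewrite scalerA mulVf// scale1r => h.
have a1 : nrm a * nrm a^-1 = 1 by rewrite -nrmcM mulfV// nrm1.
have := ler_wpM2l (nrm_ge0 a) h; rewrite mulrA a1 mul1r; exact.
Qed.

Fact bop_norm0 (f : bop) : bop_norm f = 0 -> f = 0.
Proof.
move=> /(@complexI _ _ 0) f0; apply: bop_eq => x; apply: nrm0_eq0.
by apply/le_anti; rewrite nrm_ge0 andbT; have := bnormP f x; rewrite f0 mul0r.
Qed.

HB.instance Definition _ := Lmodule_isNormed.Build R[i] bop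
  bop_normD bop_normZ bop_norm0.

Lemma nrm_bopP (f : bop) x : nrm (f x) <= nrm f * nrm x.
Proof. exact: bnormP. Qed.

Lemma nrm_bop_le (f : bop) (c : R) : 0 <= c -> bounded_by c f -> nrm f <= c.
Proof. exact: bnorm_le. Qed.

Definition bop_adj f := BOp (bop_adj_spec f).
Definition bop_comp f g := BOp (bop_comp_spec f g).
Definition bop_id := BOp bop_id_spec.

Lemma bop_adjP (f : bop) x y : hdot (f x) y = hdot x (bop_adj f y).
Proof. exact: badj_funP. Qed.

Lemma bop_adjP' (f : bop) x y : hdot (bop_adj f x) y = hdot x (f y).
Proof. by apply: adjoint_sym; exact: bop_adjP. Qed.

Lemma nrm_bop_adj (f : bop) : nrm (bop_adj f) <= nrm f.
Proof.
apply: nrm_bop_le; rewrite ?nrm_ge0//.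
by apply: (adjoint_bounded _ (@nrm_bopP f)); rewrite ?nrm_ge0//; exact: bop_adjP.
Qed.

Lemma bop_adj_uniq (f : bop) (g : H -> H) :
  (forall x y, hdot (f x) y = hdot x (g y)) -> forall x, bop_adj f x = g x.
Proof. by move=> fg x; apply: hdot_injr => z; rewrite -bop_adjP fg. Qed.

Fact bop_complete (F : set_system bop) : ProperFilter F -> cauchy F -> cvg F.
Proof.
apply: nrm_complete_filter => f fc.
have lim (g : nat -> H -> H) : (forall n m x, nrm (g n x - g m x) <= nrm (f n - f m) * nrm x) ->
    exists L : H -> H, forall e, 0 < e -> exists n, forall m, (n <= m)%N ->
      forall x, nrm (L x - g m x) <= e * nrm x.
  move=> gf.
  have /choice[L LP] : forall x, exists l, forall e : R, 0 < e ->
      exists n, forall m, (n <= m)%N -> nrm (l - g m x) < e.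
    move=> x; apply: nrm_complete => e e0.
    have x1 : 0 < nrm x + 1 by rewrite ltr_wpDl ?nrm_ge0.
    have [n nP] := fc (e / (nrm x + 1)) ltac:(by rewrite divr_gt0).
    exists n => m /nP fnm; apply: le_lt_trans (gf n m x) _.
    rewrite ltr_pdivlMr// in fnm; have := nrm_ge0 (f n - f m).
    by rewrite mulrDr mulr1 in fnm *; move: fnm; have := nrm_ge0 x; nra.
  exists L => e e0; have [n nP] := fc (e / 2) ltac:(by rewrite divr_gt0).
  exists n => m nm x; apply/ler_addgt0Pr => d d0.
  have [k kP] := LP x _ d0.
  apply: le_trans (nrm_tri (g (maxn n k) x) _ _) _.
  have h1 : nrm (L x - g (maxn n k) x) < d by rewrite kP// leq_maxr.
  have h2 := gf (maxn n k) m x.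
  have h3 : nrm (f (maxn n k) - f m) <= e.
    apply: le_trans (nrm_tri (f n) _ _) _; rewrite [e]splitr lerD// ltW//.
      by rewrite nrm_distC nP// leq_maxl.
    by rewrite nP.
  by have := ler_wpM2r (nrm_ge0 x) h3; lra.
have [n m x|L LP] := lim f.
  by rewrite -bopBE nrm_bopP.
(* The adjoints converge as well, and their limit is the adjoint required of [L]. *)
have [n m x|G GP] := lim (fun n => bop_adj (f n)).
  have -> : bop_adj (f n) x - bop_adj (f m) x = bop_adj (f n - f m) x.
    apply: hdot_injr => y; rewrite hdotBr -!bop_adjP bopBE hdotBl.
    by [].
  apply: le_trans (nrm_bopP _ _) _.
  by rewrite ler_wpM2r ?nrm_ge0// nrm_bop_adj.
have LG x y : hdot (L x) y = hdot x (G y).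
  apply/subr0_eq/nrm_eq0_le => e e0.
  have c0 : 0 < 2 * (nrm x * nrm y) + 1.
    by rewrite ltr_wpDl// !mulr_ge0 ?nrm_ge0.
  pose d := e / (2 * (nrm x * nrm y) + 1).
  have d0 : 0 < d by rewrite divr_gt0.
  have [n nP] := LP _ d0; have [m mP] := GP _ d0; pose k := maxn n m.
  have -> : hdot (L x) y - hdot x (G y) =
      hdot (L x - f k x) y - hdot x (G y - bop_adj (f k) y).
    rewrite hdotBl hdotBr -bop_adjP; ring.
  apply: le_trans (nrmB _ _) _.
  have h1 := nP k (leq_maxl _ _) x; have h2 := mP k (leq_maxr _ _) y.
  have := cauchy_schwarz (L x - f k x) y.
  have := cauchy_schwarz x (G y - bop_adj (f k) y).
  have := ler_wpM2r (nrm_ge0 y) h1; have := ler_wpM2l (nrm_ge0 x) h2.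
  have : d * (2 * (nrm x * nrm y) + 1) = e by rewrite /d mulfVK// gt_eqF.
  by have := ltW d0; lra.
have Lspec : bop_spec L.
  split; last by exists G.
  have [n /(_ n (leqnn _)) nP] := LP 1 ltac:(by []).
  exists (1 + nrm (f n)) => x; rewrite -[in leLHS](subrK (f n x) (L x)).
  by apply: le_trans (nrmD _ _) _; rewrite mulrDl lerD// nrm_bopP.
exists (BOp Lspec) => e e0.
have e2 : 0 < e / 2 by rewrite divr_gt0.
have [n nP] := LP _ e2; exists n => m nm.
apply: (@le_lt_trans _ _ (e / 2)); last by rewrite ltr_pdivrMr// ltr_pMr// ltr1n.
by apply: nrm_bop_le => [|x]; [exact: ltW | rewrite bopBE; exact: nP].
Qed.

HB.instance Definition _ := Uniform_isComplete.Build bop bop_complete.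

Fact bop_compA : associative bop_comp.
Proof. by move=> f g h; exact: bop_eq. Qed.
Fact bop_comp1 : left_id bop_id bop_comp.
Proof. by move=> f; exact: bop_eq. Qed.
Fact bop_compr1 : right_id bop_id bop_comp.
Proof. by move=> f; exact: bop_eq. Qed.
Fact bop_comp_linearl a (f g h : bop) :
  bop_comp (a *: f + g) h = a *: bop_comp f h + bop_comp g h.
Proof. exact: bop_eq. Qed.
Fact bop_comp_linearr a (f g h : bop) :
  bop_comp h (a *: f + g) = a *: bop_comp h f + bop_comp h g.
Proof. by apply: bop_eq => x /=; rewrite -bop_linear. Qed.
Fact bop_adjK : involutive bop_adj.
Proof. by move=> f; apply: bop_eq; apply: bop_adj_uniq; exact: bop_adjP'. Qed.
Fact bop_adj_semilinear a (f g : bop) :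
  bop_adj (a *: f + g) = (a^*)%C *: bop_adj f + bop_adj g.
Proof.
apply: bop_eq; apply: bop_adj_uniq => x y.
by rewrite !bopDE !bopZE hdotDl hdotDr hdotZl hdotZr conjcK !bop_adjP.
Qed.
Fact bop_adjM (f g : bop) :
  bop_adj (bop_comp f g) = bop_comp (bop_adj g) (bop_adj f).
Proof.
by apply: bop_eq; apply: bop_adj_uniq => x y; rewrite -!bop_adjP.
Qed.
Fact bop_normM (f g : bop) : `|bop_comp f g| <= `|f| * `|g|.
Proof.
rewrite !nrmE -rmorphM lecR nrm_bop_le ?mulr_ge0 ?nrm_ge0// => x.
apply: le_trans (nrm_bopP f (g x)) _; rewrite -mulrA ler_wpM2l ?nrm_ge0//.
exact: nrm_bopP.
Qed.
Fact bop_norm_star (f : bop) : `|bop_comp (bop_adj f) f| = `|f| ^+ 2.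
Proof.
apply/le_anti/andP; split.
  apply: le_trans (bop_normM _ _) _; rewrite expr2 ler_wpM2r ?normr_ge0//.
  by rewrite -nrm_le nrm_bop_adj.
rewrite !nrmE -rmorphXn lecR -[leRHS]sqr_sqrtr ?nrm_ge0//.
rewrite ler_sqr ?nnegrE ?nrm_ge0 ?sqrtr_ge0// nrm_bop_le ?sqrtr_ge0// => x.
rewrite -ler_sqr ?nnegrE ?mulr_ge0 ?nrm_ge0 ?sqrtr_ge0//.
rewrite exprMn sqr_sqrtr ?nrm_ge0//.
have : nrm (hdot (bop_comp (bop_adj f) f x) x) <= nrm (bop_comp (bop_adj f) f x) * nrm x.
  exact: cauchy_schwarz.
rewrite [X in hdot X _]/= bop_adjP' hdot_nrm nrm_real ger0_norm ?sqr_ge0//.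
move=> /le_trans; apply; rewrite [in leRHS]expr2 mulrA ler_wpM2r ?nrm_ge0//.
exact: nrm_bopP.
Qed.

HB.instance Definition _ := isCStarAlgebra.Build R bop
  bop_compA bop_comp1 bop_compr1 bop_comp_linearl bop_comp_linearr bop_adjK
  bop_adj_semilinear bop_adjM bop_normM bop_norm_star.

Lemma bopME (f g : bop) x : (f *c g) x = f (g x). Proof. by []. Qed.
Lemma bop1E x : (cone : bop) x = x. Proof. by []. Qed.

Lemma hdot_star (f : bop) x y : hdot (f x) y = hdot x (f^*c y).
Proof. exact: bop_adjP. Qed.

Lemma hdot_starl (f : bop) x y : hdot (f^*c x) y = hdot x (f y).
Proof. exact: bop_adjP'. Qed.

End hilbert.

Arguments bop {R} H.

(** * Representations and orthonormal bases *)

Section continuity.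
Variables (R : realType) (V W : normedModType R[i]).

Lemma bounded_continuous (c : R) (f : V -> W) :
  linear f -> bounded_by c f -> continuous f.
Proof.
move=> lf bf x; apply/cvgrPdist_lt => _ /complex_gt0E[e e0 ->].
have c0 : 0 < `|c| + 1 by rewrite ltr_wpDl.
have d0 : 0 < e / (`|c| + 1) by rewrite divr_gt0.
apply/nbhs_ballP; exists ((e / (`|c| + 1))%:C)%C; first by rewrite /= ltcR.
move=> y; rewrite -ball_normE /= !nrmE !ltcR -linB// ltr_pdivlMr// mulrC => xy.
apply: le_lt_trans (bf _) _; apply: le_lt_trans xy.
by rewrite ler_wpM2r ?nrm_ge0//; have := ler_norm c; lra.
Qed.

Lemma continuous_bounded (f : V -> W) :
  linear f -> continuous f -> exists c, bounded_by c f.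
Proof.
move=> lf /(_ 0)/cvgrPdist_lt/(_ 1 ltr01)/nbhs_ballP[_ /complex_gt0E[e e0 ->] H].
exists (2 / e) => x; have [->|/nrm_gt0 x0] := eqVneq x 0.
  by rewrite lin0// !nrm0 mulr0.
pose a := e / 2 / nrm x; have a0 : 0 < a by rewrite !divr_gt0.
have := H ((a%:C)%C *: x); rewrite -ball_normE /= sub0r lin0// sub0r !normrN.
rewrite !nrmE (linZ lf) !nrm_real_mul ?(ltW a0)// ltcR.
have -> : a * nrm x = e / 2 by rewrite /a mulfVK// gt_eqF.
have -> : (1 : R[i]) = ((1 : R)%:C)%C by [].
rewrite ltcR => /(_ _) h.
have {h}h : a * nrm (f x) < 1 by apply: h; rewrite ltr_pdivrMr// ltr_pMr// ltr1n.
have -> : 2 / e * nrm x = a^-1.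
  by rewrite /a; field; rewrite !gt_eqF.
by rewrite -[leRHS]mul1r ler_pdivlMr// mulrC ltW.
Qed.

End continuity.

Section representation.
Variables (R : realType) (A : cstarAlgType R) (H : hilbertType R).

Lemma star_hom_representation (rho : A -> bop H) : star_hom rho ->
  is_representation (fun x h => rho x h).
Proof.
move=> [lr r1 rM rs]; split.
- split=> x; first exact: bop_linear.
  by apply: bounded_continuous (@nrm_bopP _ _ (rho x)); exact: bop_linear.
- by move=> h a x y; rewrite lr.
- by move=> x y h; rewrite rM.
- by move=> x h k; rewrite rs hdot_star.
Qed.

Lemma representation_star_hom (pi : A -> H -> H) : is_representation pi ->
  (forall h, pi cone h = h) ->
  exists rho : A -> bop H, star_hom rho /\ forall x h, rho x h = pi x h.
Proof.
move=> [[pl pc] pll pM ps] p1.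
have sp x : bop_spec (pi x).
  split; first exact: continuous_bounded.
  by exists (pi x^*c) => h k; exact: ps.
exists (fun x => BOp (sp x)); split=> //; split=> [a x y||x y|x].
- by apply: bop_eq => h /=; exact: pll.
- by apply: bop_eq => h /=; exact: p1.
- by apply: bop_eq => h /=; exact: pM.
- apply: bop_eq => h /=; apply: hdot_inj => k /=.
  by rewrite hdot_starl /= ps starK.
Qed.

End representation.

Section basis.
Variables (R : realType) (H : hilbertType R) (X : choiceType) (e : X -> H).
Hypothesis be : orthonormal_basis e.

Let ee s t : hdot (e s) (e t) = (s == t)%:R. Proof. by case: be. Qed.
Let espan : closed_span (range e) = setT. Proof. by case: be. Qed.

Lemma hdot_lcomb (Y Z : Type) (f f' : Y -> H) (g g' : Y -> H) l m :
  (forall s t, hdot (f s) (g t) = hdot (f' s) (g' t)) ->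
  hdot (lcomb f l) (lcomb g m) = hdot (lcomb f' l) (lcomb g' m).
Proof.
move=> fg; rewrite /lcomb !hdot_suml; apply: eq_bigr => p _.
rewrite !hdot_sumr; apply: eq_bigr => q _.
by rewrite !hdotZl !hdotZr fg.
Qed.

Lemma nrm_hdot_le (x y : H) : hdot x x = hdot x y -> nrm x <= nrm y.
Proof.
move=> xy; have := cauchy_schwarz x y; rewrite -xy hdot_nrm nrm_real.
rewrite ger0_norm ?sqr_ge0//; have := nrm_ge0 x; have := nrm_ge0 y; nra.
Qed.

Lemma nrm_hdot (x y : H) : hdot x x = hdot y y -> nrm x = nrm y.
Proof.
rewrite !hdot_nrm => /complexI xy; apply/eqP.
by rewrite -(@eqrXn2 _ 2) ?nrm_ge0// xy.
Qed.

Lemma closed_subspace_hdot (f g : bop H) y z :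
  closed_subspace [set x | hdot (f x) y = hdot (g x) z].
Proof.
pose h := fun x => hdot (f x) y - hdot (g x) z : R[i].
have -> : [set x | hdot (f x) y = hdot (g x) z] = h @^-1` [set 0].
  by apply/seteqP; split=> x /=; [rewrite /h => ->; exact: subrr | move=> /subr0_eq].
apply: (@closed_subspace_preimage _ _ _ (nrm f * nrm y + nrm g * nrm z)).
- move=> a u v; rewrite /h !bop_linear !hdotDl !hdotZl /GRing.scale /=; ring.
- move=> u; rewrite /h; apply: le_trans (nrmB _ _) _; rewrite mulrDl.
  rewrite lerD//; (apply: le_trans (cauchy_schwarz _ _) _);
  by rewrite mulrAC ler_wpM2r ?nrm_ge0// nrm_bopP.
- exact: closed_subspace0.
Qed.

Lemma basis_hdot x y : (forall s, hdot (e s) x = hdot (e s) y) -> x = y.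
Proof.
move=> xy; apply: hdot_injr => z.
have zT : closed_span (range e) z by rewrite espan.
apply: (closed_span_min (closed_subspace_hdot cone cone x y) _ zT).
by move=> _ [s _ <-] /=; rewrite xy.
Qed.

Lemma bop_eq_basis (f g : bop H) : (forall s, f (e s) = g (e s)) -> f = g.
Proof.
move=> fg; apply: bop_eq => x; congr (_ x).
apply: lin_eq_dense espan _; [exact: bop_linear|exact: bop_linear|exact: nrm_bopP|exact: nrm_bopP|].
by move=> _ [s _ <-].
Qed.

(** The part of the combination supported on the domain of [s] has the same norm as the image, and
    it is an orthogonal projection of the original vector because <g, g> = <g, e>. *)
Lemma partial_injection_le (s : X -> option X) (l : seq (R[i] * X)) :
  (forall x y z, s x = Some z -> s y = Some z -> x = y) ->
  nrm (lcomb (fun x => oapp e 0 (s x)) l) <= 1 * nrm (lcomb e l).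
Proof.
move=> sI; rewrite mul1r; pose f x := oapp e 0 (s x).
pose g x := if s x is Some _ then e x else 0.
have gg x y : hdot (g x) (g y) = hdot (g x) (e y).
  rewrite /g; case sx: (s x) => [z|]; last by rewrite !hdot0l.
  case sy: (s y) => [//|]; rewrite hdot0r ee.
  by case: eqVneq => [xy|//]; rewrite xy sy in sx.
have ff x y : hdot (f x) (f y) = hdot (g x) (e y).
  rewrite /f /g; case sx: (s x) => [z|] /=; last by rewrite !hdot0l.
  case sy: (s y) => [w|] /=; rewrite ?hdot0r !ee.
    congr (_%:R); congr nat_of_bool; apply/eqP/eqP => [zw|xy].
      by apply: sI sx _; rewrite zw.
    by move: sx sy; rewrite xy => -> [].
  by case: eqVneq => [xy|//]; rewrite xy sy in sx.
apply: (@le_trans _ _ (nrm (lcomb g l))).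
  rewrite le_eqVlt; apply/orP; left; apply/eqP/nrm_hdot.
  by apply: (@hdot_lcomb X X) => x y; rewrite ff gg.
by apply: nrm_hdot_le; apply: (@hdot_lcomb X X) => x y; rewrite gg.
Qed.

(** The shifts, dilations, translations and embeddings built below are all of this kind; the inverse
    partial injection supplies the adjoint. *)
Lemma partial_injection_bop (s s' : X -> option X) :
  (forall x y, s x = Some y <-> s' y = Some x) ->
  exists W : bop H, [/\ forall x, W (e x) = oapp e 0 (s x),
    forall y, W^*c (e y) = oapp e 0 (s' y) & nrm W <= 1].
Proof.
move=> ss'.
have sI x y z : s x = Some z -> s y = Some z -> x = y.
  by move=> /ss' h /ss'; rewrite h => -[].
have sI' x y z : s' x = Some z -> s' y = Some z -> x = y.
  by move=> /ss' h /ss'; rewrite h => -[].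
have [W [Wl Wb We]] := bounded_extension ler01 espan (fun l => partial_injection_le l sI).
have [W' [Wl' Wb' We']] := bounded_extension ler01 espan (fun l => partial_injection_le l sI').
have clos (f : H -> H) y z : linear f -> bounded_by 1 f ->
    closed_subspace [set x | hdot (f x) y = hdot x z].
  move=> lf bf; pose h := fun x => hdot (f x) y - hdot x z : R[i].
  have -> : [set x | hdot (f x) y = hdot x z] = h @^-1` [set 0].
    by apply/seteqP; split=> x /=; [rewrite /h => ->; exact: subrr | move=> /subr0_eq].
  apply: (@closed_subspace_preimage _ _ _ (nrm y + nrm z)).
  - move=> a u v; rewrite /h !lf !hdotDl !hdotZl /GRing.scale /=; ring.
  - move=> u; rewrite /h; apply: le_trans (nrmB _ _) _; rewrite mulrDl.
    have := ler_wpM2r (nrm_ge0 y) (bf u).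
    by have := cauchy_schwarz (f u) y; have := cauchy_schwarz u z; lra.
  - exact: closed_subspace0.
have adj x y : hdot (W x) (e y) = hdot x (W' (e y)).
  have xT : closed_span (range e) x by rewrite espan.
  apply: (closed_span_min (clos W (e y) (W' (e y)) Wl Wb) _ xT).
  move=> _ [t _ <-] /=; rewrite We We'.
  case st: (s t) => [z|] /=; case sy: (s' y) => [w|] /=; rewrite ?ee ?hdot0l ?hdot0r//.
  - congr (_%:R); congr nat_of_bool; apply/eqP/eqP => [zy|tw].
      by move/ss': st; rewrite zy sy => -[].
    by move/ss': sy; rewrite -tw st => -[].
  - by case: eqVneq => [zy|//]; move/ss': st; rewrite zy sy.
  - by case: eqVneq => [tw|//]; move/ss': sy; rewrite -tw st.
have adj2 y x : hdot (W' y) x = hdot y (W x).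
  have yT : closed_span (range e) y by rewrite espan.
  apply: (closed_span_min (clos W' x (W x) Wl' Wb') _ yT).
  by move=> _ [t _ <-] /=; rewrite hdotC -adj -hdotC.
have adj' x y : hdot (W x) y = hdot x (W' y) by rewrite hdotC -adj2 -hdotC.
have Ws : bop_spec W by split; [exists 1 | exists W'].
exists (BOp Ws); split=> //.
  by move=> y; rewrite -We'; apply: bop_adj_uniq.
by apply: nrm_bop_le.
Qed.

End basis.

(** * Relations in the Toeplitz algebra *)

Section star_closed_span.
Variables (R : realType) (A : cstarAlgType R).
Implicit Types (S M : set A).

Lemma closed_subspace_mull M x : closed_subspace M ->
  closed_subspace [set y | M (x *c y)].
Proof.
exact: (closed_subspace_preimage (linear_cmull x) (bounded_cmull x)).
Qed.

Lemma closed_subspace_mulr M x : closed_subspace M ->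
  closed_subspace [set y | M (y *c x)].
Proof.
exact: (closed_subspace_preimage (linear_cmulr x) (bounded_cmulr x)).
Qed.

Lemma closed_subspace_star M : closed_subspace M ->
  closed_subspace [set y | M y^*c].
Proof.
move=> cM; apply: closed_subspace_nrm.
  have lM := cM.2; split=> [|a x y Mx My] /=; first by rewrite star0; case: lM.
  by rewrite star_semilinear; apply: lsubD => //; exact: lsubZ.
move=> x H /=; apply: closed_subspace_approx => // e e0.
have [y My xy] := H e e0; exists y^*c => //.
by rewrite -starB nrm_star.
Qed.

Lemma closed_spanM S : (forall x y, S x -> S y -> closed_span S (x *c y)) ->
  forall x y, closed_span S x -> closed_span S y -> closed_span S (x *c y).
Proof.
move=> SM x y Sx Sy.
have cS := closed_span_closed S.
apply: (closed_span_min (closed_subspace_mulr y cS) _ Sx) => {x Sx} x Sx /=.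
by apply: (closed_span_min (closed_subspace_mull x cS) _ Sy) => z Sz; exact: SM.
Qed.

Lemma closed_span_star S : (forall x, S x -> closed_span S x^*c) ->
  forall x, closed_span S x -> closed_span S x^*c.
Proof.
move=> Ss x Sx.
exact: (closed_span_min (closed_subspace_star (closed_span_closed S)) _ Sx).
Qed.

End star_closed_span.

Fact max0_ge0 (x : rat) : 0 <= Num.max x 0.
Proof. by rewrite le_max lexx orbT. Qed.

(** Extended by 0 to negative rationals in order to be total; it is meaningful for [0 <= x] only. *)
Definition nng (x : rat) : {nonneg rat} := NngNum (max0_ge0 x).

Lemma nngE (x : rat) : 0 <= x -> (nng x)%:num = x.
Proof. by move=> x0; rewrite /= max_l. Qed.

Lemma nngK (s : {nonneg rat}) : nng s%:num = s.
Proof. by apply/val_inj; rewrite /= max_l. Qed.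

Lemma nng_inj (x y : rat) : 0 <= x -> 0 <= y -> nng x = nng y -> x = y.
Proof. by move=> x0 y0 xy; rewrite -(nngE x0) xy nngE. Qed.

(* For [x < 0], [tshift T x] is the adjoint of the isometry [T (- x)]. *)
Definition tshift (R : realType) (A : cstarAlgType R) (T : {nonneg rat} -> A)
    (x : rat) : A :=
  if 0 <= x then T (nng x) else (T (nng (- x)))^*c.

(** The normal form T_x T_y^* of a word in the isometries and their adjoints. *)
Definition toeplitz_gen (R : realType) (A : cstarAlgType R)
    (T : {nonneg rat} -> A) (p : {nonneg rat} * {nonneg rat}) : A :=
  tshift T p.1%:num *c tshift T (- p.2%:num).

Section toeplitz.
Variables (R : realType) (A : cstarAlgType R) (T : {nonneg rat} -> A).
Hypothesis hT : is_toeplitz T.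
Local Notation V := (tshift T).

Lemma toeplitz_rep : exists (H : hilbertType R) (e : {nonneg rat} -> H)
    (rho : A -> bop H),
  [/\ orthonormal_basis e, star_hom rho, forall x, nrm (rho x) = nrm x &
    forall x s, rho (V x) (e s) =
      if 0 <= x + s%:num then e (nng (x + s%:num)) else 0].
Proof.
have [_ [H [e [pi [be hpi ipi piT]]]]] := hT.
have [[pl pc] pll pM ps] := hpi.
have ee s t : hdot (e s) (e t) = (s == t)%:R by case: be.
have espan : closed_span (range e) = setT by case: be.
(* [pi] is not assumed unital. T_0 fixes every basis vector, hence acts as the identity, and
   faithfulness then identifies it with the unit. *)
have T0 h : pi (T (nng 0)) h = h.
  have [c cb] := continuous_bounded (pl (T (nng 0))) (pc (T (nng 0))).
  have lid : linear (id : H -> H) by [].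
  have bid : bounded_by 1 (id : H -> H) by move=> x; rewrite mul1r.
  congr (_ h); apply: (lin_eq_dense (pl _) lid cb bid espan).
  move=> _ [s _ <-]; rewrite piT; congr e; apply/val_inj.
  by rewrite /= maxxx add0r.
have p1 h : pi cone h = h.
  have <- : T (nng 0) = cone; last exact: T0.
  by apply: ipi; apply/funext => k; rewrite -[T _]cmul1r pM T0.
have [rho [hrho rhoE]] := representation_star_hom hpi p1.
have irho : injective rho.
  move=> x y xy; apply: ipi; apply/funext => k.
  by rewrite -!rhoE xy.
exists H, e, rho; split=> //; first exact: star_hom_isometric.
have HT (r s : {nonneg rat}) : rho (T r) (e s) = e (nng (r%:num + s%:num)).
  by rewrite rhoE piT; congr e; apply/val_inj; rewrite /= max_l.
have HTs (r s : {nonneg rat}) : (rho (T r))^*c (e s) =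
    if r%:num <= s%:num then e (nng (s%:num - r%:num)) else 0.
  pose f (s' : {nonneg rat}) := Some (nng (r%:num + s'%:num)).
  pose g (s' : {nonneg rat}) := if r%:num <= s'%:num then Some (nng (s'%:num - r%:num)) else None.
  have fg x y : f x = Some y <-> g y = Some x.
    rewrite /f /g; split=> [[<-]|].
      have rx0 : 0 <= r%:num + x%:num by rewrite addr_ge0.
      have rx : r%:num <= r%:num + x%:num by rewrite lerDl.
      by rewrite (nngE rx0) rx addrAC subrr add0r nngK.
    case: ifP => // ry [<-]; congr Some; apply/val_inj.
    have yr0 : 0 <= y%:num - r%:num by rewrite subr_ge0.
    by rewrite (nngE yr0) /= addrC subrK max_l.
  have [W [We Wse _]] := partial_injection_bop be fg.
  have -> : rho (T r) = W.
    by apply: (bop_eq_basis be) => t; rewrite HT We.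
  by rewrite Wse /g; case: ifP.
move=> x s; rewrite /tshift; case: ifP => x0.
  by rewrite HT nngE// addr_ge0.
have x0' : 0 <= - x by rewrite oppr_ge0 ltW// ltNge x0.
have [_ _ _ ->] := hrho; rewrite HTs nngE// -subr_ge0 opprK addrC.
by [].
Qed.

(** By faithfulness, a relation in the algebra may be checked on basis vectors. *)
Lemma toeplitz_inj_rel (x y : A) :
  (forall (H : hilbertType R) (e : {nonneg rat} -> H) (rho : A -> bop H),
    orthonormal_basis e -> star_hom rho ->
    (forall x s, rho (V x) (e s) =
      if 0 <= x + s%:num then e (nng (x + s%:num)) else 0) ->
    forall s, rho x (e s) = rho y (e s)) -> x = y.
Proof.
have [H [e [rho [be hrho iso rhoE]]]] := toeplitz_rep.
move=> /(_ H e rho be hrho rhoE) h; apply/subr0_eq/nrm0_eq0.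
rewrite -iso; have [lr _ _ _] := hrho; rewrite (linB lr).
by rewrite (bop_eq_basis be h) subrr nrm0.
Qed.

Lemma tshift0 : V 0 = cone.
Proof.
apply: toeplitz_inj_rel => H e rho be [_ r1 _ _] rhoE s.
by rewrite rhoE r1 add0r ge0 nngK.
Qed.

Lemma tshiftN (x : rat) : V (- x) = (V x)^*c.
Proof.
rewrite /tshift oppr_ge0; case: ltgtP => x0.
- by rewrite starK.
- by rewrite opprK.
- by rewrite x0 oppr0; have := tshift0; rewrite /tshift lexx => ->; rewrite star1.
Qed.

(** As [0 <= y], the factor acting first annihilates no basis vector; for y < 0 < x the two sides
    differ by a product that contains a defect projection. *)
Lemma tshiftM (x y : rat) : 0 <= y -> V x *c V y = V (x + y).
Proof.
move=> y0; apply: toeplitz_inj_rel => H e rho be [_ _ rM _] rhoE s.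
have ys : 0 <= y + s%:num by rewrite addr_ge0.
by rewrite rM bopME !rhoE ys rhoE (nngE ys) addrA.
Qed.

Lemma tshiftMN (x y : rat) : x <= 0 -> V x *c V y = V (x + y).
Proof.
move=> x0; apply: (can_inj (@starK _ _)).
by rewrite starM -!tshiftN tshiftM ?oppr_ge0// opprD addrC.
Qed.

Lemma tshiftV (x : rat) : 0 <= x -> (V x)^*c *c V x = cone.
Proof. by move=> x0; rewrite -tshiftN tshiftM// addNr tshift0. Qed.

Lemma nrm_tshift (x : rat) : nrm (V x) <= 1.
Proof.
wlog x0 : x / 0 <= x => [h|].
  have [|x0] := leP 0 x; first exact: h.
  by rewrite -nrm_star -tshiftN h// oppr_ge0 ltW.
by apply: nrm_unitary; exact: tshiftV.
Qed.

(** The index x - y of T_x T_y^* is additive, which matches the generators with translations of the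
    rationals. *)
Lemma toeplitz_genM p q : exists2 r, toeplitz_gen T p *c toeplitz_gen T q =
  toeplitz_gen T r & r.1%:num - r.2%:num =
    (p.1%:num - p.2%:num) + (q.1%:num - q.2%:num).
Proof.
case: p q => [x1 x2] [y1 y2]; rewrite /toeplitz_gen.
rewrite -!cmulA [X in _ *c X]cmulA (tshiftM _ (ge0 y1)) addrC /=.
have [xy|yx] := leP x2%:num y1%:num.
  have d0 : 0 <= y1%:num - x2%:num by rewrite subr_ge0.
  have d1 : 0 <= x1%:num + (y1%:num - x2%:num) by rewrite addr_ge0.
  exists (nng (x1%:num + (y1%:num - x2%:num)), y2).
    by rewrite (nngE d1) cmulA (tshiftM _ d0).
  by rewrite (nngE d1) /=; ring.
have d0 : y1%:num - x2%:num <= 0 by rewrite subr_le0 ltW.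
have d1 : 0 <= y2%:num + (x2%:num - y1%:num).
  by rewrite addr_ge0// subr_ge0 ltW.
exists (x1, nng (y2%:num + (x2%:num - y1%:num))); last first.
  by rewrite (nngE d1) /=; ring.
rewrite (nngE d1) (tshiftMN _ d0); congr (_ *c V _).
by rewrite opprD opprB addrC.
Qed.

Lemma toeplitz_gen_star p : (toeplitz_gen T p)^*c = toeplitz_gen T (p.2, p.1).
Proof. by rewrite /toeplitz_gen starM -!tshiftN opprK. Qed.

Lemma toeplitz_gen0 (r : {nonneg rat}) : toeplitz_gen T (r, nng 0) = V r%:num.
Proof. by rewrite /toeplitz_gen /= maxxx oppr0 tshift0 cmul1r. Qed.

Lemma tshift_nng (r : {nonneg rat}) : V r%:num = T r.
Proof. by rewrite /tshift ge0 nngK. Qed.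

Lemma toeplitz_span : closed_span (range (toeplitz_gen T)) = setT.
Proof.
apply/seteqP; split=> // x _.
have [sT _] := hT.
have : smallest (@sub_cstar_algebra R A) (range T) x by rewrite sT.
apply; split.
- split; first exact: closed_span_closed.
    apply: closed_spanM => _ _ [p _ <-] [q _ <-].
    have [r -> _] := toeplitz_genM p q.
    by apply: sub_closed_span; exists r.
  apply: closed_span_star => _ [p _ <-].
  by rewrite toeplitz_gen_star; apply: sub_closed_span; exists (p.2, p.1).
- move=> _ [r _ <-]; apply: sub_closed_span; exists (r, nng 0) => //.
  by rewrite toeplitz_gen0 tshift_nng.
Qed.

Lemma toeplitz_hom_eq (B : cstarAlgType R) (f g : A -> B) :
  star_hom f -> star_hom g -> (forall x, 0 <= x -> f (V x) = g (V x)) -> f = g.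
Proof.
move=> hf hg fg.
have [lf _ fM fs] := hf; have [lg _ gM gs] := hg.
apply: (lin_eq_dense lf lg (star_hom_bounded hf) (star_hom_bounded hg) toeplitz_span).
move=> _ [[x y] _ <-]; rewrite /toeplitz_gen /=.
by rewrite !tshiftN fM gM fs gs !fg.
Qed.

End toeplitz.

(** * Characters and Folner sets of the group of positive rationals *)

Lemma Qpos_mulC (a b : Qpos) : (a * b = b * a)%g.
Proof. by apply/val_inj; rewrite /= mulrC. Qed.

Section folner.

(** [undup] accounts for multiplicative relations among the elements of [gs]. *)
Fixpoint Qpos_box (gs : seq Qpos) (m : nat) : seq Qpos :=
  if gs is g :: gs' then
    undup [seq ((g ^+ i) * x)%g | i <- iota 0 m.+1, x <- Qpos_box gs' m]
  else [:: 1%g].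

Lemma Qpos_box_cons g gs m : Qpos_box (g :: gs) m =
  undup [seq ((g ^+ i) * x)%g | i <- iota 0 m.+1, x <- Qpos_box gs m].
Proof. by []. Qed.

Lemma Qpos_box_uniq gs m : uniq (Qpos_box gs m).
Proof. by case: gs => //= g gs; exact: undup_uniq. Qed.

Lemma Qpos_box_size gs m : (size (Qpos_box gs m) <= m.+1 ^ size gs)%N.
Proof.
elim: gs => // g gs IH; rewrite Qpos_box_cons; apply: leq_trans (size_undup _) _.
by rewrite size_allpairs size_iota [size (g :: gs)]/= expnS leq_mul2l IH orbT.
Qed.

Lemma Qpos_box1 gs m : 1%g \in Qpos_box gs m.
Proof.
elim: gs => [|g gs IH]; first by rewrite inE.
rewrite Qpos_box_cons mem_undup; apply/allpairsP; exists (0%N, 1%g) => /=; split=> //.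
by rewrite expg0 mulg1.
Qed.

Lemma Qpos_box_step gs m :
  {subset Qpos_box gs m <= Qpos_box gs m.+1} /\
  forall g, g \in gs -> forall x, x \in Qpos_box gs m ->
    (g * x)%g \in Qpos_box gs m.+1.
Proof.
elim: gs => [|g gs [IH1 IH2]]; first by split.
have mem i x : (i <= m.+1)%N -> x \in Qpos_box gs m.+1 ->
    ((g ^+ i) * x)%g \in Qpos_box (g :: gs) m.+1.
  move=> im xS; rewrite Qpos_box_cons mem_undup; apply/allpairsP; exists (i, x).
  by split=> //; rewrite mem_iota.
have inv x : x \in Qpos_box (g :: gs) m ->
    exists i y, [/\ (i <= m)%N, y \in Qpos_box gs m & x = ((g ^+ i) * y)%g].
  rewrite Qpos_box_cons mem_undup => /allpairsP[[i y] [ii yS ->]].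
  by exists i, y; split=> //; move: ii; rewrite mem_iota.
split=> [x /inv[i [y [im yS ->]]]|h].
  by apply: mem; [exact: leqW | exact: IH1].
rewrite inE => /orP[/eqP ->|hgs] x /inv[i [y [im yS ->]]].
  by rewrite mulgA -expgS; apply: mem => //; exact: IH1.
rewrite mulgA (Qpos_mulC h) -mulgA; apply: mem; first exact: leqW.
exact: IH2.
Qed.

Lemma poly_lt_exp (n k : nat) : (0 < n)%N ->
  exists m, (n ^ m * m.+1 ^ k < n.+1 ^ m)%N.
Proof.
(* By Bernoulli, (n+1)^m >= n^m (N+1)^(k+1) for this exponent m, while m + 1 <= n (k+1) (N+1); the
   value of N gives (m+1)^k <= N (N+1)^k < (N+1)^(k+1). *)
move=> n0; pose N := ((n * k.+1) ^ k)%N; exists (n * N * k.+1)%N.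
have bern (p : nat) : (n ^ (n * p) * p.+1 <= n.+1 ^ (n * p))%N.
  have H q : (n ^ q * (n + q) <= n.+1 ^ q * n)%N.
    elim: q => [|q IH]; first by rewrite !expn0 addn0.
    rewrite !expnS -!mulnA; apply: (@leq_trans (n.+1 * (n ^ q * (n + q)))).
      by move: (n ^ q)%N => c; nia.
    by rewrite leq_mul2l IH orbT.
  have := H (n * p)%N; move: (n ^ (n * p))%N (n.+1 ^ (n * p))%N => c d h.
  by rewrite -(leq_pmul2r n0); nia.
set m := (n * N * k.+1)%N.
have h1 : (n ^ m * N.+1 ^ k.+1 <= n.+1 ^ m)%N.
  by rewrite /m !(expnM _ (n * N)) -expnMn leq_exp2r.
apply: leq_trans h1; rewrite ltn_pmul2l ?expn_gt0 ?n0//.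
have h2 : (m.+1 <= n * k.+1 * N.+1)%N.
  have nk0 : (0 < n * k.+1)%N by rewrite muln_gt0 n0.
  by rewrite /m; move: (N) => N'; nia.
apply: (@leq_ltn_trans ((n * k.+1 * N.+1) ^ k)%N); first by case: (k) h2 => // k' h2; rewrite leq_exp2r.
by rewrite expnMn expnS ltn_pmul2r ?expn_gt0.
Qed.

(* The boxes spanned by [gs] grow polynomially, so some of them grow by a
   factor at most [1 + 1/n] at the next step. *)
Lemma Qpos_folner (gs : seq Qpos) (n : nat) : (0 < n)%N ->
  exists S : seq Qpos, [/\ uniq S, (0 < size S)%N &
    forall g, g \in gs ->
      (count (fun t => (g * t)%g \notin S) S * n <= size S)%N].
Proof.
move=> n0; pose a m := size (Qpos_box gs m).
have [[m mP]|H] := pselect (exists m, ((a m.+1 - a m) * n <= a m)%N).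
  exists (Qpos_box gs m); split; first exact: Qpos_box_uniq.
    by have := Qpos_box1 gs m; case: (Qpos_box gs m).
  move=> g ggs; apply: leq_trans mP; rewrite leq_mul2r; apply/orP; right.
  rewrite leq_subRL; last first.
    by apply: uniq_leq_size; [exact: Qpos_box_uniq | exact: (Qpos_box_step _ _).1].
  rewrite /a -size_filter -(size_map (fun t => (g * t)%g)) -size_cat.
  apply: uniq_leq_size.
    rewrite cat_uniq Qpos_box_uniq map_inj_uniq; last exact: mulgI.
    rewrite filter_uniq ?Qpos_box_uniq// andbT; apply/hasPn => x /mapP[t].
    by rewrite mem_filter => /andP[gt _] ->.
  move=> x; rewrite mem_cat => /orP[|/mapP[t]].
    exact: (Qpos_box_step _ _).1.
  rewrite mem_filter => /andP[_ tS] ->.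
  exact: (Qpos_box_step _ _).2.
exfalso; have [m mP] := poly_lt_exp (size gs) n0.
have : (n.+1 ^ m <= n ^ m * a m)%N.
  elim: (m) => [|q IH]; first by rewrite !expn0 mul1n /a; have := Qpos_box1 gs 0; case: (Qpos_box gs 0).
  have : ~~ ((a q.+1 - a q) * n <= a q)%N by apply/negP => h; apply: H; exists q.
  rewrite -ltnNge => h.
  have h2 : (n.+1 * a q <= n * a q.+1)%N.
    by move: h; rewrite mulSn mulnBl => h; lia.
  rewrite expnS; apply: (@leq_trans (n.+1 * (n ^ q * a q))).
    by rewrite leq_mul2l IH orbT.
  by rewrite mulnCA expnS [leqRHS]mulnAC mulnC leq_mul2r h2 orbT.
rewrite leqNgt => /negP; apply; apply: leq_ltn_trans mP.
by rewrite leq_mul2l Qpos_box_size orbT.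
Qed.

End folner.

Section characters.
Variable R : realType.
Implicit Types (gamma delta : dual R Qpos) (g h : Qpos).

Lemma dual_mulJ gamma g : gamma g * ((gamma g)^*)%C = 1.
Proof. by rewrite mul_conj /nrm dual_norm1 expr1n. Qed.

Lemma dual_one gamma : gamma 1%g = 1.
Proof.
have := dualM gamma 1%g 1%g; rewrite mulg1 => /esym E.
have g0 : gamma 1%g != 0 by rewrite -normr_eq0 dual_norm1 oner_eq0.
by apply: (mulfI g0); rewrite E mulr1.
Qed.

Lemma dual_inv gamma g : gamma g^-1%g = ((gamma g)^*)%C.
Proof.
have g0 : gamma g != 0 by rewrite -normr_eq0 dual_norm1 oner_eq0.
by apply: (mulfI g0); rewrite -dualM mulgV dual_one dual_mulJ.
Qed.

Definition dual_mul gamma delta : dual R Qpos.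
Proof.
refine (@Dual _ _ (fun g => gamma g * delta g) _ _) => [g|g h].
  by rewrite normrM !dual_norm1 mulr1.
by rewrite !dualM mulrACA.
Defined.

Definition dual_unit : dual R Qpos.
Proof.
by refine (@Dual _ _ (fun=> 1) _ _) => [g|g h]; rewrite ?normr1 ?mulr1.
Defined.

(* The character [a |-> a ^ (i pi / ln h)]. *)
Lemma dual_separates h : h != 1%g -> exists gamma, gamma h = -1.
Proof.
move=> h1; pose l (g : Qpos) : R := ln (ratr g%:num).
have lM g k : l (g * k)%g = l g + l k.
  by rewrite /l rmorphM /= lnM ?posrE ?ltr0q.
have lh : l h != 0.
  rewrite ln_eq0 ?ltr0q//; apply: contra h1 => /eqP hh; apply/eqP/val_inj.
  by apply: (@fmorph_inj _ _ (@ratr R)); apply: etrans hh (esym (rmorph1 _)).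
pose t := pi / l h.
pose f (g : Qpos) : R[i] := (cos (t * l g) +i* sin (t * l g))%C.
have f1 g : `|f g| = 1 by rewrite normc_def /= cos2Dsin2 sqrtr1.
have fM g k : f (g * k)%g = f g * f k.
  by rewrite /f lM mulrDr cosD sinD; apply/eqP; rewrite eq_complex /= [sin _ * _ + _]addrC !eqxx.
exists (Dual f1 fM) => /=; rewrite /f /t mulfVK// cospi sinpi.
by apply/eqP; rewrite eq_complex /= oppr0 !eqxx.
Qed.

(** A finite substitute for Haar measure on the dual. To a family that works for [hs], adjoin its
    translate by a character with value -1 at the new element [k]: the sums at [k] cancel, and those
    that vanished remain 0. *)
Lemma dual_average (hs : seq Qpos) : exists Gamma : seq (dual R Qpos),
  (0 < size Gamma)%N /\
  forall h, h \in hs -> h != 1%g -> \sum_(gamma <- Gamma) gamma h = 0.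
Proof.
elim: hs => [|k hs [Gamma [G0 GP]]]; first by exists [:: dual_unit].
have [->|k1] := eqVneq k 1%g.
  exists Gamma; split=> // h; rewrite inE => /orP[/eqP ->|]; last exact: GP.
  by rewrite eqxx.
have [delta dk] := dual_separates k1.
exists (Gamma ++ [seq dual_mul delta gamma | gamma <- Gamma]); split.
  by rewrite size_cat addn_gt0 G0.
move=> h; rewrite inE big_cat big_map /= -mulr_sumr => /orP[/eqP ->|hs1] h1.
  by rewrite dk mulN1r subrr.
by rewrite GP// mulr0 addr0.
Qed.

End characters.

(** * The conditional expectation of a crossed product *)

Lemma unitary_nrm (R : realType) (G : groupType) (D : cstarAlgType R)
  (u : G -> D) g : unitary_representation u -> nrm (u g) <= 1.
Proof. by case=> _ _ uu _; exact: nrm_unitary. Qed.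

Lemma unitary_inv (R : realType) (G : groupType) (D : cstarAlgType R)
  (u : G -> D) g : unitary_representation u -> u g^-1%g = (u g)^*c.
Proof.
case=> u1 uM uu uu'.
by rewrite -[LHS]cmul1l -(uu g) -cmulA -uM mulgV u1 cmul1r.
Qed.

Section crossed.
Variables (R : realType) (A B : cstarAlgType R) (alpha : Qpos -> A -> A).
Variables (j : A -> B) (u : Qpos -> B).
Hypothesis hB : is_crossed_product alpha j u.

Let hj : star_hom j. Proof. by case: hB => -[]. Qed.
Let hu : unitary_representation u. Proof. by case: hB => -[]. Qed.
Let lj : linear j. Proof. by case: hj. Qed.
Let jM x y : j (x *c y) = j x *c j y. Proof. by case: hj => _ _ ->. Qed.
Let js x : j x^*c = (j x)^*c. Proof. by case: hj => _ _ _ ->. Qed.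
Let u1 : u 1%g = cone. Proof. by case: hu. Qed.
Let uM g h : u (g * h)%g = u g *c u h. Proof. by case: hu => _ ->. Qed.

Definition crossed_gen (p : Qpos * A) : B := u p.1 *c j p.2.

Lemma crossed_span : closed_span (range crossed_gen) = setT.
Proof.
case: hB => _ <- _; congr closed_span; apply/seteqP; split=> [_ [[g x] _ <-]|].
  by exists g, x.
by move=> _ [g [x ->]]; exists (g, x).
Qed.

Lemma crossed_comm g x : j x *c u g = u g *c j (alpha g^-1%g x).
Proof.
case: hB => -[_ _ cov] _ _; rewrite cov unitary_inv// starK.
by case: hu => _ _ _ uu'; rewrite !cmulA uu' cmul1l.
Qed.

Lemma crossed_gen_mull y p : j y *c crossed_gen p =
  crossed_gen (p.1, alpha p.1^-1%g y *c p.2).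
Proof. by rewrite /crossed_gen cmulA crossed_comm -cmulA -jM. Qed.

Lemma crossed_gen_star p : (crossed_gen p)^*c =
  crossed_gen (p.1^-1%g, alpha p.1 p.2^*c).
Proof.
rewrite /crossed_gen starM -js -unitary_inv//.
by rewrite crossed_comm invgK.
Qed.

(** For fixed [gamma], the embedding [j] and the unitaries gamma(g) u_g are again covariant, and the
    universal property gives [theta gamma]. *)
Lemma dual_action : exists theta : dual R Qpos -> B -> B, forall gamma,
  star_hom (theta gamma) /\
  forall p, theta gamma (crossed_gen p) = gamma p.1 *: crossed_gen p.
Proof.
suff /choice[th thP] : forall gamma : dual R Qpos, exists th : B -> B, star_hom th /\
    forall p, th (crossed_gen p) = gamma p.1 *: crossed_gen p.
  by exists th.
move=> gamma; pose v g := gamma g *: u g.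
have vs g : (v g)^*c = ((gamma g)^*)%C *: (u g)^*c by rewrite /v starZ.
have uu g : (u g)^*c *c u g = cone by case: hu.
have uu' g : u g *c (u g)^*c = cone by case: hu.
have cv : covariant alpha j v.
  split=> //.
    split=> [|g h|g|g].
    - by rewrite /v dual_one scale1r.
    - by rewrite /v uM dualM cmulZl cmulZr scalerA.
    - by rewrite vs cmulZl cmulZr scalerA mulrC dual_mulJ scale1r.
    - by rewrite vs cmulZl cmulZr scalerA dual_mulJ scale1r.
  move=> g x; case: hB => -[_ _ cov] _ _.
  by rewrite cov vs /v !cmulZl cmulZr scalerA dual_mulJ scale1r.
case: hB => _ _ /(_ B j v cv)[th [hth thj thu]]; exists th; split=> // -[g x].
have [_ _ thM _] := hth; rewrite /crossed_gen thM /=.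
have -> : th (u g) = v g by rewrite -thu.
have -> : th (j x) = j x by rewrite -[in RHS]thj.
by rewrite cmulZl.
Qed.

Lemma dual_action_sum (theta : dual R Qpos -> B -> B) (c : dual R Qpos -> R[i])
    (Gamma : seq (dual R Qpos)) l :
  (forall gamma, star_hom (theta gamma) /\
    forall p, theta gamma (crossed_gen p) = gamma p.1 *: crossed_gen p) ->
  \sum_(gamma <- Gamma) c gamma *: theta gamma (lcomb crossed_gen l) =
  \sum_(p <- l) (p.1 * \sum_(gamma <- Gamma) c gamma * gamma p.2.1) *: crossed_gen p.2.
Proof.
move=> H; rewrite (eq_bigr (fun gamma : dual R Qpos => \sum_(p <- l)
    (p.1 * (c gamma * gamma p.2.1)) *: crossed_gen p.2)).
  by rewrite exchange_big /=; apply: eq_bigr => p _; rewrite mulr_sumr scaler_suml.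
move=> gamma _; have [[lth _ _ _] thE] := H gamma.
rewrite lin_lcomb// /lcomb scaler_sumr; apply: eq_bigr => p _.
by rewrite /= thE !scalerA; congr (_ *: _); ring.
Qed.

Lemma sum_same (Gamma : seq (dual R Qpos)) :
  \sum_(gamma <- Gamma) 1 = ((size Gamma)%:R : R[i]).
Proof. by rewrite big_const_seq count_predT iter_addr_0. Qed.

Lemma nrm_natr n : nrm (n%:R : R[i]) = n%:R.
Proof.
have -> : (n%:R : R[i]) = ((n%:R : R)%:C)%C by rewrite rmorph_nat.
by rewrite nrm_real ger0_norm.
Qed.

Lemma nrm_average (theta : dual R Qpos -> B -> B) (c : dual R Qpos -> R[i])
    (Gamma : seq (dual R Qpos)) b :
  (forall gamma, star_hom (theta gamma)) ->
  nrm (\sum_(gamma <- Gamma) c gamma *: theta gamma b) <=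
    (\sum_(gamma <- Gamma) nrm (c gamma)) * nrm b.
Proof.
move=> H; apply: le_trans (nrm_sum _ _ _) _; rewrite mulr_suml.
apply: ler_sum => gamma _; rewrite nrm_scale ler_wpM2l ?nrm_ge0//.
by have := star_hom_bounded (H gamma) b; rewrite mul1r.
Qed.

(** On a finite combination, [E] is the average of the [theta gamma] over a family adapted to its
    support; it is therefore contractive and extends. Positivity passes to the limit from averages
    of elements theta(d)^* theta(d), and is expressed by vector states of representations. *)
Lemma expectation_exists : exists E : B -> B,
  [/\ linear E, bounded_by 1 E,
      forall p, E (crossed_gen p) = if p.1 == 1%g then j p.2 else 0 &
      forall (H : hilbertType R) (pi : B -> bop H) (d : B) (h : H),
        star_hom pi -> 0 <= complex.Re (hdot (pi (E (d^*c *c d)) h) h)].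
Proof.
have [theta thP] := dual_action.
have thh gamma : star_hom (theta gamma) by have [] := thP gamma.
pose s (p : Qpos * A) := if p.1 == 1%g then j p.2 else 0.
have avg l : exists Gamma : seq (dual R Qpos), (0 < size Gamma)%N /\
    \sum_(gamma <- Gamma) theta gamma (lcomb crossed_gen l) =
    (size Gamma)%:R *: lcomb s l.
  have [Gamma [G0 GP]] := dual_average R [seq p.2.1 | p <- l].
  exists Gamma; split=> //.
  rewrite (eq_bigr (fun gamma : dual R Qpos =>
    1 *: theta gamma (lcomb crossed_gen l))) => [|gamma _]; last by rewrite scale1r.
  rewrite (dual_action_sum (fun=> 1) _ _ thP) scaler_sumr.
  rewrite !big_seq; apply: eq_bigr => p pl; rewrite scalerA.
  rewrite (eq_bigr (fun gamma : dual R Qpos => gamma p.2.1)) => [|gamma _]; last by rewrite mul1r.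
  rewrite /s /crossed_gen; case: eqP => [->|/eqP g1].
    rewrite u1 cmul1l mulrC; congr (_ * _ *: _).
    by rewrite -sum_same; apply: eq_bigr => gamma _; rewrite dual_one.
  rewrite GP ?mulr0 ?scale0r ?scaler0//; apply/mapP; by exists p.
have bnd l : nrm (lcomb s l) <= 1 * nrm (lcomb crossed_gen l).
  have [Gamma [G0 GE]] := avg l.
  have := nrm_average (fun=> 1) Gamma (lcomb crossed_gen l) thh.
  rewrite (eq_bigr (fun gamma => theta gamma (lcomb crossed_gen l))) => [|gamma _]; last by rewrite scale1r.
  rewrite GE nrm_scale nrm_natr.
  rewrite (eq_bigr (fun=> 1)) => [|gamma _]; last by rewrite nrm1.
  by rewrite big_const_seq count_predT iter_addr_0 mul1r ler_pM2l// ltr0n.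
have [E [lE bE EE]] := bounded_extension ler01 crossed_span bnd.
exists E; split=> // H pi d h hpi.
apply/ler_addgt0Pl => e e0.
have [lpi pi1 piM pis] := hpi; have bpi := star_hom_bounded hpi.
pose b := d^*c *c d.
have h0 : 0 < 2 * nrm h ^+ 2 + 1 by have := nrm_ge0 h; nra.
pose r := e / (2 * nrm h ^+ 2 + 1); have r0 : 0 < r by rewrite divr_gt0.
have bT : closed_span (range crossed_gen) b by rewrite crossed_span.
have [l bl] := closed_span_lcomb bT r0.
set b0 := lcomb crossed_gen l in bl.
have [Gamma [G0 GE]] := avg l.
have Gn0 : (size Gamma)%:R != 0 :> R[i] by rewrite pnatr_eq0 -lt0n.
have Eb0 : E b0 = (size Gamma)%:R^-1 *: \sum_(gamma <- Gamma) theta gamma b0.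
  rewrite GE scalerA mulVf// scale1r /b0 lin_lcomb//.
  by rewrite /lcomb; apply: eq_bigr => p _; rewrite /= EE.
(* The family is adapted to the approximant [b0], yet averaging [b] itself gives a manifestly
   positive [S], at distance at most 2 r from [E b]. *)
pose S := (size Gamma)%:R^-1 *: \sum_(gamma <- Gamma) theta gamma b.
have ES : nrm (E b - S) <= 2 * r.
  apply: le_trans (nrm_tri (E b0) _ _) _.
  rewrite -linB//; have := bE (b - b0); rewrite mul1r => h1.
  have : nrm (E b0 - S) <= nrm (b0 - b).
    rewrite Eb0 /S -scalerBr nrm_scale -sumrB.
    have := nrm_average (fun=> 1) Gamma (b0 - b) thh.
    rewrite (eq_bigr (fun gamma => theta gamma b0 - theta gamma b)) => [|gamma _]; last first.
      by rewrite scale1r linB//; have [] := thh gamma.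
    rewrite (eq_bigr (fun=> 1)) => [|gamma _]; last by rewrite nrm1.
    rewrite big_const_seq count_predT iter_addr_0 => h2.
    have -> : nrm ((size Gamma)%:R^-1 : R[i]) = (size Gamma)%:R^-1.
      have -> : ((size Gamma)%:R^-1 : R[i]) = (((size Gamma)%:R^-1 : R)%:C)%C.
        by rewrite fmorphV rmorph_nat.
      by rewrite nrm_real ger0_norm// invr_ge0.
    by rewrite ler_pdivrMl ?ltr0n.
  by rewrite (nrm_distC b0); lra.
have S0 : 0 <= complex.Re (hdot (pi S h) h).
  have -> : hdot (pi S h) h =
      (((size Gamma)%:R^-1 * \sum_(gamma <- Gamma) nrm (pi (theta gamma d) h) ^+ 2)%:C)%C.
    rewrite /S (linZ lpi) (lin_sum lpi) bopZE bop_sumE hdotZl hdot_suml.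
    rewrite rmorphM fmorphV rmorph_nat rmorph_sum; congr (_ * _).
    apply: eq_bigr => gamma _; have [_ _ thM ths] := thh gamma.
    by rewrite /b thM ths piM pis bopME hdot_starl hdot_nrm.
  rewrite /= mulr_ge0 ?invr_ge0// sumr_ge0// => gamma _.
  by rewrite sqr_ge0.
have dist : nrm (hdot (pi (E b) h) h - hdot (pi S h) h) <= 2 * r * nrm h ^+ 2.
  rewrite -hdotBl -bopBE -(linB lpi).
  apply: le_trans (cauchy_schwarz _ _) _.
  rewrite expr2 mulrA ler_wpM2r ?nrm_ge0//.
  apply: le_trans (nrm_bopP _ _) _; rewrite ler_wpM2r ?nrm_ge0//.
  by apply: le_trans ES; have := bpi (E b - S); rewrite mul1r.
have rE : r * (2 * nrm h ^+ 2 + 1) = e by rewrite /r mulfVK// gt_eqF.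
have := le_trans (Re_nrm _) dist; rewrite raddfB /= ler_norml => /andP[].
by rewrite -/b; move: rE; rewrite mulrDr mulr1; lra.
Qed.

End crossed.

(** * Fourier coefficients and Fejer means *)

Section expectation.
Variables (R : realType) (A B : cstarAlgType R) (alpha : Qpos -> A -> A).
Variables (j : A -> B) (u : Qpos -> B).
Hypothesis hB : is_crossed_product alpha j u.
Variable E : B -> B.
Hypotheses (lE : linear E) (bE : bounded_by 1 E).
Hypothesis EE : forall p, E (crossed_gen j u p) = if p.1 == 1%g then j p.2 else 0.
Hypothesis Epos : forall (H : hilbertType R) (pi : B -> bop H) (d : B) (h : H),
  star_hom pi -> 0 <= complex.Re (hdot (pi (E (d^*c *c d)) h) h).

Let hj : star_hom j. Proof. by case: hB => -[]. Qed.
Let hu : unitary_representation u. Proof. by case: hB => -[]. Qed.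
Let jM x y : j (x *c y) = j x *c j y. Proof. by case: hj => _ _ ->. Qed.
Let js x : j x^*c = (j x)^*c. Proof. by case: hj => _ _ _ ->. Qed.
Let u1 : u 1%g = cone. Proof. by case: hu. Qed.
Let uM g h : u (g * h)%g = u g *c u h. Proof. by case: hu => _ ->. Qed.
Let jspan := closed_span (range j).
Let BT b : closed_span (range (crossed_gen j u)) b.
Proof. by rewrite (crossed_span hB). Qed.

Lemma crossed_alpha1 x : j (alpha 1%g x) = j x.
Proof. by case: hB => -[_ _ ->] _ _; rewrite u1 star1 cmul1l cmul1r. Qed.

Lemma expectation_star b : E b^*c = (E b)^*c.
Proof.
have ls : linear (fun b => (E b^*c)^*c).
  by move=> a x y; rewrite star_semilinear lE star_semilinear conjcK.
have bs : bounded_by 1 (fun b => (E b^*c)^*c).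
  by move=> x; rewrite nrm_star; apply: le_trans (bE _) _; rewrite nrm_star.
have := lin_eq_dense ls lE bs bE (crossed_span hB).
move=> /(_ _)/(congr1 (fun f => f b)) <-; first by rewrite starK.
move=> _ [[g x] _ <-]; rewrite (crossed_gen_star hB) !EE /=.
have [->|g1] := eqVneq g 1%g; first by rewrite invg1 eqxx crossed_alpha1 js starK.
case: eqP => [gV|_]; last by rewrite star0.
by case/eqP: g1; rewrite -[g]invgK gV invg1.
Qed.

Lemma expectation_jl a b : E (j a *c b) = j a *c E b.
Proof.
have l1 : linear (fun b => E (j a *c b)) by move=> c x y; rewrite cmul_linearr lE.
have l2 : linear (fun b => j a *c E b) by move=> c x y; rewrite lE cmul_linearr.
have b1 : bounded_by (nrm (j a)) (fun b => E (j a *c b)).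
  by move=> x; apply: le_trans (bE _) _; rewrite mul1r nrmM.
have b2 : bounded_by (nrm (j a)) (fun b => j a *c E b).
  move=> x; apply: le_trans (nrmM _ _) _; rewrite ler_wpM2l ?nrm_ge0//.
  by have := bE x; rewrite mul1r.
have := lin_eq_dense l1 l2 b1 b2 (crossed_span hB).
move=> /(_ _)/(congr1 (fun f => f b)); apply.
move=> _ [[g x] _ <-]; rewrite (crossed_gen_mull hB) !EE /=.
have [->|g1] := eqVneq g 1%g; last by rewrite cmul0r.
by rewrite invg1 jM crossed_alpha1.
Qed.

Lemma expectation_j a : E (j a) = j a.
Proof.
by have := EE (1%g, a); rewrite /crossed_gen u1 cmul1l eqxx.
Qed.

Lemma expectation_range b : jspan (E b).
Proof.
have cs : closed_subspace (E @^-1` jspan).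
  exact: (closed_subspace_preimage lE bE (closed_span_closed _)).
apply: (closed_span_min cs _ (BT b)) => _ [[g x] _ <-] /=; rewrite EE /=.
case: ifP => _; first by apply: sub_closed_span; exists x.
by have [_ []] := closed_span_closed (range j).
Qed.

Lemma expectation_id y : jspan y -> E y = y.
Proof.
have lid : linear (id : B -> B) by [].
have bid : bounded_by 1 (id : B -> B) by move=> x; rewrite mul1r.
apply: (closed_span_min (closed_subspace_eq lE lid bE bid)).
by move=> _ [a _ <-]; exact: expectation_j.
Qed.

Lemma expectation_mull y b : jspan y -> E (y *c b) = y *c E b.
Proof.
move=> hy.
have l1 : linear (fun y => E (y *c b)) by move=> c x z; rewrite cmul_linearl lE.
have l2 : linear (fun y => y *c E b) by exact: linear_cmulr.
have b1 : bounded_by (nrm b) (fun y => E (y *c b)).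
  by move=> x; apply: le_trans (bE _) _; rewrite mul1r mulrC nrmM.
have b2 : bounded_by (nrm (E b)) (fun y => y *c E b) by exact: bounded_cmulr.
apply: (closed_span_min (closed_subspace_eq l1 l2 b1 b2) _ hy).
by move=> _ [a _ <-]; exact: expectation_jl.
Qed.

Lemma jspan_star y : jspan y -> jspan y^*c.
Proof.
apply: closed_span_star => _ [x _ <-]; rewrite -js.
by apply: sub_closed_span; exists x^*c.
Qed.

Lemma expectation_mulr y b : jspan y -> E (b *c y) = E b *c y.
Proof.
move=> hy; apply: (can_inj (@starK _ _)).
rewrite -expectation_star !starM expectation_mull ?expectation_star//.
exact: jspan_star.
Qed.

Definition fcoef g b := E ((u g)^*c *c b).

Lemma fcoef_gen g p :
  fcoef g (crossed_gen j u p) = if p.1 == g then j p.2 else 0.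
Proof.
rewrite /fcoef /crossed_gen cmulA -unitary_inv// -uM.
have := EE ((g^-1 * p.1)%g, p.2); rewrite /crossed_gen /= => ->.
by rewrite -(inj_eq (@mulgI _ g)) mulgA mulgV mul1g mulg1.
Qed.

Lemma fcoef_linear g : linear (fcoef g).
Proof. by move=> a x y; rewrite /fcoef cmul_linearr lE. Qed.

Lemma nrm_u g : nrm (u g) <= 1.
Proof. exact: unitary_nrm. Qed.

Lemma fcoef_bounded g : bounded_by 1 (fcoef g).
Proof.
move=> x; apply: le_trans (bE _) _; rewrite ler_wpM2l//.
apply: le_trans (nrmM _ _) _; rewrite nrm_star.
by have := nrm_u g; have := nrm_ge0 x; nra.
Qed.

(** Bessel's inequality: with y the coefficient at [g], positivity applied to b - u_g y bounds y^* y
    by the expectation of b^* b. *)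
Lemma fcoef_le (H : hilbertType R) (pi : B -> bop H) g b h : star_hom pi ->
  nrm (pi (fcoef g b) h) ^+ 2 <= complex.Re (hdot (pi (E (b^*c *c b)) h) h).
Proof.
move=> hpi; have [lpi _ piM pis] := hpi.
pose y := fcoef g b; have hy : jspan y by exact: expectation_range.
have uu : (u g)^*c *c u g = cone by case: hu.
have := @Epos _ pi (b - u g *c y) h hpi.
rewrite starB cmulBl !cmulBr !starM.
have -> : y^*c *c (u g)^*c *c (u g *c y) = y^*c *c y.
  by rewrite -!cmulA (cmulA (u g)^*c) uu cmul1l.
have -> : b^*c *c (u g *c y) = ((u g)^*c *c b)^*c *c y.
  by rewrite starM starK cmulA.
have hys : jspan y^*c by exact: jspan_star.
have E1 : E (((u g)^*c *c b)^*c *c y) = y^*c *c y.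
  by rewrite (expectation_mulr _ hy) expectation_star.
have E2 : E (y^*c *c (u g)^*c *c b) = y^*c *c y.
  by rewrite -cmulA (expectation_mull _ hys).
have E3 : E (y^*c *c y) = y^*c *c y.
  by rewrite (expectation_mull _ hys) (expectation_id hy).
rewrite !(linB lE) E1 E2 E3.
rewrite subrr subr0 (linB lpi) bopBE hdotBl piM pis bopME hdot_starl hdot_nrm.
by rewrite raddfB /= subr_ge0.
Qed.

(** When [S] has no repetition, the coefficient at g is multiplied by the proportion of those t in S
    for which g t is in S. These multipliers come from the Fejer kernel |sum of gamma(s) over S|^2 /
    |S|. *)
Definition fejer (S : seq Qpos) b := ((size S)%:R^-1 : R[i]) *:
  \sum_(s <- S) \sum_(t <- S) u (s * t^-1)%g *c fcoef (s * t^-1)%g b.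

Lemma fejer_linear S : linear (fejer S).
Proof.
move=> a x y; rewrite /fejer scalerA mulrC -scalerA -scalerDr; congr (_ *: _).
rewrite scaler_sumr -big_split; apply: eq_bigr => s _ /=.
rewrite scaler_sumr -big_split; apply: eq_bigr => t _ /=.
by rewrite fcoef_linear cmul_linearr.
Qed.

Lemma fejer_gen S p : fejer S (crossed_gen j u p) =
  ((size S)%:R^-1 * \sum_(s <- S) \sum_(t <- S) (p.1 == s * t^-1)%g%:R) *:
    crossed_gen j u p.
Proof.
rewrite /fejer -scalerA scaler_suml; congr (_ *: _); apply: eq_bigr => s _.
rewrite scaler_suml; apply: eq_bigr => t _.
rewrite fcoef_gen; case: eqP => [<-|_]; first by rewrite scale1r.
by rewrite cmul0r scale0r.
Qed.

Lemma sum_eq_count (S : seq Qpos) g : uniq S ->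
  \sum_(s <- S) \sum_(t <- S) (g == s * t^-1)%g%:R =
  (count (fun t => (g * t)%g \in S) S)%:R :> R[i].
Proof.
move=> uS; rewrite exchange_big /= -sum1_count natr_sum [RHS]big_mkcond /=.
apply: eq_bigr => t _.
have E1 s : (g == s * t^-1)%g = (s == g * t)%g.
  by rewrite -(inj_eq (@mulIg _ t)) mulgVK eq_sym.
rewrite (eq_bigr (fun s => (s == g * t)%g%:R)) => [|s _]; last by rewrite E1.
rewrite -natr_sum; have -> : (if (g * t)%g \in S then 1 else 0 : R[i]) = ((g * t)%g \in S)%:R.
  by case: (_ \in _).
congr (_%:R); rewrite -big_mkcond sum1_count.
by have := count_uniq_mem (g * t)%g uS.
Qed.

Lemma nrm_natV n : nrm ((n%:R)^-1 : R[i]) = (n%:R)^-1.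
Proof.
have -> : ((n%:R)^-1 : R[i]) = (((n%:R)^-1 : R)%:C)%C by rewrite fmorphV rmorph_nat.
by rewrite nrm_real ger0_norm// invr_ge0.
Qed.

(** [fejer S] averages the dual action against a nonnegative kernel of mean 1, on each finite
    combination through a finite family of characters; an average of contractions is a
    contraction. *)
Lemma fejer_bounded S : uniq S -> (0 < size S)%N -> bounded_by 1 (fejer S).
Proof.
move=> uS S0 b; rewrite mul1r.
(* A crude bound is enough here, as [le_dense] asks for continuity only. *)
have bF : exists c, bounded_by c (fejer S).
  exists ((size S)%:R^-1 * \sum_(s <- S) \sum_(t <- S) 1) => x.
  rewrite /fejer nrm_scale nrm_natV -mulrA ler_wpM2l ?invr_ge0//.
  apply: le_trans (nrm_sum _ _ _) _; rewrite mulr_suml ler_sum// => s _.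
  apply: le_trans (nrm_sum _ _ _) _; rewrite mulr_suml ler_sum// => t _.
  apply: le_trans (nrmM _ _) _.
  have := fcoef_bounded (s * t^-1)%g x; have := nrm_u (s * t^-1)%g.
  by have := nrm_ge0 (fcoef (s * t^-1)%g x); nra.
have [c bFc] := bF.
have lid : linear (id : B -> B) by [].
have bid : bounded_by 1 (id : B -> B) by move=> x; rewrite mul1r.
apply: (le_dense (fejer_linear S) lid bFc bid (crossed_span hB)) => l.
have [theta thP] := dual_action hB.
have thh gamma : star_hom (theta gamma) by have [] := thP gamma.
(* These are all the group elements at which character sums occur for the combination [l]; the entry
   g = 1 gives the total mass of [K]. *)
pose hs := [seq (st.1^-1 * st.2 * g)%g | st <- [seq (s, t) | s <- S, t <- S],
  g <- 1%g :: [seq p.2.1 | p <- l]].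
have [Gamma [G0 GP]] := dual_average R hs.
pose K (gamma : dual R Qpos) : R[i] :=
  \sum_(s <- S) \sum_(t <- S) gamma (s^-1 * t)%g.
have KE (gamma : dual R Qpos) :
    K gamma = ((nrm (\sum_(s <- S) gamma s) ^+ 2)%:C)%C.
  rewrite -mul_conj mulrC rmorph_sum mulr_suml; apply: eq_bigr => s _ /=.
  by rewrite mulr_sumr; apply: eq_bigr => t _; rewrite dualM dual_inv.
have Ksum g : g \in 1%g :: [seq p.2.1 | p <- l] ->
    \sum_(gamma <- Gamma) K gamma * gamma g =
    (size Gamma)%:R * \sum_(s <- S) \sum_(t <- S) (g == s * t^-1)%g%:R.
  move=> gl; rewrite (eq_bigr (fun gamma : dual R Qpos =>
      \sum_(s <- S) \sum_(t <- S) gamma (s^-1 * t * g)%g)); last first.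
    move=> gamma _; rewrite mulr_suml; apply: eq_bigr => s _.
    by rewrite mulr_suml; apply: eq_bigr => t _; rewrite -dualM.
  rewrite exchange_big mulr_sumr !big_seq; apply: eq_bigr => s sS /=.
  rewrite exchange_big mulr_sumr !big_seq; apply: eq_bigr => t tS /=.
  have -> : (g == s * t^-1)%g = (s^-1 * t * g == 1)%g.
    rewrite -(inj_eq (@mulgI _ (s^-1 * t)%g)); congr (_ == _).
    by rewrite (Qpos_mulC s^-1%g) -!mulgA (mulgA s^-1%g) mulVg mul1g mulgV.
  have [->|stg] := eqVneq (s^-1 * t * g)%g 1%g.
    by rewrite mulr1 -sum_same; apply: eq_bigr => gamma _; rewrite dual_one.
  rewrite mulr0; apply: GP => //; apply/allpairsP; exists ((s, t), g); split => //.
  by apply/allpairsP; exists (s, t).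
have GS0 : 0 < (size Gamma)%:R * (size S)%:R :> R by rewrite mulr_gt0// ltr0n.
have Sn0 : (size S)%:R != 0 :> R[i] by rewrite pnatr_eq0 -lt0n.
have E1 : \sum_(gamma <- Gamma) K gamma *: theta gamma (lcomb (crossed_gen j u) l) =
    ((size Gamma)%:R * (size S)%:R) *: fejer S (lcomb (crossed_gen j u) l).
  rewrite (dual_action_sum K Gamma l thP) (lin_lcomb _ _ (fejer_linear S)).
  rewrite /lcomb scaler_sumr !big_seq; apply: eq_bigr => p pl /=.
  rewrite fejer_gen !scalerA Ksum; last first.
    by rewrite inE (map_f (fun q : R[i] * (Qpos * A) => q.2.1) pl) orbT.
  congr (_ *: _); move: (\sum_(s <- S) _) (size Gamma)%:R => z c2.
  by move: Sn0; move: ((size S)%:R : R[i]) => d d0; field.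
have E2 : \sum_(gamma <- Gamma) nrm (K gamma) = (size Gamma)%:R * (size S)%:R.
  apply: (@complexI R); rewrite rmorph_sum rmorphM !rmorph_nat.
  rewrite (eq_bigr (fun gamma : dual R Qpos => K gamma * gamma 1%g)); last first.
    by move=> gamma _; rewrite dual_one mulr1 KE nrm_real ger0_norm// sqr_ge0.
  rewrite Ksum ?mem_head// sum_eq_count//; congr (_ * _%:R).
  rewrite -[RHS]count_predT; apply: eq_in_count => t tS.
  by rewrite mul1g.
have := nrm_average K Gamma (lcomb (crossed_gen j u) l) thh.
rewrite E1 E2 nrm_scale nrmcM !nrm_natr.
by rewrite ler_pM2l.
Qed.

(** On a finite combination the multipliers are within 1/(n+1) of 1 for a Folner set chosen for its
    support; contractivity of the means carries this over to [b]. *)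
Lemma fejer_close b (e : R) : 0 < e -> exists S,
  nrm (b - fejer S b) <= e.
Proof.
move=> e0; have e3 : 0 < e / 3 by rewrite divr_gt0.
have [l bl] := closed_span_lcomb (BT b) e3.
set b0 := lcomb _ l in bl.
pose k := \sum_(p <- l) nrm (p.1 *: crossed_gen j u p.2).
have k0 : 0 <= k by rewrite sumr_ge0// => p _; rewrite nrm_ge0.
have [n nP] := small_invS (e := e / 3 / (k + 1)) ltac:(by rewrite divr_gt0// ltr_wpDl).
have [S [uS S0 SP]] := @Qpos_folner [seq p.2.1 | p <- l] n.+1 ltac:(by []).
exists S; have bF := fejer_bounded uS S0.
have S0' : 0 < (size S)%:R :> R by rewrite ltr0n.
have h : nrm (b0 - fejer S b0) <= k * n.+1%:R^-1.
  rewrite /b0 (lin_lcomb _ _ (fejer_linear S)) /lcomb -sumrB.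
  apply: le_trans (nrm_sum _ _ _) _; rewrite /k mulr_suml !big_seq.
  apply: ler_sum => p pl; rewrite /= fejer_gen sum_eq_count//.
  rewrite scalerA mulrC -scalerA -[X in X - _]scale1r -scalerBl nrm_scale mulrC.
  rewrite ler_wpM2l ?nrm_ge0//.
  set c := count _ _.
  have cS : (c + count (fun t => (p.2.1 * t)%g \notin S) S)%N = size S.
    exact: (count_predC (fun t => (p.2.1 * t)%g \in S)).
  have := SP p.2.1 (map_f (fun q : R[i] * (Qpos * A) => q.2.1) pl); set d := count _ _ in cS * => dn.
  have -> : 1 - (size S)%:R^-1 * c%:R = ((((size S)%:R^-1 * d%:R) : R)%:C)%C :> R[i].
    rewrite rmorphM fmorphV !rmorph_nat.
    have -> : (d%:R : R[i]) = (size S)%:R - c%:R by rewrite -cS natrD addrC addKr.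
    by rewrite mulrBr mulVf// pnatr_eq0 -lt0n.
  rewrite nrm_real ger0_norm ?mulr_ge0 ?invr_ge0//.
  rewrite ler_pdivrMl// -[leRHS]mulrC ler_pdivlMl ?ltr0n//.
  by rewrite -natrM ler_nat mulnC.
have h1 : k * n.+1%:R^-1 <= e / 3.
  have := nP n (leqnn n); rewrite ltr_pdivlMr ?ltr_wpDl// => h1.
  have : 0 <= (n.+1%:R^-1 : R) by rewrite invr_ge0.
  by move: (n.+1%:R^-1) h1 => r h1 r0; nra.
have h2 : nrm (fejer S (b0 - b)) <= e / 3.
  by apply: le_trans (bF _) _; rewrite mul1r nrm_distC ltW.
apply: le_trans (nrm_tri b0 _ _) _.
have h3 := nrm_tri (fejer S b0) b0 (fejer S b).
rewrite -(linB (fejer_linear S)) in h3.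
have h4 := le_trans h h1; clear h h1.
by move: bl h2 h3 h4; lra.
Qed.

(** The Fejer means are combinations of these terms and converge to [b]. With M = {0} it follows
    that the coefficients determine an element; with an ideal, that membership can be tested on
    them. *)
Theorem fourier_mem (M : set B) b : closed_subspace M ->
  (forall g, M (u g *c fcoef g b)) -> M b.
Proof.
move=> cM bM; apply: (closed_subspace_approx cM) => e e0.
have [S bS] := fejer_close b (e := e / 2) ltac:(by rewrite divr_gt0).
exists (fejer S b); last by apply: le_lt_trans bS _; lra.
have lM := cM.2; apply: lsubZ => //.
by apply: lsub_sum => // s _ _; apply: lsub_sum => // t _ _.
Qed.

End expectation.

(** * The commutator ideal *)

Section ideals.
Variables (R : realType) (A : cstarAlgType R).
Implicit Types (K : set A).

Lemma ideal_mull K x y : closed_ideal_in setT K -> K y -> K (x *c y).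
Proof. by move=> [_ _ h] Ky; have [] := h x y I Ky. Qed.

Lemma ideal_mulr K x y : closed_ideal_in setT K -> K x -> K (x *c y).
Proof. by move=> [_ _ h] Ky; have [] := h y x I Ky. Qed.

Lemma ideal_sub K : closed_ideal_in setT K -> linear_subspace K.
Proof. by case=> _ []. Qed.

(** Computations modulo an ideal are carried out on differences, without forming the quotient
    algebra. *)
Lemma ideal_modM K x x' y y' : closed_ideal_in setT K ->
  K (x - x') -> K (y - y') -> K (x *c y - x' *c y').
Proof.
move=> iK xx yy.
have -> : x *c y - x' *c y' = (x - x') *c y + x' *c (y - y').
  by rewrite cmulBl cmulBr addrA subrK.
apply: lsubD (ideal_mulr _ iK xx) (ideal_mull _ iK yy).
exact: ideal_sub.
Qed.

Lemma ideal_mod_trans K x y z : closed_ideal_in setT K ->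
  K (x - y) -> K (y - z) -> K (x - z).
Proof.
move=> iK xy yz; rewrite -[x](subrK y) -addrA.
by apply: lsubD xy yz; exact: ideal_sub.
Qed.

Lemma ideal_mod_sym K x y : closed_ideal_in setT K -> K (x - y) -> K (y - x).
Proof.
by move=> iK xy; rewrite -opprB; apply: lsubN xy; exact: ideal_sub.
Qed.

Lemma ideal_bigcap (F : set (set A)) :
  (forall K, F K -> closed_ideal_in setT K) -> closed_ideal_in setT (\bigcap_(K in F) K).
Proof.
move=> FK; split=> //.
  split; first by apply: closed_bigI => K /FK[_ []].
  split=> [K /FK[_ [_ []]]//|a x y Fx Fy K hK].
  by have [_ [_ [_ h]] _] := FK _ hK; apply: h; [exact: Fx|exact: Fy].
move=> x y _ Fy; split=> K hK.
  by apply: ideal_mull (FK _ hK) _; exact: Fy.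
by apply: ideal_mulr (FK _ hK) _; exact: Fy.
Qed.

Lemma commutator_ideal_ideal : closed_ideal_in setT (@commutator_ideal R A).
Proof.
apply: (@ideal_bigcap [set K | closed_ideal_in setT K /\
  [set z | exists x y, z = x *c y - y *c x] `<=` K]) => K.
by case.
Qed.

Lemma commutator_in (x y : A) : @commutator_ideal R A (x *c y - y *c x).
Proof. by move=> K [_]; apply; exists x, y. Qed.

Lemma commutator_min K : closed_ideal_in setT K ->
  (forall x y, K (x *c y - y *c x)) -> @commutator_ideal R A `<=` K.
Proof.
by move=> iK h; apply: smallest_sub => // _ [x [y ->]].
Qed.

Lemma commutator_hom (f : A -> A) : star_hom f ->
  forall x, @commutator_ideal R A x -> @commutator_ideal R A (f x).
Proof.
move=> hf; have [lf _ fM _] := hf; apply: commutator_min; last first.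
  by move=> x y /=; rewrite (linB lf) !fM; exact: commutator_in.
have iC := commutator_ideal_ideal; split=> //.
  by have [_ cC _] := iC; exact: closed_subspace_preimage lf (star_hom_bounded hf) cC.
move=> x y _ /= Cy; rewrite !fM; split.
  exact: (ideal_mull (f x) iC Cy).
exact: (ideal_mulr (f x) iC Cy).
Qed.

End ideals.

Section tshift_mod.
Variables (R : realType) (A : cstarAlgType R) (T : {nonneg rat} -> A).
Hypothesis hT : is_toeplitz T.
Local Notation V := (tshift T).

(** On l^2 of the nonnegative rationals, for [0 <= t], the projection onto the basis vectors with
    index in [0, t). *)
Definition defect (t : rat) : A := cone - V t *c V (- t).

Lemma tshift_defect (t : rat) : V t *c V (- t) = cone - defect t .
Proof. by rewrite /defect subKr. Qed.

Lemma defect_in_commutator (t : rat) : 0 <= t -> @commutator_ideal R A (defect t).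
Proof.
move=> t0; rewrite /defect -(tshift0 hT) -(addNr t) -(tshiftM hT)//.
exact: commutator_in.
Qed.

Section mod.
Variable K : set A.
Hypotheses (iK : closed_ideal_in setT K) (KE : forall t, 0 <= t -> K (defect t)).

(** Only the case y < 0 < x is not exact; there, splitting the longer of the two shifts exposes a
    factor V_t V_t^* = 1 - P_t. *)
Lemma tshift_mod (x y : rat) : K (V x *c V y - V (x + y)).
Proof.
have K0 : K 0 by case: (ideal_sub iK).
have [y0|y0] := leP 0 y; first by rewrite (tshiftM hT)// subrr.
have [x0|x0] := leP x 0; first by rewrite (tshiftMN hT)// subrr.
have y0' : 0 <= - y by rewrite oppr_ge0 ltW.
have [xy|xy] := leP 0 (x + y).
  have xE : V x = V (x + y) *c V (- y) by rewrite (tshiftM hT)// addrK.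
  have e : V (- y) *c V y = cone - defect (- y).
    by rewrite -tshift_defect opprK.
  rewrite xE -cmulA e cmulBr cmul1r.
  rewrite addrAC subrr add0r; apply: (lsubN (ideal_sub iK)).
  by apply: ideal_mull => //; exact: KE.
have yE : V y = V (- x) *c V (x + y).
  by rewrite (tshiftMN hT) ?oppr_le0 ?ltW// addKr.
rewrite [in X in K X]yE cmulA tshift_defect cmulBl cmul1l.
rewrite addrAC subrr add0r; apply: (lsubN (ideal_sub iK)).
by apply: ideal_mulr => //; apply: KE; exact: ltW.
Qed.

Lemma toeplitz_gen_mod p : K (toeplitz_gen T p - V (p.1%:num - p.2%:num)).
Proof. exact: tshift_mod. Qed.

(** Modulo [K] a generator depends only on its index, and indices add commutatively; bilinearity and
    density extend this to all commutators. *)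
Lemma defect_commutator : @commutator_ideal R A `<=` K.
Proof.
apply: commutator_min => // x y.
have cK : closed_subspace K by case: iK.
pose f w z : A := w *c z - z *c w.
have lf w : linear (f w).
  move=> a b c; rewrite /f cmul_linearr cmul_linearl scalerBr opprD.
  by rewrite addrACA.
have bf w : bounded_by (2 * nrm w) (f w).
  move=> z; rewrite /f; apply: le_trans (nrmB _ _) _.
  by have := nrmM w z; have := nrmM z w; lra.
have fN w z : f w z = - f z w by rewrite /f opprB.
have xT : closed_span (range (toeplitz_gen T)) x by rewrite (toeplitz_span hT).
have yT : closed_span (range (toeplitz_gen T)) y by rewrite (toeplitz_span hT).
rewrite -/(f x y); apply: (closed_span_min (closed_subspace_preimage (lf x) (bf x) cK) _ yT).
move=> _ [q _ <-] /=; rewrite fN; apply: (lsubN cK.2).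
apply: (closed_span_min (closed_subspace_preimage (lf _) (bf _) cK) _ xT).
move=> _ [p _ <-] /=; rewrite /f.
have gg r s : K (toeplitz_gen T r *c toeplitz_gen T s -
    V (r.1%:num - r.2%:num + (s.1%:num - s.2%:num))).
  apply: (ideal_mod_trans iK _ (tshift_mod _ _)).
  by apply: ideal_modM => //; exact: toeplitz_gen_mod.
apply: (ideal_mod_trans iK (gg q p)); apply: (ideal_mod_sym iK).
by rewrite [X in V X]addrC; exact: gg.
Qed.

End mod.

End tshift_mod.

(** * Two covariant representations *)

Section star_hom_ops.
Variable R : realType.
Implicit Types A B D : cstarAlgType R.

Lemma star_hom_comp A B D (f : A -> B) (g : B -> D) :
  star_hom f -> star_hom g -> star_hom (g \o f).
Proof.
move=> [lf f1 fM fs] [lg g1 gM gs]; split=> [a x y||x y|x] /=.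
- by rewrite lf lg.
- by rewrite f1 g1.
- by rewrite fM gM.
- by rewrite fs gs.
Qed.

Lemma star_hom_conj A (w : A) : w^*c *c w = cone -> w *c w^*c = cone ->
  star_hom (fun x => w *c x *c w^*c).
Proof.
move=> ww ww'; split=> [a x y||x y|x].
- by rewrite cmul_linearr cmul_linearl.
- by rewrite cmul1r.
- by rewrite !cmulA -(cmulA (w *c x) w^*c) ww cmul1r.
- by rewrite !starM starK cmulA.
Qed.

End star_hom_ops.

Lemma basis_unitary_rep (R : realType) (H : hilbertType R) (X : choiceType)
    (e : X -> H) (act : Qpos -> X -> X) : orthonormal_basis e ->
  (forall x, act 1%g x = x) -> (forall g h x, act (g * h)%g x = act g (act h x)) ->
  exists U : Qpos -> bop H, unitary_representation U /\
    forall g x, U g (e x) = e (act g x).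
Proof.
move=> be act1 actM.
have /choice[U UP] : forall g, exists W : bop H, (forall x, W (e x) = e (act g x)) /\
    forall x, W^*c (e x) = e (act g^-1%g x).
  move=> g; have [|W [We Ws _]] := @partial_injection_bop _ _ _ _ be
      (fun x => Some (act g x)) (fun x => Some (act g^-1%g x)).
    by move=> x y; split=> -[<-]; rewrite -actM ?mulVg ?mulgV act1.
  by exists W.
exists U; split=> [|g x]; last by have [-> _] := UP g.
split=> [|g h|g|g]; apply: (bop_eq_basis be) => x; rewrite ?bopME ?bop1E.
- by rewrite (UP 1%g).1 act1.
- by rewrite !(proj1 (UP _)) actM.
- by rewrite (UP g).1 (UP g).2 -actM mulVg act1.
- by rewrite (UP g).2 (UP g).1 -actM mulgV act1.
Qed.

Lemma card_nat_bij (X : Type) : ([set: X] #= [set: nat])%card ->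
  exists f : X -> nat, bijective f.
Proof.
by move=> /card_set_bijP[f]; rewrite setTT_bijective => fb; exists f.
Qed.

(** Relabelling its basis turns the given Hilbert space into l^2 of all rationals, so that no other
    Hilbert space has to be constructed. *)
Lemma nonneg_rat_bij : exists f : rat -> {nonneg rat}, bijective f.
Proof.
have cn : ([set: {nonneg rat}] #= [set: nat])%card.
  apply: eq_card_nat.
    apply/countable_injP; exists (fun s : {nonneg rat} => pickle (s%:num : rat)).
    by move=> s t _ _ /(pcan_inj pickleK) st; apply/val_inj.
  pose f (n : nat) : {nonneg rat} := nng n%:R.
  have fI : {in [set: nat] &, injective f}.
    move=> m n _ _ /(nng_inj (ler0n _ _) (ler0n _ _))/eqP.
    by rewrite eqr_nat => /eqP.
  apply/infiniteP; rewrite -(card_le_eql (inj_card_eq fI)).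
  exact: subset_card_le.
have [g [g' gK gK']] := card_nat_bij card_rat.
have [h [h' hK hK']] := card_nat_bij cn.
exists (h' \o g); exists (g' \o h) => x /=; first by rewrite hK' gK.
by rewrite gK' hK.
Qed.

(** * Ideals of the crossed product induced by invariant ideals *)

Section crossed_ideal.
Variables (R : realType) (A B : cstarAlgType R) (alpha : Qpos -> A -> A).
Variables (j : A -> B) (u : Qpos -> B).
Hypothesis hB : is_crossed_product alpha j u.

Let hj : star_hom j. Proof. by case: hB => -[]. Qed.
Let hu : unitary_representation u. Proof. by case: hB => -[]. Qed.

Lemma crossed_ideal_gen (K : set A) g x : K x -> crossed_ideal j u K (u g *c j x).
Proof. by move=> Kx; apply: sub_closed_span; exists g; exists x. Qed.

Lemma crossed_ideal_j (K : set A) x : K x -> crossed_ideal j u K (j x).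
Proof.
move=> Kx; have [u1 _ _ _] := hu.
by have := crossed_ideal_gen 1%g Kx; rewrite u1 cmul1l.
Qed.

Lemma crossed_ideal_ideal (K : set A) : closed_ideal_in setT K ->
  (forall a x, K x -> K (alpha a x)) ->
  closed_ideal_in setT (crossed_ideal j u K).
Proof.
move=> iK aK; have [lj _ jM js] := hj; have [u1 uM uu uu'] := hu.
have cI := closed_span_closed [set z | exists g, exists2 x, K x & z = u g *c j x].
split=> // b y _ Iy; split.
- have bT : closed_span (range (crossed_gen j u)) b by rewrite (crossed_span hB).
  apply: (closed_span_min (closed_subspace_mulr y cI) _ bT) => _ [[g x] _ <-] /=.
  apply: (closed_span_min (closed_subspace_mull _ cI) _ Iy) => _ [h [z Kz ->]] /=.
  rewrite /crossed_gen /= -cmulA (cmulA (j x)) (crossed_comm hB) -cmulA -jM cmulA -uM.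
  by apply: crossed_ideal_gen; exact: ideal_mull.
- have bT : closed_span (range (crossed_gen j u)) b by rewrite (crossed_span hB).
  apply: (closed_span_min (closed_subspace_mull y cI) _ bT) => _ [[g x] _ <-] /=.
  apply: (closed_span_min (closed_subspace_mulr _ cI) _ Iy) => _ [h [z Kz ->]] /=.
  rewrite /crossed_gen /= -cmulA (cmulA (j z)) (crossed_comm hB) -cmulA -jM cmulA -uM.
  by apply: crossed_ideal_gen; apply: ideal_mulr => //; exact: aK.
Qed.

End crossed_ideal.

Section representations.
Variables (R : realType) (A : cstarAlgType R) (T : {nonneg rat} -> A).
Hypothesis hT : is_toeplitz T.
Variable alpha : Qpos -> A -> A.
Hypothesis halpha : is_action alpha.
Hypothesis halphaT : forall a r, alpha a (T r) = T (Qscale a r).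
Variables (B : cstarAlgType R) (j : A -> B) (u : Qpos -> B).
Hypothesis hB : is_crossed_product alpha j u.
Local Notation V := (tshift T).

Lemma alpha_star_hom a : star_hom (alpha a). Proof. by case: halpha. Qed.

Lemma alpha_tshift a (x : rat) : alpha a (V x) = V (a%:num * x).
Proof.
have [_ _ _ as_] := alpha_star_hom a.
wlog x0 : x / 0 <= x => [h|].
  have [|/ltW x0] := leP 0 x; first exact: h.
  have := h (- x); rewrite oppr_ge0 x0 mulrN !(tshiftN hT) as_ => /(_ isT).
  exact: (can_inj (@starK _ _)).
have ax0 : 0 <= a%:num * x by rewrite mulr_ge0.
rewrite /tshift x0 ax0 halphaT; congr T; apply/val_inj.
by rewrite /= !max_l.
Qed.

(** Both sides of the covariance relation are homomorphisms in the element of [A], so it need only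
    be verified on the generating isometries. *)
Lemma covariant_tshift (H : hilbertType R) (rho : A -> bop H) (U : Qpos -> bop H) :
  star_hom rho -> unitary_representation U ->
  (forall a x, 0 <= x -> rho (V (a%:num * x)) *c U a = U a *c rho (V x)) ->
  covariant alpha rho U.
Proof.
move=> hrho hU rU; split=> // a x; have [_ _ UU UU'] := hU.
have h1 := star_hom_comp (alpha_star_hom a) hrho.
have h2 := star_hom_comp hrho (star_hom_conj (UU a) (UU' a)).
have := toeplitz_hom_eq hT h1 h2; move=> /(_ _)/(congr1 (fun f => f x)); apply.
by move=> y y0 /=; rewrite alpha_tshift -rU// -cmulA UU' cmul1r.
Qed.

Lemma natural_rep : exists (H : hilbertType R) (e : {nonneg rat} -> H)
    (pi : B -> bop H),
  [/\ orthonormal_basis e, star_hom pi, forall a, nrm (pi (j a)) = nrm a,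
      forall x s, pi (j (V x)) (e s) =
        if 0 <= x + s%:num then e (nng (x + s%:num)) else 0 &
      forall a s, pi (u a) (e s) = e (Qscale a s)].
Proof.
have [H [e [rho [be hrho iso rhoE]]]] := toeplitz_rep hT.
have [||U [hU UE]] := @basis_unitary_rep _ _ _ e Qscale be.
- by move=> s; apply/val_inj; rewrite /= mul1r.
- by move=> g h s; apply/val_inj; rewrite /= mulrA.
have cov : covariant alpha rho U.
  apply: covariant_tshift => // a x x0; apply: (bop_eq_basis be) => s.
  rewrite !bopME UE !rhoE /= -mulrDr mulr_ge0 ?addr_ge0//.
  rewrite UE; congr e; apply/val_inj; rewrite /= !max_l ?mulr_ge0 ?addr_ge0//.
case: hB => _ _ /(_ _ rho U cov)[pi [hpi pij piu]].
exists H, e, pi; split=> // [a|x s|a s].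
- by rewrite -iso -pij.
- by rewrite -rhoE -pij.
- by rewrite -UE -piu.
Qed.

Lemma rat_seq_bound (s : seq rat) : exists2 n, 0 <= n & forall x, x \in s -> x <= n.
Proof.
elim: s => [|x s [n n0 nP]]; first by exists 0.
exists (n + `|x|); first by rewrite addr_ge0.
move=> y; rewrite inE => /orP[/eqP ->|/nP yn].
  by rewrite (le_trans (ler_norm x))// lerDr.
by rewrite (le_trans yn)// lerDl.
Qed.

(* The representation of [A] by translations on l^2 of the rationals: applied
   to a finitely supported vector [h], the image of a linear combination [x] of
   generators is the restriction to l^2 of the nonnegative rationals of
   [W_n^* x W_n], where the translation [W_n] is taken far enough. *)
Lemma translation_star_hom (H : hilbertType R) (e : {nonneg rat} -> H)
    (rho : A -> bop H) (d : rat -> H) (L : rat -> bop H) (Z : bop H) :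
  star_hom rho ->
  (forall x s, rho (V x) (e s) =
     if 0 <= x + s%:num then e (nng (x + s%:num)) else 0) ->
  orthonormal_basis d ->
  (forall x, nrm (L x) <= 1) -> nrm Z <= 1 ->
  (forall x q, L x (d q) = d (x + q)) ->
  (forall x q, (L x)^*c (d q) = d (- x + q)) ->
  (forall s, Z (e s) = d s%:num) ->
  (forall q, 0 <= q -> Z^*c (d q) = e (nng q)) ->
  exists lam : A -> bop H, star_hom lam /\
    forall p, lam (toeplitz_gen T p) = L (p.1%:num - p.2%:num).
Proof.
move=> hrho rhoE bd nL nZ LE LsE ZE ZsE.
have [lrho r1 rM rs] := hrho; have brho := star_hom_bounded hrho.
pose Lg (p : {nonneg rat} * {nonneg rat}) := L (p.1%:num - p.2%:num).
have genE p s : p.2%:num <= s%:num -> rho (toeplitz_gen T p) (e s) =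
    e (nng (p.1%:num + (s%:num - p.2%:num))).
  move=> ps; have d0 : 0 <= - p.2%:num + s%:num by rewrite addrC subr_ge0.
  rewrite /toeplitz_gen rM bopME (rhoE (- _)) d0 rhoE (nngE d0).
  by rewrite (addrC (- p.2%:num)) addr_ge0// addrC.
have bnd l : nrm (lcomb Lg l) <= 1 * nrm (lcomb (toeplitz_gen T) l).
  rewrite mul1r; set a := lcomb (toeplitz_gen T) l.
  apply: nrm_bop_le; first exact: nrm_ge0.
  pose sc (h : H) := ((nrm a)%:C)%C *: h.
  have lsc : linear sc.
    by move=> c x y; rewrite /sc scalerDr !scalerA mulrC.
  have bsc : bounded_by (nrm a) sc.
    by move=> x; rewrite /sc nrm_real_mul ?nrm_ge0.
  have [_ dspan] := bd.
  move=> h; rewrite -[leRHS](nrm_real_mul _ (nrm_ge0 a)).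
  apply: (le_dense (bop_linear _) lsc (@nrm_bopP _ _ _) bsc dspan) => m.
  (* After translation by this [n], all basis vectors of [m] have nonnegative index, and no
     generator of [l] annihilates them. *)
  have [n n0 nP] := rat_seq_bound
    ([seq p.2.2%:num - q.2 | p <- l, q <- m] ++ [seq - q.2 | q <- m]).
  pose X : bop H := (L n)^*c *c (Z *c (rho a *c (Z^*c *c L n))).
  have nX : nrm X <= nrm a.
    have nLs : nrm (L n)^*c <= 1 by rewrite nrm_star nL.
    have nZs : nrm Z^*c <= 1 by rewrite nrm_star.
    have nra : nrm (rho a) <= nrm a by have := brho a; rewrite mul1r.
    have c1 (x y : bop H) (r s : R) : nrm x <= r -> nrm y <= s -> nrm (x *c y) <= r * s.
      by move=> xr ys; apply: le_trans (nrmM _ _) _; rewrite ler_pM ?nrm_ge0.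
    have := c1 _ _ _ _ nLs (c1 _ _ _ _ nZ (c1 _ _ _ _ nra (c1 _ _ _ _ nZs (nL n)))).
    by rewrite !mul1r mulr1.
  have vec q : q \in m -> lcomb Lg l (d q.2) = X (d q.2).
    move=> qm; have nq0 : 0 <= n + q.2.
      rewrite addrC -lerBlDl sub0r; apply: nP; rewrite mem_cat; apply/orP; right.
      by apply/mapP; exists q.
    rewrite /X !bopME LE ZsE// /a /lcomb (lin_sum lrho) !bop_sumE.
    rewrite (lin_sum (@bop_linear _ _ Z)) (lin_sum (@bop_linear _ _ (L n)^*c)) !big_seq.
    apply: eq_bigr => p pl; rewrite bopZE (linZ lrho) bopZE.
    rewrite !(linZ (@bop_linear _ _ _)); congr (_ *: _).
    have pq : p.2.2%:num <= (nng (n + q.2))%:num.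
      rewrite nngE// -lerBlDr; apply: nP; rewrite mem_cat; apply/orP; left.
      by apply/allpairsP; exists (p, q).
    have pq0 : 0 <= p.2.1%:num + (n + q.2 - p.2.2%:num).
      by rewrite addr_ge0// subr_ge0; rewrite nngE in pq.
    by rewrite genE// nngE// ZE (nngE pq0) LsE LE; congr d; ring.
  have -> : lcomb Lg l (lcomb d m) = X (lcomb d m).
    rewrite !(lin_lcomb _ _ (@bop_linear _ _ _)) [LHS]/lcomb [RHS]/lcomb.
    rewrite [LHS]big_seq [RHS]big_seq.
    by apply: eq_bigr => q qm; congr (_ *: _); exact: vec.
  by apply: le_trans (nrm_bopP _ _) _; rewrite /sc nrm_real_mul ?nrm_ge0// ler_wpM2r ?nrm_ge0.
have [lam [ll bl lE]] := bounded_extension ler01 (toeplitz_span hT) bnd.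
exists lam; split=> //.
have LL x y : L x *c L y = L (x + y).
  by apply: (bop_eq_basis bd) => q; rewrite bopME !LE addrA.
have Ls x : (L x)^*c = L (- x).
  by apply: (bop_eq_basis bd) => q; rewrite LsE LE.
have cu := toeplitz_span hT.
have lM1 p q : lam (toeplitz_gen T p *c toeplitz_gen T q) =
    lam (toeplitz_gen T p) *c lam (toeplitz_gen T q).
  have [r -> rE] := toeplitz_genM hT p q.
  by rewrite !lE /Lg rE LL.
have lb x : bounded_by (nrm x) (fun y => lam (x *c y)).
  by move=> y; apply: le_trans (bl _) _; rewrite mul1r nrmM.
have rb x : bounded_by (nrm x) (fun y => lam (y *c x)).
  by move=> y; apply: le_trans (bl _) _; rewrite mul1r mulrC nrmM.
have lb' x : bounded_by (nrm (lam x)) (fun y => lam x *c lam y).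
  move=> y; apply: le_trans (nrmM _ _) _; rewrite ler_wpM2l ?nrm_ge0//.
  by have := bl y; rewrite mul1r.
have rb' x : bounded_by (nrm (lam x)) (fun y => lam y *c lam x).
  move=> y; apply: le_trans (nrmM _ _) _; rewrite mulrC ler_wpM2l ?nrm_ge0//.
  by have := bl y; rewrite mul1r.
have l1 x : linear (fun y => lam (x *c y)) by move=> c y z; rewrite cmul_linearr ll.
have l2 x : linear (fun y => lam x *c lam y) by move=> c y z; rewrite ll cmul_linearr.
have r1' x : linear (fun y => lam (y *c x)) by move=> c y z; rewrite cmul_linearl ll.
have r2' x : linear (fun y => lam y *c lam x) by move=> c y z; rewrite ll cmul_linearl.
have lM2 p y : lam (toeplitz_gen T p *c y) = lam (toeplitz_gen T p) *c lam y.
  have := lin_eq_dense (l1 _) (l2 _) (lb _) (lb' _) cu.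
  move=> /(_ (toeplitz_gen T p) (toeplitz_gen T p) _)/(congr1 (fun f => f y)); apply.
  by move=> _ [q _ <-].
split=> // [|x y|x].
- have := lE (nng 0, nng 0); rewrite (toeplitz_gen0 hT) nngE// (tshift0 hT) => ->.
  apply: (bop_eq_basis bd) => q; rewrite bop1E LE /= maxxx subrr add0r.
  by [].
- have := lin_eq_dense (r1' y) (r2' y) (rb _) (rb' _) cu.
  move=> /(_ _)/(congr1 (fun f => f x)); apply.
  by move=> _ [q _ <-].
- have ls : linear (fun x => (lam x^*c)^*c).
    by move=> a y z; rewrite star_semilinear ll star_semilinear conjcK.
  have bs : bounded_by 1 (fun x => (lam x^*c)^*c).
    by move=> y; rewrite nrm_star; apply: le_trans (bl _) _; rewrite nrm_star.
  have := lin_eq_dense ls ll bs bl cu.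
  move=> /(_ _)/(congr1 (fun f => f x)) <-; first by rewrite starK.
  move=> _ [q _ <-]; rewrite (toeplitz_gen_star hT) !lE /Lg Ls opprB.
  by [].
Qed.

(** The last clause compares quotient norms. On a finite combination, replacing T_x T_y^* by V_{x-y}
    changes the element within the commutator ideal; the new element acts on l^2 of the nonnegative
    rationals as a compression of the translation operator, so its norm is at most that of the
    image. *)
Lemma translation_rep : exists (H : hilbertType R) (d : rat -> H)
    (pi : B -> bop H),
  [/\ orthonormal_basis d, star_hom pi,
      forall x q, pi (j (V x)) (d q) = d (x + q),
      forall a q, pi (u a) (d q) = d (a%:num * q) &
      forall (a : A) (r : R), 0 < r ->
        exists2 c, @commutator_ideal R A c & nrm (a - c) <= nrm (pi (j a)) + r].
Proof.
have [H [e [rho [be hrho iso rhoE]]]] := toeplitz_rep hT.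
have [f [g fK gK]] := nonneg_rat_bij.
pose d (q : rat) := e (f q).
have [ee espan] := be.
have bd : orthonormal_basis d.
  split=> [s t|]; first by rewrite /d ee (inj_eq (can_inj fK)).
  rewrite -espan; congr closed_span; apply/seteqP; split=> [_ [q _ <-]|_ [s _ <-]].
    by exists (f q).
  by exists (g s) => //; rewrite /d gK.
have /choice[L LP] : forall x, exists W : bop H, [/\ forall q, W (d q) = d (x + q),
    forall q, W^*c (d q) = d (- x + q) & nrm W <= 1].
  move=> x; apply: (@partial_injection_bop _ _ _ _ bd
    (fun q => Some (x + q)) (fun q => Some (- x + q))) => q q'.
  by split=> -[<-]; rewrite ?addKr ?addNKr.
have LE x q : L x (d q) = d (x + q) by have [] := LP x.
have [|Z [ZE ZsE nZ]] := @partial_injection_bop _ _ _ _ be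
    (fun s => Some (f s%:num)) (fun t => if 0 <= g t then Some (nng (g t)) else None).
  move=> s t; split=> [[<-]|]; first by rewrite fK ge0 nngK.
  by case: ifP => // gt0 [<-]; rewrite (nngE gt0) gK.
have [||||||lam [hlam lamE]] := translation_star_hom hrho rhoE bd (Z := Z) (L := L).
- by move=> x; have [] := LP x.
- exact: nZ.
- exact: LE.
- by move=> x q; have [] := LP x.
- by move=> s; rewrite ZE.
- by move=> q q0; rewrite ZsE fK q0.
have [ll l1 lM ls] := hlam.
have lamV x : lam (V x) = L x.
  have pos y : 0 <= y -> lam (V y) = L y.
    by move=> y0; rewrite -{1}(nngE y0) -(toeplitz_gen0 hT) lamE /= maxxx subr0 max_l.
  have [|x0] := leP 0 x; first exact: pos.
  rewrite -[x]opprK (tshiftN hT) ls pos ?oppr_ge0 ?ltW//.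
  apply: (bop_eq_basis bd) => q; rewrite opprK LE.
  by have [_ -> _] := LP (- x); rewrite opprK.
have [||U [hU UE]] := @basis_unitary_rep _ _ _ d (fun a q => a%:num * q) bd.
- by move=> q; rewrite mul1r.
- by move=> a b q; rewrite /= mulrA.
have cov : covariant alpha lam U.
  apply: covariant_tshift => // a x x0; apply: (bop_eq_basis bd) => q.
  by rewrite !bopME !lamV UE !LE UE mulrDr.
case: hB => _ _ /(_ _ lam U cov)[pi [hpi pij piu]].
exists H, d, pi; split=> // [x q|a q|a r r0].
- by rewrite -LE -lamV -pij.
- by rewrite -UE -piu.
have aT : closed_span (range (toeplitz_gen T)) a by rewrite (toeplitz_span hT).
have r2 : 0 < r / 2 by rewrite divr_gt0.
have [l al] := closed_span_lcomb aT r2.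
set a0 := lcomb _ l in al.
pose a' := lcomb (fun p : {nonneg rat} * {nonneg rat} => V (p.1%:num - p.2%:num)) l.
have iC := @commutator_ideal_ideal R A.
exists (a0 - a').
  rewrite /a0 /a' /lcomb -sumrB; apply: lsub_sum; first exact: (ideal_sub iC).
  move=> p _ _; rewrite -scalerBr; apply: (lsubZ _ (ideal_sub iC)).
  by apply: (toeplitz_gen_mod hT iC) => t; exact: defect_in_commutator.
have na' : nrm a' <= nrm (lam a0).
  rewrite -iso; have -> : rho a' = Z^*c *c (lam a0 *c Z).
    apply: (bop_eq_basis be) => s; have [lrho _ _ _] := hrho.
    rewrite !bopME ZE /a' /a0 (lin_lcomb _ _ lrho) (lin_lcomb _ _ ll) /lcomb !bop_sumE.
    rewrite (lin_sum (@bop_linear _ _ _)); apply: eq_bigr => p _.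
    rewrite !bopZE (linZ (@bop_linear _ _ _)); congr (_ *: _).
    rewrite /comp lamE rhoE [oapp _ _ _]/= -/(d _) LE /d ZsE fK.
    by case: ifP.
  apply: le_trans (nrmM _ _) _; rewrite nrm_star.
  have h := nrmM (lam a0) Z; have := nrm_ge0 (lam a0); have := nrm_ge0 Z.
  by have := nrm_ge0 (lam a0 *c Z); nra.
have na0 : nrm (lam a0) <= nrm (lam a) + r / 2.
  rewrite -[a0](subKr a) (linB ll); apply: le_trans (nrmB _ _) _.
  by rewrite lerD2l; have := star_hom_bounded hlam (a - a0); rewrite mul1r; lra.
have -> : nrm (pi (j a)) = nrm (lam a) by rewrite -pij.
rewrite opprB addrA addrAC; apply: le_trans (nrmD _ _) _.
lra.
Qed.

End representations.

(** * The ideal generated by the defect projections is minimal *)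

Section defect.
Variables (R : realType) (A : cstarAlgType R) (T : {nonneg rat} -> A).
Hypothesis hT : is_toeplitz T.
Local Notation V := (tshift T).
Local Notation P := (defect T).

Lemma defect_star t : 0 <= t -> (P t)^*c = P t.
Proof.
by move=> t0; rewrite /defect starB star1 starM -!(tshiftN hT) opprK.
Qed.

Lemma tshift_defect0 (t w : rat) : 0 <= t -> t <= w -> V (- w) *c P t = 0.
Proof.
move=> t0 tw; rewrite /defect cmulBr cmul1r cmulA (tshiftM hT)// (tshiftMN hT).
  by rewrite addrK subrr.
by rewrite addrC subr_le0.
Qed.

Lemma defect_tshift0 (t w : rat) : 0 <= t -> t <= w -> P t *c V w = 0.
Proof.
move=> t0 tw; apply: (can_inj (@starK _ _)).
by rewrite starM defect_star// -(tshiftN hT) tshift_defect0// star0.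
Qed.

Lemma defect_absorb (t w : rat) : 0 <= t -> t <= w -> P t *c P w = P t.
Proof.
by move=> t0 tw; rewrite {2}/defect cmulBr cmul1r cmulA defect_tshift0// cmul0l subr0.
Qed.

Lemma defect_idem t : 0 <= t -> P t *c P t = P t.
Proof. by move=> t0; exact: defect_absorb. Qed.

Lemma defectD (t w : rat) : 0 <= t -> 0 <= w ->
  P (t + w) = P t + V t *c P w *c V (- t).
Proof.
move=> t0 w0; rewrite /defect cmulBr cmul1r cmulBl.
have -> : V t *c (V w *c V (- w)) *c V (- t) = V (t + w) *c V (- (t + w)).
  rewrite cmulA (tshiftM hT)// -cmulA (tshiftMN hT) ?oppr_le0//.
  by rewrite -opprD (addrC w).
by rewrite addrA subrK.
Qed.

End defect.

Section neumann.
Variables (R : realType) (B : cstarAlgType R) (I0 J : set B).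
Hypotheses (iI : closed_ideal_in setT I0) (cJ : closed_subspace J).
Hypothesis JI : forall x b, I0 x -> J b -> J (x *c b) /\ J (b *c x).

(** As z = z p is close to p, the elements p (p - z)^n tend to 0, while p - p (p - z)^n stays in [J]
    by induction. The bound 1/(n+1), weaker than 2^-n, has the form used for limits elsewhere. *)
Lemma neumann_mem (p z : B) : I0 p -> J z -> p *c p = p -> z *c p = z ->
  nrm (p - z) <= 2^-1 -> J p.
Proof.
move=> Ip Jz pp zp pz.
pose v := fix v n := if n is m.+1 then v m *c (p - z) else p.
have Iv n : I0 (v n) by elim: n => //= n IH; exact: ideal_mulr.
have vp n : v n *c p = v n.
  by elim: n => //= n IH; rewrite -cmulA cmulBl pp zp.
have Jv n : J (p - v n).
  elim: n => [|n IH] /=; first by rewrite subrr; have [_ []] := cJ.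
  rewrite cmulBr vp opprB addrC addrAC -addrA addrC; apply: (lsubD cJ.2) => //.
  by have [] := JI (Iv n) Jz.
have nv n : nrm (v n) <= nrm p * n.+1%:R^-1.
  elim: n => [|n IH] /=; first by rewrite invr1 mulr1.
  apply: le_trans (nrmM _ _) _.
  apply: (@le_trans _ _ (nrm p * n.+1%:R^-1 * 2^-1)).
    by rewrite ler_pM ?nrm_ge0.
  rewrite -mulrA ler_wpM2l ?nrm_ge0// -invfM lef_pV2 ?posrE ?mulr_gt0 ?ltr0n//.
  by rewrite -natrM ler_nat mulnC; lia.
apply: (closed_subspace_approx cJ) => e e0.
have [n nP] := small_invS (e := e / (nrm p + 1)) ltac:(by rewrite divr_gt0// ltr_wpDl ?nrm_ge0).
exists (p - v n) => //; rewrite subKr; apply: le_lt_trans (nv n) _.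
have := nP n (leqnn n); rewrite ltr_pdivlMr ?ltr_wpDl ?nrm_ge0//.
have : 0 <= (n.+1%:R^-1 : R) by rewrite invr_ge0.
by move: (n.+1%:R^-1) => r r0; have := nrm_ge0 p; nra.
Qed.

End neumann.

(** Concerns small intervals [r, r + t) with r just to the right of [s]. The length is chosen after
    r, as it must be small compared with the displacement of r by a monomial. *)
Definition near_interval (s : rat) (Q : rat -> rat -> Prop) :=
  exists2 eta, 0 < eta & forall r, s < r -> r < s + eta ->
    exists2 t0, 0 < t0 & forall t, 0 < t -> t <= t0 -> Q r t.

Lemma near_interval_and s Q1 Q2 : near_interval s Q1 -> near_interval s Q2 ->
  near_interval s (fun r t => Q1 r t /\ Q2 r t).
Proof.
move=> [eta1 e1 H1] [eta2 e2 H2].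
exists (Num.min eta1 eta2); first by rewrite lt_min e1.
move=> r sr; rewrite -ltrBlDl lt_min => /andP[]; rewrite !ltrBlDl => r1 r2.
have [t1 t10 h1] := H1 _ sr r1; have [t2 t20 h2] := H2 _ sr r2.
exists (Num.min t1 t2); first by rewrite lt_min t10.
by move=> t t0; rewrite le_min => /andP[tt1 tt2]; split; [exact: h1 | exact: h2].
Qed.

Lemma near_interval_seq (X : eqType) s (Q : X -> rat -> rat -> Prop) (l : seq X) :
  (forall x, near_interval s (Q x)) ->
  near_interval s (fun r t => forall x, x \in l -> Q x r t).
Proof.
move=> H; elim: l => [|x l IH].
  by exists 1 => // r _ _; exists 1.
have [eta e0 h] := near_interval_and (H x) IH; exists eta => // r sr rs.
have [t0 t00 h0] := h r sr rs; exists t0 => // t tp tt0 y.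
by rewrite inE => /orP[/eqP ->|yl]; have [h1 h2] := h0 t tp tt0; [|exact: h2].
Qed.

Section minimal_ideal.
Variables (R : realType) (A : cstarAlgType R) (T : {nonneg rat} -> A).
Hypothesis hT : is_toeplitz T.
Variable alpha : Qpos -> A -> A.
Hypothesis halpha : is_action alpha.
Hypothesis halphaT : forall a r, alpha a (T r) = T (Qscale a r).
Variables (B : cstarAlgType R) (j : A -> B) (u : Qpos -> B).
Hypothesis hB : is_crossed_product alpha j u.
Local Notation V := (tshift T).
Local Notation P := (defect T).
Local Notation I0 := (crossed_ideal j u (@commutator_ideal R A)).

Let hj : star_hom j. Proof. by case: hB => -[]. Qed.
Let hu : unitary_representation u. Proof. by case: hB => -[]. Qed.
Let lj : linear j. Proof. by case: hj. Qed.
Let jM x y : j (x *c y) = j x *c j y. Proof. by case: hj => _ _ ->. Qed.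

Definition monomial (p : Qpos * ({nonneg rat} * {nonneg rat})) : B :=
  u p.1 *c j (toeplitz_gen T p.2).

Lemma monomial_span : closed_span (range monomial) = setT.
Proof.
apply/seteqP; split=> // b _; rewrite -[closed_span _ b]/(closed_span (range monomial) b).
have bT : closed_span (range (crossed_gen j u)) b by rewrite (crossed_span hB).
have cM := closed_span_closed (range monomial).
apply: (closed_span_min cM _ bT) => _ [[g x] _ <-].
have xT : closed_span (range (toeplitz_gen T)) x by rewrite (toeplitz_span hT).
have c1 := closed_subspace_preimage lj (star_hom_bounded hj)
  (closed_subspace_mull (u g) cM).
apply: (closed_span_min c1 _ xT) => _ [p _ <-] /=.
by apply: sub_closed_span; exists (g, p).
Qed.

Lemma jspan_approx y : closed_span (range j) y ->
  forall e, 0 < e -> exists a, nrm (y - j a) < e.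
Proof.
move=> hy e e0; have [l yl] := closed_span_lcomb hy e0.
by exists (lcomb id l); rewrite (lin_lcomb _ _ lj).
Qed.

Lemma crossed_commutator_ideal : closed_ideal_in setT I0.
Proof.
apply: (crossed_ideal_ideal hB (@commutator_ideal_ideal R A)) => a x.
by apply: commutator_hom; exact: (alpha_star_hom halpha).
Qed.

Lemma alpha_defect a t : 0 <= t -> alpha a (P t) = P (a%:num * t).
Proof.
move=> t0; have [la a1 aM _] := alpha_star_hom halpha a.
by rewrite /defect (linB la) a1 aM !(alpha_tshift hT halpha halphaT) mulrN.
Qed.

Lemma u_j g x : u g *c j x = j (alpha g x) *c u g.
Proof. by rewrite (crossed_comm hB); case: halpha => _ a1 aM; have := aM g^-1%g g; rewrite mulVg a1 => /(congr1 (fun f => f x)) /= <-. Qed.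

(** In the natural representation, the projection onto the basis vectors with index in [r, r + t),
    for nonnegative r and t. *)
Definition interval_proj (r t : rat) : B := j (V r *c P t *c V (- r)).

(** The diagonal entry at e_s of the expectation of the monomial: V_y V_y^* fixes e_s exactly when y
    <= s. *)
Definition diag_coef (s : rat) (p : Qpos * ({nonneg rat} * {nonneg rat})) : bool :=
  [&& p.1 == 1%g, p.2.1 == p.2.2 & p.2.2%:num <= s].

(* Unless it is diagonal, a monomial acts on [r] by an affine map with at most
   one fixed point, so that it moves a small interval [r, r + t) off itself. *)
Lemma compress_monomial (s : rat) p : 0 <= s -> near_interval s (fun r t =>
  interval_proj r t *c monomial p *c interval_proj r t =
    (diag_coef s p)%:R *: interval_proj r t).
Proof.
case: p => g [x y] s0; rewrite /monomial /diag_coef /toeplitz_gen /=.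
have [ys|sy] := leP y%:num s; last first.
  (* Here [r, r + t) lies below y, where V_y^* vanishes. *)
  exists (y%:num - s); first by rewrite subr_gt0.
  move=> r sr; rewrite addrC subrK => ry; exists (y%:num - r); first by rewrite subr_gt0.
  move=> t t0 tyr; rewrite !andbF scale0r /interval_proj.
  have r0 : 0 <= r by apply: ltW; apply: le_lt_trans sr.
  have E0 : V x%:num *c V (- y%:num) *c (V r *c P t *c V (- r)) = 0.
    rewrite -!cmulA (cmulA (V (- y%:num))) (tshiftM hT)//.
    have -> : - y%:num + r = - (y%:num - r) by rewrite opprB addrC.
    by rewrite (cmulA _ (P t)) (tshift_defect0 hT (ltW t0) tyr) cmul0l cmul0r.
  by rewrite -(cmulA _ (u g *c _)) -(cmulA (u g)) -jM E0 (lin0 lj) !cmul0r.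
(* Moving u_g to the right leaves a product P_t V_z P_{gt}, with z the displacement of r: it
   compares [0, t) with [z, z + g t) and vanishes when these are disjoint. *)
have red r t : s < r -> 0 < t ->
    interval_proj r t *c (u g *c j (V x%:num *c V (- y%:num))) *c interval_proj r t =
    j (V r *c P t *c V (g%:num * (x%:num - y%:num + r) - r) *c P (g%:num * t)) *c
      (u g *c j (V (- r))).
  move=> sr t0; have r0 : 0 <= r by apply: ltW; apply: le_lt_trans sr.
  have ry : 0 <= - y%:num + r by rewrite addrC subr_ge0 (le_trans ys)// ltW.
  have w0 : 0 <= x%:num - y%:num + r by rewrite -addrA addr_ge0.
  have E1 : V x%:num *c V (- y%:num) *c (V r *c P t *c V (- r)) =
      V (x%:num - y%:num + r) *c P t *c V (- r).
    rewrite -!cmulA (cmulA (V (- _)) (V r)) (tshiftM hT)// cmulA (tshiftM hT)//.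
    by rewrite addrA.
  have [_ _ aM _] := alpha_star_hom halpha g.
  have gw0 : 0 <= g%:num * (x%:num - y%:num + r) by rewrite mulr_ge0.
  have E2 : u g *c j (V (x%:num - y%:num + r) *c P t *c V (- r)) =
      j (V (g%:num * (x%:num - y%:num + r)) *c P (g%:num * t)) *c
        (u g *c j (V (- r))).
    rewrite jM (cmulA (u g)) u_j aM (alpha_tshift hT halpha halphaT).
    by rewrite (alpha_defect _ (ltW t0)) -cmulA.
  rewrite /interval_proj -(cmulA _ (u g *c _)) -(cmulA (u g)) -jM E1 E2.
  rewrite cmulA -jM (cmulA (V r *c P t *c V (- r))) -(cmulA (V r *c P t)).
  by rewrite (tshiftM hT)// (addrC (- r)).
have zero r t z : 0 < t -> (t <= z \/ g%:num * t <= - z) ->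
    V r *c P t *c V z *c P (g%:num * t) = 0.
  move=> t0 [tz|tz].
    by rewrite -(cmulA (V r)) (defect_tshift0 hT (ltW t0) tz) cmul0r cmul0l.
  have gt0 : 0 <= g%:num * t by rewrite mulr_ge0 ?ltW.
  by rewrite -cmulA -[z]opprK (tshift_defect0 hT gt0 tz) cmul0r.
pose phi r := g%:num * (x%:num - y%:num + r) - r.
have small r (b : bool) : phi r != 0 -> exists2 t0, 0 < t0 & forall t, 0 < t -> t <= t0 ->
    t <= phi r \/ g%:num * t <= - phi r.
  move=> phi0; case: (ltgtP (phi r) 0) phi0 => // phir _.
    exists (- phi r / g%:num); first by rewrite divr_gt0 ?oppr_gt0.
    by move=> t t0; rewrite ler_pdivlMr// mulrC; right.
  by exists (phi r) => // t t0; left.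
have [g1|g1] := eqVneq g 1%g.
  have phiE r : phi r = x%:num - y%:num by rewrite /phi g1 /= mul1r addrK.
  have [xy|xy] := eqVneq x y.
    exists 1 => // r sr _; exists 1 => // t t0 _; rewrite red//= scale1r.
    rewrite -/(phi r) phiE xy subrr (tshift0 hT) cmul1r g1 /= mul1r.
    have [u1 _ _ _] := hu; rewrite u1 cmul1l -jM -(cmulA (V r)).
    by rewrite (defect_idem hT) ?ltW.
  exists 1 => // r sr _.
  have [|t0 t00 h] := small r true.
    by rewrite phiE subr_eq0; apply: contra xy => /eqP xy; apply/eqP/val_inj.
  exists t0 => // t tp tt; rewrite red//= scale0r zero ?(lin0 lj) ?cmul0l//.
  exact: h.
have g1' : g%:num != 1 by apply: contra g1 => /eqP g1; apply/eqP/val_inj.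
have g10 : 1 - g%:num != 0 by rewrite subr_eq0 eq_sym.
pose v := g%:num * (x%:num - y%:num) / (1 - g%:num).
have phi0 r : phi r = 0 -> r = v.
  move=> h; apply: (mulIf g10); rewrite mulfVK//; move: h; rewrite /phi.
  by move=> /eqP; rewrite subr_eq0 => /eqP h; rewrite mulrBr mulr1 -{1}h; ring.
(* [v] is the fixed point of r |-> g (x - y + r); if it lies to the right of [s], the neighbourhood
   stops before it. *)
exists (if s < v then v - s else 1); first by case: ifP => //; rewrite subr_gt0.
move=> r sr rv; have [|t0 t00 h] := small r true.
  apply/eqP => /phi0 rE; move: rv; rewrite -rE sr addrC subrK ltxx.
  by [].
exists t0 => // t tp tt; rewrite red//= scale0r zero ?(lin0 lj) ?cmul0l//.
exact: h.
Qed.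

Lemma I0_mull x y : I0 y -> I0 (x *c y).
Proof. exact: ideal_mull crossed_commutator_ideal. Qed.

Lemma I0_mulr x y : I0 x -> I0 (x *c y).
Proof. exact: ideal_mulr crossed_commutator_ideal. Qed.

Lemma I0_defect t : 0 <= t -> I0 (j (P t)).
Proof. by move=> t0; apply: (crossed_ideal_j hB); exact: defect_in_commutator. Qed.

Section generated.
Variable J : set B.
Hypotheses (cJ : closed_subspace J).
Hypothesis JI : forall x b, I0 x -> J b -> J (x *c b) /\ J (b *c x).

(** Translates of P_d add up to P_{nd}, which absorbs every shorter P_t, and the defects generate
    the commutator ideal. As [J] absorbs only elements of [I0], idempotence is used to insert
    further defects, so that the outer factors of each product lie in [I0]. *)
Lemma defect_generates (d : rat) : 0 < d -> J (j (P d)) -> I0 `<=` J.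
Proof.
move=> d0 Jd; have lJ := cJ.2; have d0' := ltW d0.
have conjP w : 0 <= w -> J (j (V w *c P d *c V (- w))).
  move=> w0.
  have -> : j (V w *c P d *c V (- w)) =
      j (V w *c P d) *c j (P d) *c j (P d *c V (- w)).
    by rewrite -!jM -!cmulA (cmulA (P d) (P d)) (defect_idem hT)// (cmulA (P d) (P d)) (defect_idem hT).
  have [_ h] := JI (x := j (P d *c V (- w)))
    (b := j (V w *c P d) *c j (P d)) ltac:(rewrite jM; exact: I0_mulr (I0_defect d0'))
    (proj1 (JI (x := j (V w *c P d)) ltac:(rewrite jM; exact: I0_mull (I0_defect d0')) Jd)).
  exact: h.
have Jn n : J (j (P (n%:R * d))).
  elim: n => [|n IH].
    by rewrite mul0r /defect oppr0 (tshift0 hT) cmul1l subrr (lin0 lj); have [_ []] := cJ.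
  have nd0 : 0 <= n%:R * d by rewrite mulr_ge0.
  rewrite -addn1 natrD mulrDl mul1r (defectD hT)// (linD lj).
  by apply: lsubD => //; exact: conjP.
have Jt t : 0 <= t -> J (j (P t)).
  move=> t0; pose n := (Num.truncn (t / d)).+1.
  have tn : t <= n%:R * d.
    by rewrite -ler_pdivrMr// ltW// /n truncnS_gt.
  rewrite -(defect_absorb hT t0 tn) jM.
  by have [] := JI (I0_defect t0) (Jn n).
(* The two-sided multipliers make this an ideal of [A], to which [defect_commutator] applies. *)
pose K := [set a | forall x y g, J (u g *c j (x *c a *c y))].
have iK : closed_ideal_in setT K.
  split=> //.
    have -> : K = \bigcap_(p in [set: A * A * Qpos])
        [set a | J (u p.2 *c j (p.1.1 *c a *c p.1.2))].
      apply/seteqP; split=> [a Ka [[x y] g] _ /=|a Ka x y g]; first exact: Ka.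
      exact: (Ka ((x, y), g)).
    have cp (p : A * A * Qpos) : closed_subspace [set a | J (u p.2 *c j (p.1.1 *c a *c p.1.2))].
      have c1 := closed_subspace_preimage lj (star_hom_bounded hj)
        (closed_subspace_mull (u p.2) cJ).
      exact: (closed_subspace_mull p.1.1 (closed_subspace_mulr p.1.2 c1)).
    split; first by apply: closed_bigI => p _; have [] := cp p.
    split=> [p _|a x y hx hy p _]; first by have [_ []] := cp p.
    by have [_ [_ h]] := cp p; apply: h; [exact: hx | exact: hy].
  move=> x y _ Ky; split=> z w g; rewrite (cmulA z); first exact: Ky.
  by rewrite -(cmulA (z *c y)); exact: Ky.
have KC : @commutator_ideal R A `<=` K.
  apply: (defect_commutator hT iK) => t t0 x y g.
  have -> : u g *c j (x *c P t *c y) = u g *c j (x *c P t) *c (j (P t) *c j (P t *c y)).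
    rewrite -(cmulA (u g)) -!jM; congr (_ *c j _).
    by rewrite -!cmulA (cmulA (P t) (P t)) (defect_idem hT)// (cmulA (P t) (P t)) (defect_idem hT).
  apply: (JI _ _).1; first by apply: I0_mull; rewrite jM; exact: I0_mull (I0_defect t0).
  apply: (JI _ _).2; first by rewrite jM; exact: I0_mulr (I0_defect t0).
  exact: Jt.
apply: (closed_span_min cJ) => _ [g [x Cx ->]].
by have := KC _ Cx cone cone g; rewrite cmul1l cmul1r.
Qed.

Section nonzero.
Variable E : B -> B.
Hypotheses (lE : linear E) (bE : bounded_by 1 E).
Hypothesis EE : forall p, E (crossed_gen j u p) = if p.1 == 1%g then j p.2 else 0.
Hypothesis Epos : forall (H : hilbertType R) (pi : B -> bop H) (d : B) (h : H),
  star_hom pi -> 0 <= complex.Re (hdot (pi (E (d^*c *c d)) h) h).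

(** If all these vector states vanish, Bessel's inequality kills every Fourier coefficient in a
    representation that is isometric on [A], hence [b] itself. *)
Lemma diag_nonzero (H : hilbertType R) (e : {nonneg rat} -> H) (pi : B -> bop H) b :
  orthonormal_basis e -> star_hom pi -> (forall a, nrm (pi (j a)) = nrm a) ->
  b != 0 -> exists s, 0 < complex.Re (hdot (pi (E (b^*c *c b)) (e s)) (e s)).
Proof.
move=> be hpi iso b0; apply: contrapT => h.
have f0 g : fcoef u E g b = 0.
  have pf : pi (fcoef u E g b) = 0.
    apply: (bop_eq_basis be) => s; rewrite bop0E; apply: nrm0_eq0; apply/eqP.
    rewrite -sqrf_eq0; apply/eqP/le_anti; rewrite sqr_ge0 andbT.
    apply: le_trans (fcoef_le hB lE bE EE Epos g b (e s) hpi) _.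
    by rewrite leNgt; apply/negP => hs; apply: h; exists s.
  apply: nrm_eq0_le => r r0.
  have hy : closed_span (range j) (fcoef u E g b) by exact: (expectation_range hB lE bE EE).
  have [a ya] := jspan_approx hy (e := r / 2) ltac:(by rewrite divr_gt0).
  set y := fcoef u E g b in pf ya *.
  have h1 : nrm a <= nrm (y - j a).
    have pja : pi (j a) = - pi (y - j a).
      by rewrite (linB (star_hom_lin hpi)) pf sub0r opprK.
    rewrite -iso pja nrmN.
    by have := star_hom_bounded hpi (y - j a); rewrite mul1r.
  have h2 := nrmD (y - j a) (j a); rewrite subrK in h2.
  by have := star_hom_bounded hj a; rewrite mul1r; lra.
case/eqP: b0; apply: (fourier_mem hB lE bE EE (M := [set 0])).
  exact: closed_subspace0.
by move=> g /=; rewrite f0 cmul0r.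
Qed.

(* The support interval of [J] is found by compressing [b^* b], approximated by
   monomials, to an interval on which its expectation does not vanish. *)
Theorem ideal_contains_commutator b : J b -> J (b^*c *c b) -> b != 0 -> I0 `<=` J.
Proof.
move=> Jb Jc b0; set c := b^*c *c b in Jc.
have [H [e [pi [be hpi iso piV piu]]]] := natural_rep hT halpha halphaT hB.
have [lpi pi1 piM pis] := hpi.
have [ee _] := be.
have [s s0] := diag_nonzero be hpi iso b0.
set mu := complex.Re _ in s0.
have cT : closed_span (range monomial) c by rewrite monomial_span.
(* Accuracy mu/4 keeps |lam| >= 3 mu/4, so that p - lam^-1 p c p has norm at most 1/3, within the
   1/2 required by [neumann_mem]. *)
have [l cl] := closed_span_lcomb cT (e := mu / 4) ltac:(by rewrite divr_gt0).
set c0 := lcomb monomial l in cl.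
have [eta e0 hr] := near_interval_seq l (fun p => compress_monomial p.2 (ge0 s)).
have [||t t0 ht] := hr (s%:num + eta / 2).
- by rewrite ltrDl divr_gt0.
- by rewrite ltrD2l ltr_pdivrMr// ltr_pMr// ltr1n.
have {ht} ht := ht t t0 (lexx _).
set r := s%:num + eta / 2 in ht; pose p := interval_proj r t.
have r0 : 0 <= r by rewrite addr_ge0// divr_ge0// ltW.
pose lam := \sum_(q <- l) q.1 * (diag_coef s%:num q.2)%:R : R[i].
have pcp : p *c c0 *c p = lam *: p.
  rewrite /c0 (lin_lcomb _ _ (linear_cmull p)) (lin_lcomb _ _ (linear_cmulr p)).
  rewrite /lcomb /lam scaler_suml !big_seq; apply: eq_bigr => q ql /=.
  by rewrite ht// scalerA.
have lamE : hdot (pi (E c0) (e s)) (e s) = lam.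
  rewrite /c0 (lin_lcomb _ _ lE) (lin_lcomb _ _ lpi) /lcomb bop_sumE hdot_suml.
  apply: eq_bigr => -[a [g [x y]]] _ /=; rewrite ?bopZE hdotZl; congr (_ * _).
  have := EE (g, toeplitz_gen T (x, y)); rewrite /crossed_gen /monomial /= => ->.
  rewrite /diag_coef /=; case: eqP => _ /=; last by rewrite (lin0 lpi) bop0E hdot0l.
  rewrite /toeplitz_gen jM piM bopME /= piV addrC subr_ge0.
  case: leP => ys /=; last by rewrite (lin0 (@bop_linear _ _ _)) hdot0l andbF.
  have sy0 : 0 <= s%:num - y%:num by rewrite subr_ge0.
  rewrite piV (nngE sy0) addr_ge0// ee andbT; congr (_%:R); congr nat_of_bool.
  have xsy0 : 0 <= x%:num + (s%:num - y%:num) by rewrite addr_ge0.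
  apply/eqP/eqP => [/(congr1 (fun z : {nonneg rat} => z%:num))|->].
    by rewrite (nngE xsy0) => h; apply/val_inj => /=; move: h; lra.
  by rewrite addrC subrK nngK.
have ns : nrm (e s) = 1.
  have := hdot_nrm (e s); rewrite ee eqxx => /esym/(@complexI _ _ 1)/eqP.
  by rewrite sqrp_eq1 ?nrm_ge0// => /eqP.
have lam_mu : 3 / 4 * mu <= nrm lam.
  have : nrm (hdot (pi (E c) (e s)) (e s) - lam) <= mu / 4.
    rewrite -lamE -hdotBl -bopBE -(linB lpi) -(linB lE).
    apply: le_trans (cauchy_schwarz _ _) _; rewrite ns mulr1.
    apply: le_trans (nrm_bopP _ _) _; rewrite ns mulr1.
    have := star_hom_bounded hpi (E (c - c0)); have := bE (c - c0).
    by rewrite !mul1r; lra.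
  move=> h; have := nrm_dist (hdot (pi (E c) (e s)) (e s)) lam.
  have := Re_nrm (hdot (pi (E c) (e s)) (e s)); rewrite -/mu.
  by rewrite !ler_norml => /andP[_ h1] /andP[_ h2]; lra.
have lam0 : lam != 0.
  by apply/eqP => l0; move: lam_mu; rewrite l0 nrm0; lra.
have Ip : I0 p.
  rewrite /p /interval_proj !jM; apply: I0_mulr; apply: I0_mull.
  by apply: I0_defect; exact: ltW.
have VV : V (- r) *c V r = cone by rewrite (tshiftM hT)// addNr (tshift0 hT).
have pp : p *c p = p.
  rewrite /p /interval_proj -jM -!cmulA (cmulA (V (- r))) VV cmul1l.
  by rewrite (cmulA (P t)) (defect_idem hT) ?ltW.
have ps : p^*c = p.
  rewrite /p /interval_proj; have [_ _ _ <-] := hj.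
  by rewrite !starM (defect_star hT) ?ltW// -!(tshiftN hT) opprK cmulA.
have np : nrm p <= 1.
  by have := nrm_starM p; rewrite ps pp; have := nrm_ge0 p; nra.
pose z := lam^-1 *: (p *c c *c p).
have Jz : J z.
  apply: (lsubZ _ cJ.2); apply: (JI _ _).2 => //.
  exact: (JI _ _).1.
have zp : z *c p = z by rewrite /z cmulZl -(cmulA (p *c c)) pp.
have pz : nrm (p - z) <= 2^-1.
  have -> : p - z = lam^-1 *: (p *c (c0 - c) *c p).
    rewrite /z cmulBr cmulBl pcp scalerBr scalerA mulVf// scale1r.
    by [].
  have nl : nrm lam * nrm lam^-1 = 1 by rewrite -nrmcM mulfV// nrm1.
  rewrite nrm_scale.
  have : nrm (p *c (c0 - c) *c p) <= mu / 4.
    apply: le_trans (nrmM _ _) _; have := nrmM p (c0 - c).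
    have := nrm_ge0 (p *c (c0 - c)); have := nrm_ge0 p; rewrite (nrm_distC c0).
    have := nrm_ge0 (c - c0); nra.
  move: (nrm (p *c _ *c p)) => w hw.
  have i0 : 0 <= nrm lam^-1 by exact: nrm_ge0.
  by have := nrm_ge0 lam; nra.
have Jp := neumann_mem crossed_commutator_ideal cJ JI Ip Jz pp zp pz.
apply: (defect_generates t0).
have t0' := ltW t0.
have -> : j (P t) = j (P t *c V (- r)) *c p *c j (V r *c P t).
  rewrite /p /interval_proj -!jM; congr j.
  rewrite -!cmulA (cmulA (V (- r)) (V r)) VV cmul1l (cmulA (V (- r)) (V r)) VV cmul1l.
  by rewrite !(defect_idem hT).
apply: (JI _ _).2; first by rewrite jM; exact: I0_mull (I0_defect t0').
by apply: (JI _ _).1; first by rewrite jM; exact: I0_mulr (I0_defect t0').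
Qed.

End nonzero.
End generated.
End minimal_ideal.

(** * Ideals strictly containing the crossed product of the commutator ideal *)

(** All but at most 2|m| terms cancel, whatever [L] is. *)
Lemma telescope_bound (R : realType) (V : normedModType R[i]) (F : int -> V) (m : int) (L : nat) :
  (forall n, nrm (F n) <= 1) ->
  nrm (\sum_(0 <= n < L) (F (n%:Z + m) - F n%:Z)) <= 2 * (`|m|%N)%:R.
Proof.
have pos (G : int -> V) (k : nat) : (forall n, nrm (G n) <= 1) ->
    nrm (\sum_(0 <= n < L) (G (n%:Z + k%:Z) - G n%:Z)) <= 2 * k%:R.
  move=> G1; elim: k => [|k IH].
    rewrite big1 ?nrm0 ?mulr0// => n _; rewrite addr0 subrr.
    by [].
  rewrite (eq_bigr (fun n : nat => (G (n.+1%:Z + k%:Z) - G (n%:Z + k%:Z)) +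
      (G (n%:Z + k%:Z) - G n%:Z))) => [|n _]; last first.
    rewrite addrA subrK; congr (G _ - _).
    by rewrite -!PoszD addSnnS.
  rewrite big_split /= (telescope_sumr (fun n : nat => G (n%:Z + k%:Z)))//.
  apply: le_trans (nrmD _ _) _.
  have := nrmB (G (L%:Z + k%:Z)) (G (0%:Z + k%:Z)).
  have := G1 (L%:Z + k%:Z); have := G1 (0%:Z + k%:Z); rewrite -addn1 natrD.
  by lra.
case: m => k F1; first exact: pos.
rewrite NegzE abszN absz_nat.
have := pos (fun n => F (n - k.+1%:Z)) k.+1 ltac:(by move=> n; exact: F1).
rewrite -nrmN -sumrN; congr (nrm _ <= _).
by apply: eq_bigr => n _; rewrite opprB addrK.
Qed.

(** Makes one step size serve finitely many slopes: with h = rho / K, each nonzero r in the list has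
    rho equal to an integer multiple of h r. *)
Lemma common_multiple (s : seq rat) : exists2 K : nat, (0 < K)%N &
  forall r, r \in s -> r != 0 -> exists m : int, K%:R = m%:~R * r.
Proof.
elim: s => [|r s [K K0 KP]]; first by exists 1%N.
have [->|r0] := eqVneq r 0.
  by exists K => // q; rewrite inE => /orP[/eqP ->|/KP//]; rewrite eqxx.
exists (K * `|numq r|)%N; first by rewrite muln_gt0 K0 absz_gt0 numq_eq0.
move=> q; rewrite inE natrM => /orP[/eqP -> _|/KP h /h[m ->]]; last first.
  by exists (m * (`|numq r|%N)%:Z); rewrite rmorphM /= mulrAC.
exists (K%:Z * (sgz r) * denq r).
rewrite !rmorphM /= -!mulrA; congr (_ * _).
have -> : (denq r)%:~R * r = (numq r)%:~R.
  by rewrite -[X in _ * X]divq_num_den mulrC mulfVK// intr_eq0 denq_neq0.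
by rewrite -intrM -sgr_numq -abszEsg.
Qed.

(** The factor is n + 1, which keeps the value positive at n = 0. *)
Definition Qpos_multiple (c : rat) (c0 : 0 < c) (n : nat) : Qpos :=
  PosNum (mulr_gt0 (ltr0Sn rat n) c0).

Section second_ideal.
Variables (R : realType) (A : cstarAlgType R) (T : {nonneg rat} -> A).
Hypothesis hT : is_toeplitz T.
Variable alpha : Qpos -> A -> A.
Hypothesis halpha : is_action alpha.
Hypothesis halphaT : forall a r, alpha a (T r) = T (Qscale a r).
Variables (B : cstarAlgType R) (j : A -> B) (u : Qpos -> B).
Hypothesis hB : is_crossed_product alpha j u.
Local Notation V := (tshift T).
Local Notation P := (defect T).
Local Notation I0 := (crossed_ideal j u (@commutator_ideal R A)).
Local Notation mono := (monomial T j u).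

Let hj : star_hom j. Proof. by case: hB => -[]. Qed.
Let hu : unitary_representation u. Proof. by case: hB => -[]. Qed.
Let lj : linear j. Proof. by case: hj. Qed.
Let jM x y : j (x *c y) = j x *c j y. Proof. by case: hj => _ _ ->. Qed.
Let js x : j x^*c = (j x)^*c. Proof. by case: hj => _ _ _ ->. Qed.
Let j1 : j cone = cone. Proof. by case: hj => _ ->. Qed.
Let u1 : u 1%g = cone. Proof. by case: hu. Qed.
Let uM g h : u (g * h)%g = u g *c u h. Proof. by case: hu => _ ->. Qed.
Let iI : closed_ideal_in setT I0. Proof. exact: (crossed_commutator_ideal halpha hB). Qed.
Let iC := @commutator_ideal_ideal R A.

Let jmod x y : @commutator_ideal R A (x - y) -> I0 (j x - j y).
Proof. by move=> xy; rewrite -(linB lj); exact: (crossed_ideal_j hB). Qed.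

Let Cdefect t : 0 <= t -> @commutator_ideal R A (P t).
Proof. by move=> t0; exact: defect_in_commutator. Qed.

Let nrm_jV x : nrm (j (V x)) <= 1.
Proof.
apply: le_trans (star_hom_bounded hj _) _.
by rewrite mul1r (nrm_tshift hT).
Qed.

(** Moving V_{-z} across u_g replaces z by g^-1 z, and modulo [I0] the V's multiply as a group.
    Since the positive rationals commute, conjugation by u_a leaves u_g unchanged and scales the
    index by a. *)
Lemma conj_monomial_mod (a : Qpos) (z : rat)
    (p : Qpos * ({nonneg rat} * {nonneg rat})) : 0 <= z ->
  I0 (u a *c j (V (- z)) *c mono p *c j (V z) *c (u a)^*c -
    u p.1 *c j (V (a%:num * (p.2.1%:num - p.2.2%:num + z - p.1%:num^-1 * z)))).
Proof.
move=> z0; have [_ _ uu uu'] := hu.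
set r := _ + z - _.
have -> : u a *c j (V (- z)) *c mono p *c j (V z) *c (u a)^*c =
    u p.1 *c j (alpha a (V (- (p.1%:num^-1 * z)) *c toeplitz_gen T p.2 *c V z)).
  have E1 : j (V (- z)) *c u p.1 = u p.1 *c j (V (- (p.1%:num^-1 * z))).
    by rewrite (crossed_comm hB) (alpha_tshift hT halpha halphaT) /= mulrN.
  have -> : u a *c j (V (- z)) *c mono p *c j (V z) *c (u a)^*c =
      u a *c (j (V (- z)) *c u p.1) *c j (toeplitz_gen T p.2) *c j (V z) *c (u a)^*c.
    by rewrite /monomial !cmulA.
  have [[_ _ cov] _ _] := hB.
  by rewrite E1 cov !jM !cmulA -!uM Qpos_mulC.
rewrite -cmulBr; apply: (ideal_mull _ iI).
rewrite -(alpha_tshift hT halpha halphaT); apply: jmod.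
have [la _ _ _] := alpha_star_hom halpha a.
rewrite -(linB la); apply: (commutator_hom (alpha_star_hom halpha a)).
apply: (@ideal_mod_trans _ _ _ _ (V (- (p.1%:num^-1 * z) + (p.2.1%:num - p.2.2%:num)) *c V z) _ iC).
  apply: (ideal_modM iC); last by rewrite subrr; have [_ [_ []]] := iC.
  apply: (@ideal_mod_trans _ _ _ _ (V (- (p.1%:num^-1 * z)) *c V (p.2.1%:num - p.2.2%:num)) _ iC).
    apply: (ideal_modM iC); first by rewrite subrr; have [_ [_ []]] := iC.
    exact: (toeplitz_gen_mod hT iC Cdefect).
  exact: (tshift_mod hT iC Cdefect).
rewrite (tshiftM hT)// /r.
have -> : - (p.1%:num^-1 * z) + (p.2.1%:num - p.2.2%:num) + z =
    p.2.1%:num - p.2.2%:num + z - p.1%:num^-1 * z by ring.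
by rewrite subrr; have [_ [_ []]] := iC.
Qed.

Definition diag (p : Qpos * ({nonneg rat} * {nonneg rat})) : bool :=
  (p.1 == 1%g) && (p.2.1 == p.2.2).

(** Each off-diagonal monomial has at most one exceptional z; any value beyond all of them is
    suitable. *)
Lemma generic_shift (l : seq (R[i] * (Qpos * ({nonneg rat} * {nonneg rat})))) :
  exists2 z, 0 <= z & forall q, q \in l -> ~~ diag q.2 ->
    q.2.2.1%:num - q.2.2.2%:num + z - q.2.1%:num^-1 * z != 0.
Proof.
pose bad (q : R[i] * (Qpos * ({nonneg rat} * {nonneg rat}))) : rat :=
  (q.2.2.2%:num - q.2.2.1%:num) / (1 - q.2.1%:num^-1).
have [n n0 nP] := rat_seq_bound [seq bad q | q <- l].
exists (n + 1); first by rewrite addr_ge0.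
move=> q ql dq; apply/eqP => h.
have [g1|g1] := eqVneq q.2.1 1%g.
  move: dq; rewrite /diag g1 eqxx /= => /negP; apply; apply/eqP/val_inj => /=.
  by move: h; rewrite g1 /= invr1 mul1r addrK => /subr0_eq.
have g1' : 1 - q.2.1%:num^-1 != 0.
  rewrite subr_eq0 eq_sym invr_eq1; apply: contra g1 => /eqP g1.
  by apply/eqP/val_inj.
have : n + 1 = bad q.
  apply: (mulIf g1'); rewrite /bad mulfVK//.
  by apply/eqP; rewrite -subr_eq0 -h; apply/eqP; ring.
have := nP (bad q) (map_f _ ql) => le1 E; move: le1; rewrite -E.
by rewrite gerDl ler10.
Qed.

Section ideal.
(** [N] stands for the kernel of id x| psi, and [kappa] for the quotient map followed by the section
    that sends the unitaries of the group algebra to the u_g. *)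
Variables (N : set B) (kappa : B -> B) (d : R).
Hypotheses (iN : closed_ideal_in setT N) (lk : linear kappa) (bk : bounded_by d kappa).
Hypothesis kE : forall p, kappa (mono p) = u p.1.
Hypothesis Nk : forall b, N b -> kappa b = 0.
Hypothesis NV : forall x, 0 <= x -> N (j (V x) - cone).
Variable J : set B.
Hypotheses (cJ : closed_subspace J) (IJ : I0 `<=` J).
Hypothesis JN : forall x b, N x -> J b -> J (x *c b) /\ J (b *c x).

(** A bound for the norm modulo [I0], together with a representative that realises it. *)
Definition near_ideal (x : B) (r : R) := exists2 w, I0 w & nrm (x - w) <= r.

Lemma near_ideal_sum (X : eqType) (l : seq X) (F : X -> B) (M : X -> R) :
  (forall x, x \in l -> near_ideal (F x) (M x)) ->
  near_ideal (\sum_(x <- l) F x) (\sum_(x <- l) M x).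
Proof.
elim: l => [|x l IH] h.
  by exists 0; [have [_ [_ []]] := iI | rewrite !big_nil subrr nrm0].
have [w Iw hw] := h x (mem_head _ _).
have [v Iv hv] : near_ideal (\sum_(x <- l) F x) (\sum_(x <- l) M x).
  by apply: IH => y yl; apply: h; rewrite inE yl orbT.
exists (w + v); first exact: lsubD (ideal_sub iI) Iw Iv.
rewrite !big_cons opprD addrACA; apply: le_trans (nrmD _ _) _.
exact: lerD.
Qed.

(* The averages over [n <= L] of the conjugates of a monomial by [u_{nc} V_z^*],
   times [V_rho - 1], converge at rate [1/L] modulo [I0], since off the diagonal
   they telescope. *)
Lemma conj_sum_near (rho c z : rat) (c0 : 0 < c) (m : int)
    (p : Qpos * ({nonneg rat} * {nonneg rat})) (L : nat) :
  0 <= z -> 0 < rho ->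
  let r := p.2.1%:num - p.2.2%:num + z - p.1%:num^-1 * z in
  (~~ diag p -> rho = m%:~R * (c * r)) ->
  near_ideal (\sum_(0 <= n < L) u (Qpos_multiple c0 n) *c j (V (- z)) *c mono p *c j (V z) *c
      (u (Qpos_multiple c0 n))^*c *c (j (V rho) - cone) -
    (L%:R * (diag p)%:R : R[i]) *: (j (V rho) - cone)) (2 * (`|m|%N)%:R).
Proof.
move=> z0 rho0 r hm; set k := j (V rho) - cone.
have iI' := ideal_sub iI.
have [dp|dp] := boolP (diag p).
  have r0 : r = 0.
    move: dp; rewrite /diag /r => /andP[/eqP -> /eqP ->].
    by rewrite /= invr1 mul1r subrr add0r subrr.
  have g1 : p.1 = 1%g by move: dp => /andP[/eqP].
  set S := \sum_(0 <= n < L) _.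
  have IS : I0 (S - (L%:R * 1 : R[i]) *: k).
    have -> : (L%:R * 1 : R[i]) *: k = \sum_(0 <= n < L) k.
      by rewrite mulr1 big_const_nat subn0 iter_addr_0 scaler_nat.
    rewrite /S -sumrB; apply: lsub_sum => // n _ _.
    rewrite -[X in _ - X]cmul1l -cmulBl; apply: (ideal_mulr _ iI).
    have := conj_monomial_mod (Qpos_multiple c0 n) p z0; rewrite -/r r0 mulr0 (tshift0 hT) j1 g1 u1.
    by rewrite cmul1l.
  by exists (S - (L%:R * 1 : R[i]) *: k) => //; rewrite subrr nrm0 mulr_ge0.
rewrite mulr0 scale0r subr0.
(* Multiplication by V_rho shifts the index of [F] by m, since rho = m s; the n + 1 comes from
   [Qpos_multiple]. *)
pose s := c * r; pose F (n : int) := u p.1 *c j (V ((n + 1)%:~R * s)).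
have F1 n : nrm (F n) <= 1.
  apply: le_trans (nrmM _ _) _; have := nrm_jV ((n + 1)%:~R * s).
  have := unitary_nrm p.1 hu; have := nrm_ge0 (u p.1).
  by have := nrm_ge0 (j (V ((n + 1)%:~R * s))); nra.
set S := \sum_(0 <= n < L) _.
pose S' := \sum_(0 <= n < L) (F (n%:Z + m) - F n%:Z).
exists (S - S'); last by rewrite subKr; exact: telescope_bound.
rewrite /S /S' -sumrB; apply: lsub_sum => // n _ _.
have E1 : (Qpos_multiple c0 n)%:num * r = (n%:Z + 1)%:~R * s.
  by rewrite /s /= mulrA; congr (_ * _ * _); rewrite -PoszD addn1.
apply: (@ideal_mod_trans _ _ _ _ (u p.1 *c j (V ((n%:Z + 1)%:~R * s)) *c k) _ iI).
  rewrite -cmulBl; apply: (ideal_mulr _ iI).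
  by have := conj_monomial_mod (Qpos_multiple c0 n) p z0; rewrite -/r E1.
rewrite /k cmulBr cmul1r -/(F n%:Z) opprB addrA subrK.
rewrite /F -cmulA -jM -cmulBr; apply: (ideal_mull _ iI); apply: jmod.
have -> : (n%:Z + m + 1)%:~R * s = (n%:Z + 1)%:~R * s + rho.
  by rewrite (hm dp) -/s -mulrDl -intrD; congr (_%:~R * _); ring.
exact: (tshift_mod hT iC Cdefect).
Qed.

Lemma near_ideal_scale (a : R[i]) x r : near_ideal x r -> near_ideal (a *: x) (nrm a * r).
Proof.
move=> [w Iw h]; exists (a *: w); first exact: lsubZ (ideal_sub iI) Iw.
by rewrite -scalerBr nrm_scale ler_wpM2l ?nrm_ge0.
Qed.

Definition diag_sum (l : seq (R[i] * (Qpos * ({nonneg rat} * {nonneg rat})))) : R[i] :=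
  \sum_(q <- l) q.1 * (diag q.2)%:R.

(** With k = V_rho - 1, the averages of y_n c y_n^* k come arbitrarily close to tau k modulo [I0].
    The factors [k1] on the left and k on the right, both in [N], keep them in [J], which absorbs
    only [N]. *)
Lemma absorb_mem (c : B) (tau : R[i]) (rho : rat) (k1 : B) : 0 < rho -> J c ->
  N k1 ->
  (forall l, nrm (tau - diag_sum l) <= nrm (c - lcomb mono l)) ->
  J (tau *: (k1 *c (j (V rho) - cone))).
Proof.
move=> rho0 Jc Nk1 tauP; set k := j (V rho) - cone.
have Nk0 : N k by apply: NV; exact: ltW.
apply: (closed_subspace_approx cJ) => e e0.
have nk : nrm k <= 2.
  apply: le_trans (nrmB _ _) _; have := nrm_jV rho; have := nrm_cone B.
  by lra.
have n1 : 0 < nrm k1 + 1 by rewrite ltr_wpDl ?nrm_ge0.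
have cT : closed_span (range mono) c by rewrite (monomial_span hT hB).
(* Three errors will result: twice this distance from [tau], once the same amount from M / L, and
   twice this distance from the averaging; after multiplication by [k1] they sum to at most 5/8 of
   e. *)
have [l cl] := closed_span_lcomb cT (e := e / 8 / (nrm k1 + 1)) ltac:(by rewrite !divr_gt0).
set c0 := lcomb mono l in cl.
have [z z0 zP] := generic_shift l.
pose rr (q : R[i] * (Qpos * ({nonneg rat} * {nonneg rat}))) :=
  q.2.2.1%:num - q.2.2.2%:num + z - q.2.1%:num^-1 * z.
have [K K0 KP] := common_multiple [seq rr q | q <- l].
have K0' : 0 < K%:R :> rat by rewrite ltr0n.
pose h := rho / K%:R; have h0 : 0 < h by rewrite divr_gt0.
have /choice[m mP] : forall q, exists m : int, q \in l -> ~~ diag q.2 ->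
    rho = m%:~R * (h * rr q).
  move=> q; have [/andP[ql dq]|/negP nq] := boolP ((q \in l) && ~~ diag q.2); last first.
    by exists 0 => ql dq; case: nq; rewrite ql.
  have [m mE] := KP (rr q) (map_f _ ql) (zP q ql dq); exists m => _ _.
  by rewrite mulrCA -mE /h mulfVK// gt_eqF.
pose M := \sum_(q <- l) nrm q.1 * (2 * (`|m q|%N)%:R).
have M0 : 0 <= M by rewrite sumr_ge0// => q _; rewrite mulr_ge0 ?nrm_ge0// mulr_ge0.
have [L0 LP] := small_invS (e := e / 8 / (nrm k1 + 1) / (M + 1))
  ltac:(by rewrite !divr_gt0// ltr_wpDl).
pose L := L0.+1; pose y n := u (Qpos_multiple h0 n) *c j (V (- z)).
have ys n : (y n)^*c = j (V z) *c (u (Qpos_multiple h0 n))^*c.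
  by rewrite /y starM -js -(tshiftN hT) opprK.
have ny n : nrm (y n) <= 1.
  apply: le_trans (nrmM _ _) _; have := nrm_jV (- z).
  have := unitary_nrm (Qpos_multiple h0 n) hu; have := nrm_ge0 (u (Qpos_multiple h0 n)).
  by have := nrm_ge0 (j (V (- z))); nra.
pose av x := \sum_(0 <= n < L) y n *c x *c (y n)^*c *c k.
have lav : linear av.
  move=> a x w; rewrite /av scaler_sumr -big_split; apply: eq_bigr => n _.
  by rewrite /= cmul_linearr !cmul_linearl.
have bav : bounded_by (L%:R * 2) av.
  move=> x; apply: le_trans (nrm_sum _ _ _) _.
  apply: (@le_trans _ _ (\sum_(0 <= n < L) (2 * nrm x))); last first.
    by rewrite sumr_const_nat subn0 -(mulr_natl (2 * nrm x)) mulrA.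
  apply: ler_sum => n _.
  have b2 : nrm (y n *c x) <= nrm x.
    apply: le_trans (nrmM _ _) _; rewrite -[leRHS]mul1r.
    by rewrite ler_wpM2r ?nrm_ge0// ny.
  have b1 : nrm (y n *c x *c (y n)^*c) <= nrm x.
    apply: le_trans (nrmM _ _) _; rewrite -[leRHS]mulr1.
    by rewrite ler_pM ?nrm_ge0// nrm_star ny.
  by apply: le_trans (nrmM _ _) _; rewrite mulrC ler_pM ?nrm_ge0.
have near0 : near_ideal (av c0 - (L%:R * diag_sum l) *: k) M.
  have -> : av c0 - (L%:R * diag_sum l) *: k =
      \sum_(q <- l) q.1 *: (av (mono q.2) - (L%:R * (diag q.2)%:R) *: k).
    rewrite /c0 (lin_lcomb _ _ lav) /lcomb /diag_sum mulr_sumr scaler_suml -sumrB.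
    apply: eq_bigr => q _; rewrite [RHS]scalerBr (scalerA q.1).
    by congr (_ - _ *: _); ring.
  apply: near_ideal_sum => q ql; apply: near_ideal_scale.
  have := @conj_sum_near rho h z h0 (m q) q.2 L z0 rho0 => /(_ _); rewrite -/(rr q) => /(_ (mP q ql)).
  rewrite -/k; congr (near_ideal (_ - _) _); apply: eq_bigr => n _.
  by rewrite /y starM -js -(tshiftN hT) opprK !cmulA.
have [w Iw hw] := near0.
have Jav : J (k1 *c av c).
  clear near0 hw; clearbody y.
  rewrite /av (lin_sum (linear_cmull k1)); apply: (lsub_sum cJ.2) => n _ _.
  rewrite -!cmulA (cmulA k1); apply: (JN _ _).1; first exact: (ideal_mulr _ iN Nk1).
  by apply: (JN _ _).2 => //; exact: (ideal_mull _ iN Nk0).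
have Ln0 : L%:R != 0 :> R[i] by rewrite pnatr_eq0.
exists (L%:R^-1 *: (k1 *c av c - k1 *c w)).
  apply: (lsubZ _ cJ.2); apply: (lsubB cJ.2 Jav); apply: IJ.
  exact: (ideal_mull _ iI).
have -> : tau *: (k1 *c k) - L%:R^-1 *: (k1 *c av c - k1 *c w) =
    k1 *c ((tau - diag_sum l) *: k -
      L%:R^-1 *: (av c0 - (L%:R * diag_sum l) *: k - w) - L%:R^-1 *: av (c - c0)).
  have zid (v1 v2 v3 v4 v5 : B) :
      v4 - (v1 - v3) = v4 - v5 - (v2 - v5 - v3) - (v1 - v2).
    by rewrite !opprB (addrCA v3) (addrA (v4 - v5)) subrK -addrA (addrA (v3 - v2)) subrK.
  rewrite -cmulBr -!cmulZr -cmulBr; congr (_ *c _).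
  rewrite (linB lav) !scalerBl.
  rewrite [L%:R^-1 *: (av c - w)]scalerBr [L%:R^-1 *: (av c - av c0)]scalerBr.
  rewrite [L%:R^-1 *: (_ - _ - w)]scalerBr [L%:R^-1 *: (av c0 - _)]scalerBr.
  by rewrite (scalerA L%:R^-1) mulrA mulVf// mul1r; exact: zid.
have h1 : nrm ((tau - diag_sum l) *: k) <= nrm (c - c0) * 2.
  by rewrite nrm_scale ler_pM ?nrm_ge0// tauP.
have h2 : nrm (L%:R^-1 *: (av c0 - (L%:R * diag_sum l) *: k - w)) <= L%:R^-1 * M.
  by rewrite nrm_scale nrm_natV ler_wpM2l ?invr_ge0.
have h3 : nrm (L%:R^-1 *: av (c - c0)) <= nrm (c - c0) * 2.
  rewrite nrm_scale nrm_natV ler_pdivrMl ?ltr0n// (mulrC (nrm _)) mulrA.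
  exact: bav.
have h4 : L%:R^-1 * M <= e / 8 / (nrm k1 + 1).
  have := LP L0 (leqnn _); rewrite ltr_pdivlMr ?ltr_wpDl// -/L => h4.
  have : 0 <= (L%:R^-1 : R) by rewrite invr_ge0.
  by move: (L%:R^-1) h4 => q h4 q0; nra.
apply: le_lt_trans (nrmM _ _) _.
set D := _ - _ - _.
have hD : nrm D <= 5 * (e / 8 / (nrm k1 + 1)).
  apply: le_trans (nrmB _ _) _.
  by have := nrmB ((tau - diag_sum l) *: k) (L%:R^-1 *: (av c0 - (L%:R * diag_sum l) *: k - w)); lra.
apply: (@le_lt_trans _ _ ((nrm k1 + 1) * (5 * (e / 8 / (nrm k1 + 1))))).
  by rewrite ler_pM ?nrm_ge0// lerDl.
have -> : (nrm k1 + 1) * (5 * (e / 8 / (nrm k1 + 1))) = 5 / 8 * e by field; rewrite gt_eqF.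
lra.
Qed.

(** Let el be 1 minus the mean of the V_{n rho} for n < L, an element of [N]. The product (1 - el)
    (V_rho - 1) telescopes to norm at most 2/L, so y (V_rho - 1) is a limit of the y el (V_rho -
    1). *)
Lemma mem_of_shift_mul (rho : rat) (y : B) : 0 < rho ->
  (forall k1, N k1 -> J (k1 *c (j (V rho) - cone))) ->
  J (y *c (j (V rho) - cone)).
Proof.
move=> rho0 Jk; set k := j (V rho) - cone.
have n1 : 0 < nrm y + 1 by rewrite ltr_wpDl ?nrm_ge0.
apply: (closed_subspace_approx cJ) => e e0.
have [L0 LP] := small_invS (e := e / 2 / (nrm y + 1)) ltac:(by rewrite !divr_gt0).
pose L := L0.+1; pose S := \sum_(0 <= n < L) j (V (n%:R * rho)).
have Ln0 : L%:R != 0 :> R[i] by rewrite pnatr_eq0.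
pose el := cone - L%:R^-1 *: S.
have Nel : N el.
  have -> : el = - (L%:R^-1 *: \sum_(0 <= n < L) (j (V (n%:R * rho)) - cone)).
    rewrite sumrB sumr_const_nat subn0 -[(cone : B) *+ L](@scaler_nat R[i]) scalerBr scalerA mulVf//.
    by rewrite scale1r opprB.
  have lN := ideal_sub iN; apply: (lsubN lN); apply: (lsubZ _ lN).
  by apply: (lsub_sum lN) => n _ _; apply: NV; rewrite mulr_ge0// ltW.
exists (y *c el *c k); first by apply: Jk; exact: (ideal_mull _ iN Nel).
have -> : y *c k - y *c el *c k = y *c (L%:R^-1 *: (S *c k)).
  by rewrite -cmulA -cmulBr; congr (_ *c _); rewrite /el cmulBl cmul1l cmulZl subKr.
apply: le_lt_trans (nrmM _ _) _; rewrite nrm_scale nrm_natV.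
have : nrm (S *c k) <= 2.
  have -> : S *c k = \sum_(0 <= n < L) (j (V (n.+1%:R * rho)) - j (V (n%:R * rho))).
    rewrite /S (lin_sum (linear_cmulr k)); apply: eq_bigr => n _.
    rewrite /k cmulBr cmul1r -jM (tshiftM hT) ?(ltW rho0)//.
    by rewrite -[in RHS]addn1 natrD mulrDl mul1r.
  rewrite (telescope_sumr (fun n : nat => j (V (n%:R * rho))))//.
  apply: le_trans (nrmB _ _) _.
  by have := nrm_jV (L%:R * rho); have := nrm_jV (0%:R * rho); lra.
have := LP L0 (leqnn _); rewrite ltr_pdivlMr// -/L.
have : 0 <= (L%:R^-1 : R) by rewrite invr_ge0.
have := nrm_ge0 y; have := nrm_ge0 (S *c k).
move: (nrm y) (L%:R^-1) (nrm (S *c k)) => a q s s0 a0 q0 h1 h2.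
have : a * (q * s) <= a * (q * 2) by rewrite ler_wpM2l// ler_wpM2l.
nra.
Qed.

(** An element b of [N] equals b - kappa(b), and the bounded map b |-> b - kappa(b) sends a monomial
    u_g V_x V_y^* to u_g (V_{x-y} - 1) modulo [I0]. *)
Lemma kernel_sub :
  (forall x : rat, 0 < x -> forall k, N k -> J (k *c (j (V x) - cone))) -> N `<=` J.
Proof.
move=> NJ b Nb.
have Jy (y : B) (x : rat) : J (y *c (j (V x) - cone)).
  have pos z w : 0 <= z -> J (w *c (j (V z) - cone)).
    rewrite le_eqVlt => /orP[/eqP <-|z0].
      by rewrite (tshift0 hT) j1 subrr cmul0r; have [_ []] := cJ.
    by apply: mem_of_shift_mul => // k1; exact: NJ.
  have [|x0] := leP 0 x; first exact: pos.
  have -> : y *c (j (V x) - cone) = - (y *c j (V x) *c (j (V (- x)) - cone)).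
    rewrite -cmulA -cmulNr; congr (_ *c _).
    rewrite cmulBr -jM (tshiftMN hT) ?(ltW x0)// subrr (tshift0 hT) j1 cmul1r.
    by rewrite opprB.
  by apply: (lsubN cJ.2); apply: pos; rewrite oppr_ge0 ltW.
have lid : linear (fun b => b - kappa b).
  by move=> a x y; rewrite lk scalerBr opprD addrACA.
have bid : bounded_by (1 + d) (fun b => b - kappa b).
  by move=> x; apply: le_trans (nrmB _ _) _; rewrite mulrDl mul1r lerD2l.
have bT : closed_span (range mono) b by rewrite (monomial_span hT hB).
rewrite -[b]subr0 -(Nk Nb).
apply: (closed_span_min (closed_subspace_preimage lid bid cJ) _ bT) => _ [p _ <-] /=.
rewrite kE /monomial -[X in _ - X]cmul1r -cmulBr.
rewrite -(subrK (j (V (p.2.1%:num - p.2.2%:num))) (j (toeplitz_gen T p.2))) -addrA cmulDr.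
apply: (lsubD cJ.2); last exact: Jy.
apply: IJ; apply: (ideal_mull _ iI); apply: jmod.
exact: (toeplitz_gen_mod hT iC Cdefect).
Qed.

Section large.
Variable E : B -> B.
Hypotheses (lE : linear E) (bE : bounded_by 1 E).
Hypothesis EE : forall p, E (crossed_gen j u p) = if p.1 == 1%g then j p.2 else 0.
Hypothesis Epos : forall (H : hilbertType R) (pi : B -> bop H) (d : B) (h : H),
  star_hom pi -> 0 <= complex.Re (hdot (pi (E (d^*c *c d)) h) h).

(** If this state is not positive, every Fourier coefficient kills d_0; commuting with the
    translations, it kills all d_q. The comparison of quotient norms then places it in [I0], and
    [fourier_mem] places [b] there. *)
Lemma trace_nonzero (H : hilbertType R) (dd : rat -> H) (pi : B -> bop H) b :
  orthonormal_basis dd -> star_hom pi ->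
  (forall x q, pi (j (V x)) (dd q) = dd (x + q)) ->
  (forall (a : A) (r : R), 0 < r ->
    exists2 c, @commutator_ideal R A c & nrm (a - c) <= nrm (pi (j a)) + r) ->
  ~ I0 b -> 0 < complex.Re (hdot (pi (E (b^*c *c b)) (dd 0)) (dd 0)).
Proof.
move=> bd hpi piV dist nIb; rewrite ltNge; apply/negP => h; apply: nIb.
have [lpi pi1 piM pis] := hpi; have bpi := star_hom_bounded hpi.
apply: (fourier_mem hB lE bE EE (M := I0)); first by case: iI.
move=> g; apply: (ideal_mull _ iI); set y := fcoef u E g b.
have hy : closed_span (range j) y by exact: (expectation_range hB lE bE EE).
have y0 : pi y (dd 0) = 0.
  apply: nrm0_eq0; apply/eqP; rewrite -sqrf_eq0; apply/eqP/le_anti.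
  rewrite sqr_ge0 andbT.
  exact: le_trans (fcoef_le hB lE bE EE Epos g b (dd 0) hpi) h.
have comm q : pi y *c pi (j (V q)) = pi (j (V q)) *c pi y.
  have lpj : linear (fun a => pi (j a)) by move=> c a a'; rewrite lj lpi.
  have bpj : bounded_by 1 (fun a => pi (j a)).
    move=> a; apply: le_trans (bpi _) _; rewrite mul1r.
    exact: (star_hom_bounded hj).
  have cs1 : closed_subspace [set z | pi z *c pi (j (V q)) = pi (j (V q)) *c pi z].
    apply: (@closed_subspace_eq _ _ _ (nrm (pi (j (V q)))) (nrm (pi (j (V q))))).
    - by move=> c a a'; rewrite lpi cmul_linearl.
    - by move=> c a a'; rewrite lpi cmul_linearr.
    - move=> a; apply: le_trans (nrmM _ _) _; rewrite mulrC ler_wpM2l ?nrm_ge0//.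
      by have := bpi a; rewrite mul1r.
    - move=> a; apply: le_trans (nrmM _ _) _; rewrite ler_wpM2l ?nrm_ge0//.
      by have := bpi a; rewrite mul1r.
  apply: (closed_span_min cs1 _ hy) => _ [a _ <-] /=.
  have cs2 := closed_subspace_preimage lj (star_hom_bounded hj) cs1.
  have aT : closed_span (range (toeplitz_gen T)) a by rewrite (toeplitz_span hT).
  apply: (closed_span_min cs2 _ aT) => _ [p _ <-] /=.
  rewrite -!piM -!jM; apply: (bop_eq_basis bd) => s.
  by rewrite /toeplitz_gen !jM !piM !bopME !piV; congr dd; ring.
have py : pi y = 0.
  apply: (bop_eq_basis bd) => q; rewrite bop0E -[q]addr0 -piV -bopME comm bopME.
  by rewrite y0 lin0//; exact: bop_linear.
have cI : closed_subspace I0 by case: iI.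
apply: (closed_subspace_approx cI) => e e0.
have [a ya] := jspan_approx hB hy (e := e / 4) ltac:(by rewrite divr_gt0).
have [c Cc ac] := dist a (e / 4) ltac:(by rewrite divr_gt0).
exists (j c); first exact: (crossed_ideal_j hB).
have pja : nrm (pi (j a)) <= nrm (y - j a).
  have -> : pi (j a) = - pi (y - j a) by rewrite (linB lpi) py sub0r opprK.
  by rewrite nrmN; have := bpi (y - j a); rewrite mul1r.
have h1 := nrm_tri (j a) y (j c); rewrite -(linB lj) in h1.
by have := star_hom_bounded hj (a - c); rewrite mul1r; lra.
Qed.

(** The scalar is the vector state at d_0 after the expectation: a translation moves d_0 unless its
    index is 0, hence [tau] agrees with [diag_sum] on combinations of monomials, and [trace_nonzero]
    lets it be inverted. *)
Theorem ideal_contains_kernel b : J (b^*c *c b) -> ~ I0 b -> N `<=` J.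
Proof.
move=> Jc nIb; set c := b^*c *c b in Jc.
have [H [dd [pi [bd hpi piV piu dist]]]] := translation_rep hT halpha halphaT hB.
have [lpi pi1 piM pis] := hpi; have bpi := star_hom_bounded hpi.
pose tau x := hdot (pi (E x) (dd 0)) (dd 0).
have dd1 : nrm (dd 0) = 1.
  have [dde _] := bd; have := hdot_nrm (dd 0); rewrite dde eqxx.
  move=> /esym/(@complexI _ _ 1)/eqP.
  by rewrite sqrp_eq1 ?nrm_ge0// => /eqP.
have tau0 : tau c != 0.
  have := trace_nonzero bd hpi piV dist nIb; rewrite -/c -/(tau c) => h.
  by apply/eqP => t0; move: h; rewrite t0 /= ltxx.
apply: kernel_sub => rho rho0 k1 Nk1.
rewrite -[_ *c _]scale1r -(mulVf tau0) -scalerA; apply: (lsubZ _ cJ.2).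
apply: (absorb_mem rho0 Jc Nk1) => l.
have -> : diag_sum l = tau (lcomb mono l).
  rewrite /tau (lin_lcomb _ _ lE) (lin_lcomb _ _ lpi) /lcomb bop_sumE hdot_suml.
  apply: eq_bigr => -[a [g [x y]]] _ /=; rewrite ?bopZE hdotZl; congr (_ * _).
  have := EE (g, toeplitz_gen T (x, y)); rewrite /crossed_gen /monomial /= => ->.
  rewrite /diag /=; case: eqP => _ /=; last by rewrite (lin0 lpi) bop0E hdot0l.
  have [dde _] := bd.
  rewrite /toeplitz_gen jM piM bopME !piV dde addr0 subr_eq0.
  by have -> : (x == y) = (x%:num == y%:num) by apply/eqP/eqP => [->|/val_inj ->].
rewrite /tau -hdotBl -bopBE -(linB lpi) -(linB lE).
apply: le_trans (cauchy_schwarz _ _) _; rewrite dd1 mulr1.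
apply: le_trans (nrm_bopP _ _) _; rewrite dd1 mulr1.
apply: le_trans (bpi _) _; rewrite mul1r.
by apply: le_trans (bE _) _; rewrite mul1r.
Qed.

End large.
End ideal.
End second_ideal.

(** * Irreducible representations *)

Section primitive.
Variables (R : realType) (B : cstarAlgType R) (H : hilbertType R) (rho : B -> bop H).
Hypothesis hrho : star_hom rho.

Lemma irreducible_primitive (h0 : H) : h0 != 0 ->
  (forall M : set H, closed_subspace M -> (forall x h, M h -> M (rho x h)) ->
    M = [set 0] \/ M = setT) ->
  primitive (ker rho).
Proof.
move=> h00 irr; exists H, (fun x h => rho x h); split.
  split=> //; first exact: star_hom_representation.
  by have [_ r1 _ _] := hrho; exists cone, h0; rewrite r1.
apply/seteqP; split=> x x0; first by move=> h; rewrite /ker /= in x0; rewrite x0.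
by apply: bop_eq => h; rewrite x0.
Qed.

(** A nonzero invariant subspace contains some h with a nonzero coefficient at some e_s.
    Contractions from the algebra send h close to that multiple of e_w, and from e_w all basis
    vectors are reached. The norm bound allows [b] to be chosen for a finite approximation of h. *)
Lemma basis_irreducible_primitive (X : choiceType) (e : X -> H) (w : X) :
  orthonormal_basis e -> (forall x, exists b, rho b (e w) = e x) ->
  (forall s (l : seq (R[i] * X)) (r : R), 0 < r -> exists2 b, nrm (rho b) <= 1 &
    nrm (rho b (lcomb e l) - hdot (lcomb e l) (e s) *: e w) < r) ->
  primitive (ker rho).
Proof.
move=> be tr ap; have [ee espan] := be.
have ne s : nrm (e s) = 1.
  apply/eqP; rewrite -(@eqrXn2 _ 2) ?nrm_ge0// expr1n; apply/eqP/(@complexI R).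
  by rewrite -hdot_nrm ee eqxx.
apply: (@irreducible_primitive (e w)) => [|M cM Mi].
  by apply/eqP => w0; move: (ne w); rewrite w0 nrm0 => /eqP; rewrite eq_sym oner_eq0.
have [[h Mh /eqP h0]|M0] := pselect (exists2 h, M h & h <> 0); last first.
  left; apply/seteqP; split=> [h Mh|_ ->]; last by have [_ []] := cM.
  by apply: contrapT => h0; apply: M0; exists h.
right; have [s hs] : exists s, hdot h (e s) != 0.
  apply: contrapT => /forallNP hs; move/eqP: h0; apply.
  apply: (basis_hdot be) => s; rewrite hdot0r hdotC.
  by have /negP/negPn/eqP -> := hs s; rewrite conjc0.
have Mw : M (e w).
  suff Mhs : M (hdot h (e s) *: e w).
    by rewrite -[e w]scale1r -(mulVf hs) -scalerA; exact: lsubZ cM.2 Mhs.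
  apply: (closed_subspace_approx cM) => r r0.
  have hT : closed_span (range e) h by rewrite espan.
  have [l hl] := closed_span_lcomb hT (e := r / 3) ltac:(by rewrite divr_gt0).
  have [b b1 bl] := ap s l (r / 3) ltac:(by rewrite divr_gt0).
  exists (rho b h); first exact: Mi.
  apply: le_lt_trans (nrm_tri (hdot (lcomb e l) (e s) *: e w) _ _) _.
  have E1 : nrm (hdot h (e s) *: e w - hdot (lcomb e l) (e s) *: e w) < r / 3.
    rewrite -scalerBl -hdotBl nrm_scale ne mulr1.
    by apply: le_lt_trans (cauchy_schwarz _ _) _; rewrite ne mulr1.
  have := nrm_tri (rho b (lcomb e l)) (hdot (lcomb e l) (e s) *: e w) (rho b h).
  rewrite (nrm_distC (_ *: _) (rho b (lcomb e l))) -(linB (@bop_linear _ _ (rho b))).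
  have := nrm_bopP (rho b) (lcomb e l - h); rewrite (nrm_distC _ h).
  have := nrm_ge0 (h - lcomb e l); nra.
apply/seteqP; split=> // k _; have kT : closed_span (range e) k by rewrite espan.
apply: (closed_span_min cM _ kT) => _ [x _ <-].
by have [b <-] := tr x; exact: Mi.
Qed.

End primitive.

Section concrete.
Variables (R : realType) (A : cstarAlgType R) (T : {nonneg rat} -> A).
Hypothesis hT : is_toeplitz T.
Variable alpha : Qpos -> A -> A.
Variables (B : cstarAlgType R) (j : A -> B) (u : Qpos -> B).
Hypothesis hB : is_crossed_product alpha j u.
Local Notation V := (tshift T).

Let hj : star_hom j. Proof. by case: hB => -[]. Qed.
Let hu : unitary_representation u. Proof. by case: hB => -[]. Qed.

Lemma nrm_hom_le1 (D E : cstarAlgType R) (f : D -> E) x :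
  star_hom f -> nrm x <= 1 -> nrm (f x) <= 1.
Proof.
move=> hf; apply: le_trans.
by have := star_hom_bounded hf x; rewrite mul1r.
Qed.

Lemma nrmM_le1 (D : cstarAlgType R) (x y : D) : nrm x <= 1 -> nrm y <= 1 -> nrm (x *c y) <= 1.
Proof.
move=> x1 y1; apply: le_trans (nrmM _ _) _.
by have := nrm_ge0 x; have := nrm_ge0 y; nra.
Qed.

Lemma nrm_le1_idem (D : cstarAlgType R) (p : D) : p^*c = p -> p *c p = p -> nrm p <= 1.
Proof.
move=> ps pp; have := nrm_starM p; rewrite ps pp => h.
by have := nrm_ge0 p; nra.
Qed.

Lemma pos_below (l : seq rat) : exists2 t, 0 < t & forall x, x \in l -> 0 < x -> t <= x.
Proof.
elim: l => [|x l [t t0 tP]]; first by exists 1.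
have [x0|x0] := ltP 0 x.
  exists (Num.min t x); first by rewrite lt_min t0.
  by move=> y; rewrite inE ge_min => /orP[/eqP -> _|/tP h /h ->//]; rewrite lexx orbT.
exists t => // y; rewrite inE => /orP[/eqP ->|]; last exact: tP.
by move=> xp; have := lt_le_trans xp x0; rewrite ltxx.
Qed.

(** P_t V_s^* sends e_s to e_0 and kills e_q for q < s; for t below all gaps q - s > 0 it also kills
    the other basis vectors of the combination. *)
Lemma natural_primitive (H : hilbertType R) (e : {nonneg rat} -> H) (pi : B -> bop H) :
  orthonormal_basis e -> star_hom pi ->
  (forall x s, pi (j (V x)) (e s) =
        if 0 <= x + s%:num then e (nng (x + s%:num)) else 0) ->
  primitive (ker pi).
Proof.
move=> be hpi piV; have [lj j1 jM _] := hj; have [lp p1 pM _] := hpi.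
have [ee _] := be.
apply: (basis_irreducible_primitive hpi (w := nng 0) be) => [s|s l r r0].
  by exists (j (V s%:num)); rewrite piV nngE// addr0 ge0 nngK.
have [t t0 tP] := pos_below [seq q.2%:num - s%:num | q <- l].
exists (j (defect T t *c V (- s%:num))).
  apply: (nrm_hom_le1 hpi); apply: (nrm_hom_le1 hj); apply: nrmM_le1; last exact: (nrm_tshift hT).
  apply: nrm_le1_idem; last exact: (defect_idem hT (ltW t0)).
  exact: (defect_star hT (ltW t0)).
have cE q : q \in l -> pi (j (defect T t *c V (- s%:num))) (e q.2) =
    (q.2 == s)%:R *: e (nng 0).
  move=> ql; rewrite jM pM bopME piV addrC.
  have [->|qs] := eqVneq q.2 s.
    rewrite subrr lexx scale1r /defect (linB lj) (linB lp) j1 p1 bopBE jM pM bopME.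
    by rewrite !piV !nngE// addr0 oppr_ge0 leNgt t0 (lin0 (@bop_linear _ _ _)) subr0.
  rewrite scale0r; case: ifP => qs0; last exact: (lin0 (@bop_linear _ _ _)).
  have tq : t <= q.2%:num - s%:num.
    apply: tP; first by apply/mapP; exists q.
    rewrite lt_neqAle qs0 andbT eq_sym subr_eq0.
    by apply: contra qs => /eqP qs; apply/eqP/val_inj.
  rewrite /defect (linB lj) (linB lp) j1 p1 bopBE jM pM bopME bop1E.
  by rewrite piV nngE// (addrC (- t)) subr_ge0 tq piV nngE ?subr_ge0// subrKC qs0 subrr.
rewrite [hdot _ _]hdot_suml (lin_lcomb _ _ (@bop_linear _ _ _)) /lcomb scaler_suml.
rewrite -sumrB big_seq big1 ?nrm0// => q ql.
by rewrite [(_ \o _) _]cE// hdotZl ee scalerA subrr.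
Qed.

Lemma sum_delta (K : pzRingType) (n : nat) (i : 'I_n) :
  \sum_(k < n) ((i == k)%:R : K) = 1.
Proof. by rewrite (bigD1 i)//= eqxx big1 ?addr0// => k /negbTE ki; rewrite eq_sym ki. Qed.

Lemma nrm_orthonormal_average (H : hilbertType R) (n : nat) (f : 'I_(n.+1 ^ 2) -> H) :
  (forall i k, hdot (f i) (f k) = (i == k)%:R) ->
  nrm ((((n.+1%:R ^+ 2)^-1 : R)%:C)%C *: \sum_i f i) = n.+1%:R^-1.
Proof.
move=> ff; rewrite nrm_real_mul ?invr_ge0 ?exprn_ge0//.
suff -> : nrm (\sum_i f i) = n.+1%:R by rewrite expr2 invfM mulfVK// pnatr_eq0.
apply/eqP; rewrite -(@eqrXn2 _ 2) ?nrm_ge0//; apply/eqP/(@complexI R).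
rewrite -hdot_nrm hdot_suml (eq_bigr (fun=> 1)).
  by rewrite sumr_const card_ord rmorphXn rmorph_nat -natrX.
by move=> i _; rewrite hdot_sumr (eq_bigr (fun k => (i == k)%:R)) ?sum_delta.
Qed.

(** After the translation V_{-s}, the average of u_1, ..., u_N fixes d_0 and spreads any other basis
    vector over N orthogonal ones, leaving norm N^(-1/2). *)
Lemma translation_primitive (H : hilbertType R) (d : rat -> H) (pi : B -> bop H) :
  orthonormal_basis d -> star_hom pi ->
  (forall x q, pi (j (V x)) (d q) = d (x + q)) ->
  (forall a q, pi (u a) (d q) = d (a%:num * q)) ->
  primitive (ker pi).
Proof.
move=> bd hpi piV piu; have [lj j1 jM _] := hj; have [lp p1 pM _] := hpi.
have [dd _] := bd; have [_ _ uu _] := hu.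
apply: (basis_irreducible_primitive hpi (w := 0) bd) => [q|s l r r0].
  by exists (j (V q)); rewrite piV addr0.
pose S : R := \sum_(q <- l) nrm q.1.
have S0 : 0 <= S by apply: sumr_ge0 => q _; exact: nrm_ge0.
have [n /(_ n (leqnn n)) nr] := small_invS (e := r / (S + 1)) ltac:(by rewrite divr_gt0// ltr_wpDl).
pose c : R[i] := (((n.+1%:R ^+ 2)^-1 : R)%:C)%C.
(* A square, so that N^(-1/2) = 1/(n+1). *)
pose N := (n.+1 ^ 2)%N.
pose g (k : 'I_N) : Qpos := PosNum (ltr0Sn rat k).
pose b := (c *: \sum_(k < N) u (g k)) *c j (V (- s)).
have cN : nrm c * N%:R = 1.
  rewrite /c /N nrm_real ger0_norm ?invr_ge0 ?exprn_ge0// natrX mulVf.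
    by [].
  by rewrite expf_neq0// pnatr_eq0.
exists b.
  apply: (nrm_hom_le1 hpi); apply: nrmM_le1.
    rewrite nrm_scale -cN ler_wpM2l ?nrm_ge0//; apply: le_trans (nrm_sum _ _ _) _.
    rewrite -[leRHS]mulr_natl mulr1 -[N in leRHS]card_ord -sum1_card natr_sum.
    by apply: ler_sum => k _; apply: nrm_unitary; exact: uu.
  by apply: (nrm_hom_le1 hj); exact: (nrm_tshift hT).
have bE q : pi b (d q) = c *: \sum_(k < N) d ((g k)%:num * (q - s)).
  rewrite /b pM bopME piV (linZ lp) bopZE (lin_sum lp) bop_sumE.
  by congr (_ *: _); apply: eq_bigr => k _; rewrite piu addrC.
have b0 q : nrm (pi b (d q) - (q == s)%:R *: d 0) <= n.+1%:R^-1.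
  rewrite bE; have [->|qs] := eqVneq q s.
    rewrite scale1r subrr (eq_bigr (fun=> d 0)) => [|k _]; last by rewrite mulr0.
    rewrite sumr_const card_ord -scaler_nat scalerA.
    have -> : c * N%:R = 1.
      by rewrite /c /N fmorphV rmorphXn rmorph_nat natrX mulVf// expf_neq0// pnatr_eq0.
    by rewrite scale1r subrr nrm0 invr_ge0.
  rewrite scale0r subr0 nrm_orthonormal_average// => i k; rewrite dd; congr (_%:R).
  have qs0 : q - s != 0 by rewrite subr_eq0.
  by rewrite (inj_eq (mulIf qs0)) /g /= eqr_nat eqSS.
rewrite [hdot _ _]hdot_suml (lin_lcomb _ _ (@bop_linear _ _ _)) /lcomb scaler_suml.
rewrite -sumrB; apply: le_lt_trans (nrm_sum _ _ _) _.
apply: (@le_lt_trans _ _ (\sum_(q <- l) nrm q.1 * n.+1%:R^-1)).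
  apply: ler_sum => q _; rewrite hdotZl dd -scalerA -scalerBr nrm_scale.
  by rewrite ler_wpM2l ?nrm_ge0//; exact: b0.
rewrite -mulr_suml -/S; move: nr; rewrite ltr_pdivlMr ?ltr_wpDl//.
have : 0 < (n.+1%:R^-1 : R) by rewrite invr_gt0.
by move: (n.+1%:R^-1) => z z0; nra.
Qed.

End concrete.

(** * Primitive ideals with commutative quotient *)

Section commutative.
Variables (R : realType) (B : cstarAlgType R).

(** Unitality has to be derived: the vectors killed by the whole algebra form an invariant subspace,
    which is 0 by irreducibility and contains every pi(1) h - h. *)
Lemma primitive_star_hom (P : set B) : primitive P ->
  exists (H : hilbertType R) (rho : B -> bop H), [/\ star_hom rho, ker rho = P,
    exists h : H, h != 0 &
    forall M : set H, closed_subspace M -> (forall x h, M h -> M (rho x h)) ->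
      M = [set 0] \/ M = setT].
Proof.
move=> [H [pi [[hpi [x0 [k xk]] irr] ->]]]; have [[pl pc] pll pM ps] := hpi.
pose M := [set h | forall x, pi x h = 0].
have cM : closed_subspace M.
  have cx x : closed_subspace [set h | pi x h = 0].
    have [c bc] := continuous_bounded (pl x) (pc x).
    exact: closed_subspace_preimage (pl x) bc (@closed_subspace0 _ _).
  have -> : M = \bigcap_x [set h | pi x h = 0].
    by apply/seteqP; split=> h Mh x => [_|]; exact: Mh.
  split; first by apply: closed_bigI => x _; have [] := cx x.
  split=> [x _|a h l Mh Ml x _]; first by have [_ []] := cx x.
  by have [_ [_ cl]] := cx x; apply: cl; [exact: Mh|exact: Ml].
have p1 h : pi cone h = h.
  have : M (pi cone h - h).
    by move=> x; rewrite (linB (pl x)) -pM cmul1r subrr.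
  have [||->|MT _] := irr M => //.
  - by move=> x l Ml y; rewrite Ml (lin0 (pl y)).
  - by move=> /subr0_eq.
  - have : M k by rewrite MT.
    by move=> /(_ x0) xk0; rewrite xk0 eqxx in xk.
have [rho [hrho rhoE]] := representation_star_hom hpi p1.
exists H, rho; split=> //.
- apply/seteqP; split=> x x0' => [h|].
    by rewrite -rhoE x0'.
  by apply: bop_eq => h; rewrite rhoE x0'.
- exists k; apply: contra xk => /eqP ->; by rewrite (lin0 (pl _)).
- by move=> N cN Ni; apply: irr => // x h Nh; rewrite -rhoE; exact: Ni.
Qed.

Section irreducible.
Variables (H : hilbertType R) (rho : B -> bop H).
Hypothesis hrho : star_hom rho.
Hypothesis irr : forall M : set H, closed_subspace M ->
  (forall x h, M h -> M (rho x h)) -> M = [set 0] \/ M = setT.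
Hypothesis comm : forall x y, rho x *c rho y = rho y *c rho x.
Variable h0 : H.
Hypothesis h00 : h0 != 0.

(** Schur's lemma in the form of kernels: the kernel of an intertwiner is invariant. *)
Lemma comm_kernel (W : bop H) : (forall x, rho x *c W = W *c rho x) ->
  W = 0 \/ forall h, W h = 0 -> h = 0.
Proof.
move=> Wc; have [||M0|MT] := irr (M := [set h | W h = 0]).
- exact: closed_subspace_preimage (@bop_linear _ _ W) (@nrm_bopP _ _ W) (@closed_subspace0 _ _).
- by move=> x h /= Wh; rewrite -bopME -Wc bopME Wh (lin0 (@bop_linear _ _ _)).
- by right=> h Wh; have : [set h | W h = 0] h by []; rewrite M0.
- left; apply: bop_eq => h; have : [set h | W h = 0] h by rewrite MT.
  by [].
Qed.

(* Some real translate [x] of [y] has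
   [<rho x h0, h0> = 0]; one of [|x| - x] and [|x| + x] vanishes, so that
   [|x|] kills [h0]. *)
Lemma self_adjoint_scalar y : y^*c = y -> exists t : R[i], rho y = t *: cone.
Proof.
move=> ys; have [lr r1 rM rs] := hrho.
pose t : R := complex.Re (hdot (rho y h0) h0) / nrm h0 ^+ 2.
have n0 : nrm h0 ^+ 2 != 0 by rewrite expf_neq0// gt_eqF// nrm_gt0.
exists (t%:C)%C.
pose x1 := y - (t%:C)%C *: cone; pose r := (nrm x1 + 1)^-1.
have r0 : 0 < r by rewrite invr_gt0 ltr_wpDl ?nrm_ge0.
pose x := (r%:C)%C *: x1.
have xs : x^*c = x by rewrite /x /x1 starZ starB starZ star1 !conjc_real ys.
have x1n : nrm x <= 1.
  rewrite /x nrm_real_mul ?(ltW r0)// mulrC /r ler_pdivrMr ?ltr_wpDl ?nrm_ge0// mul1r.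
  by rewrite lerDl.
have xh0 : hdot (rho x h0) h0 = 0.
  have real : hdot (rho y h0) h0 = ((complex.Re (hdot (rho y h0) h0))%:C)%C.
    have : ((hdot (rho y h0) h0)^*)%C = hdot (rho y h0) h0.
      by rewrite -hdotC hdot_star -rs ys.
    by case: (hdot _ _) => a b [] /eqP; rewrite eq_sym -addr_eq0 -mulr2n mulrn_eq0 /= => /eqP ->.
  rewrite /x /x1 (linZ lr) (linB lr) (linZ lr) r1 bopZE bopBE bopZE bop1E.
  rewrite hdotZl hdotBl hdotZl hdot_nrm real -rmorphM /= /t mulfVK// subrr mulr0.
  by [].
have [z [zs zz _]] := cstar_abs xs x1n.
have zc w : rho w *c rho z = rho z *c rho w by [].
have dcomp : (rho (z *c z) - rho x) *c (rho (z *c z) + rho x) = 0.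
  by rewrite cmulBl !cmulDr (comm x) -!rM zz [X in _ - X]addrC subrr.
have zh0 : rho z h0 = 0.
  have key : hdot (rho (z *c z) h0) h0 = 0 -> rho z h0 = 0.
    rewrite rM bopME hdot_star -rs zs hdot_nrm => /(@complexI _ _ 0)/eqP.
    by rewrite sqrf_eq0 => /eqP/nrm0_eq0.
  have [e0|inj] := @comm_kernel (rho (z *c z) - rho x) ltac:(by move=> w; rewrite -(linB lr)).
    by apply: key; rewrite (subr0_eq e0).
  apply: key; have : (rho (z *c z) + rho x) h0 = 0.
    by apply: inj; rewrite -bopME dcomp.
  by rewrite bopDE => /eqP; rewrite addr_eq0 => /eqP ->; rewrite hdotNl xh0 oppr0.
have rz : rho z = 0.
  have [//|inj] := comm_kernel zc.
  by move: h00; rewrite (inj _ zh0) eqxx.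
have rx : rho x = 0.
  have : (rho x)^*c *c rho x = 0.
    by rewrite -rs xs -rM -zz !rM rz !cmul0l.
  by move=> xx; apply: nrm0_eq0; apply/eqP; rewrite -sqrf_eq0 -nrm_starM xx nrm0.
move: rx; rewrite /x (linZ lr) => /eqP; rewrite scaler_eq0 => /orP[/eqP/(@complexI _ _ 0) e|].
  by move: r0; rewrite e ltxx.
by rewrite /x1 (linB lr) (linZ lr) r1 => /eqP/subr0_eq.
Qed.

Lemma commutative_scalar y : exists t : R[i], rho y = t *: cone.
Proof.
have [lr _ _ _] := hrho.
have two : (2 : R[i]) != 0 by rewrite pnatr_eq0.
have ii : ('i * 'i = -1 :> R[i])%C by rewrite -expr2 sqr_i.
have ci : (('i%C : R[i])^*)%C = - 'i%C by apply/eqP; rewrite eq_complex /= oppr0 !eqxx.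
have [|s sE] := @self_adjoint_scalar (y + y^*c); first by rewrite starD starK addrC.
have [|t tE] := @self_adjoint_scalar ('i%C *: (y - y^*c)).
  by rewrite starZ starB starK ci scaleNr -scalerN opprB.
exists (2^-1 * (s - 'i%C * t)).
rewrite -scalerA scalerBl -sE -scalerA -tE -(linZ lr) -(linB lr) -(linZ lr).
congr rho; rewrite scalerA ii scaleN1r opprK addrACA subrr addr0.
by rewrite -mulr2n -(scaler_nat 2 y) scalerA mulVf// scale1r.
Qed.

Lemma commutative_character : exists2 chi : B -> R[i], star_hom chi &
  ker chi = ker rho.
Proof.
have [lr r1 rM rs] := hrho.
have /choice[chi chiE] := commutative_scalar.
have inj s t : s *: (cone : bop H) = t *: cone -> s = t.
  move=> /(congr1 (fun f : bop H => f h0)); rewrite !bopZE !bop1E => /eqP.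
  by rewrite -subr_eq0 -scalerBl scaler_eq0 (negbTE h00) orbF subr_eq0 => /eqP.
exists chi; first split=> [a x y||x y|x]; try apply: inj.
- by rewrite -chiE lr !chiE scalerA scalerDl.
- by rewrite -chiE r1 scale1r.
- by rewrite -chiE rM !chiE cmulZl cmulZr cmul1l scalerA.
- by rewrite -chiE rs chiE starZ star1.
apply/seteqP; split=> x; rewrite /ker /= => x0.
  by rewrite chiE x0 scale0r.
by apply: inj; rewrite -chiE x0 scale0r.
Qed.

End irreducible.

Lemma primitive_character (P : set B) : primitive P ->
  (forall x y, P (x *c y - y *c x)) ->
  exists2 chi : B -> R[i], star_hom chi & ker chi = P.
Proof.
move=> /primitive_star_hom[H [rho [hrho <- [h h0] irr]]] xy.
apply: (commutative_character hrho irr _ h0) => x y.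
have [lr _ rM _] := hrho; apply: subr0_eq; rewrite -!rM -(linB lr).
exact: xy.
Qed.

End commutative.

(** * Characters as one-dimensional irreducible representations *)

Section complex_hilbert.
Variable R : realType.

Fact complex_hdot_linearl (a x y z : R[i]) :
  (a *: x + y) * (z^*)%C = a * (x * (z^*)%C) + y * (z^*)%C.
Proof. by rewrite mulrDl mulrA. Qed.

Fact complex_hdotC (x y : R[i]) : y * (x^*)%C = ((x * (y^*)%C)^*)%C.
Proof. by rewrite rmorphM /= conjcK mulrC. Qed.

Fact complex_hdot_norm (x : R[i]) : x * (x^*)%C = `|x| ^+ 2.
Proof. by rewrite sqr_normc. Qed.

HB.instance Definition _ := isHilbert.Build R R[i]
  complex_hdot_linearl complex_hdotC complex_hdot_norm.

End complex_hilbert.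

Lemma character_primitive (R : realType) (B : cstarAlgType R) (chi : B -> R[i]) :
  star_hom chi -> primitive (ker chi).
Proof.
move=> [lc c1 cM cs].
pose rho b : bop R[i] := chi b *: cone.
have hrho : star_hom rho.
  split=> [a x y||x y|x]; rewrite /rho.
  - by rewrite lc scalerDl scalerA.
  - by rewrite c1 scale1r.
  - by rewrite cM cmulZl cmulZr cmul1l scalerA.
  - by rewrite cs starZ star1.
have -> : ker chi = ker rho.
  apply/seteqP; split=> x; rewrite /ker /rho /=; first by move=> ->; rewrite scale0r.
  move=> /(congr1 (fun f : bop _ => f (1 : R[i]))); rewrite bopZE bop1E bop0E.
  by rewrite -[_ *: _]/(chi x * 1) mulr1.
apply: (irreducible_primitive hrho (h0 := 1 : R[i])); first exact: oner_neq0.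
move=> M [_ lM] _.
have [[h Mh /eqP h0]|M0] := pselect (exists2 h, M h & h <> 0).
  right; apply/seteqP; split=> // k _.
  by rewrite -(mulfVK h0 k); exact: (lsubZ (k / h) lM Mh).
left; apply/seteqP; split=> [h Mh|_ ->]; last by have [] := lM.
by apply: contrapT => h0; apply: M0; exists h.
Qed.

(** * The compact dual group *)

Lemma ultra_fmap (X Y : Type) (f : X -> Y) (F : set_system X) :
  UltraFilter F -> UltraFilter (f @ F).
Proof.
move=> UF; split=> [|S PS FS]; first exact: fmap_proper_filter.
apply/seteqP; split=> // A SA.
have [//|FA] := in_ultra_setVsetC (f @^-1` A) UF.
have /FS SA' : (f @ F) (~` A) by [].
by have /filter_ex [? []] : S (A `&` ~` A) by exact: filterI.
Qed.

Section dual_topology.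
Variables (R : realType) (G : groupType).
Implicit Types gamma : dual R G.

Lemma cvg_dual (F : set_system (dual R G)) gamma0 : Filter F ->
  (forall g, (fun gamma => dual_fun gamma g) @ F --> gamma0 g) -> F --> gamma0.
Proof.
move=> FF Fg A.
have Fp : ((@dual_fun R G : dual R G -> {ptws G -> R[i]}) @ F) --> (gamma0 : {ptws G -> R[i]}).
  apply/cvg_sup => g S /= [_ [[C Cop <-] Cg CS]].
  by apply: (filterS CS); apply: (Fg g); exact: open_nbhs_nbhs.
move=> [_ [[B Bop <-] /= Bg BA]].
by apply: (filterS BA); apply: (Fp B); exact: open_nbhs_nbhs.
Qed.

Lemma dual_eval_continuous g : continuous (fun gamma => dual_fun gamma g).
Proof.
move=> gamma0.
have c1 : {for gamma0, continuous ((@dual_fun R G) : dual R G -> {ptws G -> R[i]})}.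
  exact: initial_continuous.
exact: (continuous_comp c1 (@proj_continuous G (fun=> R[i]) g _)).
Qed.

(** The sets containing such a basic neighbourhood form a filter, which converges to [gamma0] by the
    coordinatewise criterion. *)
Lemma dual_nbhs gamma0 (U : set (dual R G)) : nbhs gamma0 U ->
  exists (l : seq G) (r : R), 0 < r /\ forall gamma,
    (forall a, a \in l -> nrm (gamma a - gamma0 a) < r) -> U gamma.
Proof.
pose F : set_system (dual R G) := [set S | exists (l : seq G) (r : R), 0 < r /\
  forall gamma, (forall a, a \in l -> nrm (gamma a - gamma0 a) < r) -> S gamma].
have FF : Filter F.
  split=> [|S S' [l [r [r0 lS]]] [l' [r' [r0' lS']]]|S S' SS' [l [r [r0 lS]]]].
  - by exists [::], 1.
  - exists (l ++ l'), (Num.min r r'); split=> [|gamma gl]; first by rewrite lt_min r0.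
    split; [apply: lS|apply: lS'] => a al; have := gl a; rewrite mem_cat al ?orbT;
    by rewrite lt_min => /(_ isT)/andP[].
  - by exists l, r; split=> // gamma /lS; exact: SS'.
suff : F --> gamma0 by apply.
apply: cvg_dual => g; apply/cvgrPdist_lt => _ /complex_gt0E[e e0 ->].
exists [:: g], e; split=> // gamma /(_ g (mem_head _ _)) h.
by rewrite /= nrmE ltcR nrm_distC.
Qed.

(** Tychonoff in ultrafilter form: each coordinate converges by compactness of [-1, 1], applied to
    real and imaginary parts, and the limit is again multiplicative of modulus 1. *)
Lemma compact_dual : compact [set: dual R G].
Proof.
rewrite compact_ultra => F UF _.
have PF : ProperFilter F by exact: ultra_proper.
have /choice[f fP] : forall g, exists z : R[i], (fun gamma => dual_fun gamma g) @ F --> z.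
  move=> g.
  have part (p : R[i] -> R) : (forall z, `|p z| <= nrm z) ->
      exists a : R, (fun gamma => p (dual_fun gamma g)) @ F --> a.
    move=> pP; have := @segment_compact R (-1) 1; rewrite compact_ultra.
    move=> /(_ ((fun gamma => p (dual_fun gamma g)) @ F) (ultra_fmap _ UF)) cF.
    have [|a [_ Fa]] := cF; last by exists a.
    apply: (filterE (F := F)) => gamma /=; rewrite in_itv /= -ler_norml.
    by apply: le_trans (pP _) _; rewrite /nrm dual_norm1.
  have [a /cvgrPdist_lt Fa] := part (@complex.Re R) (@Re_nrm R).
  have [b /cvgrPdist_lt Fb] := part (@complex.Im R) (fun z => ltac:(
    by rewrite -lecR -nrmE; exact: normc_ge_Im_aux)).
  exists (a +i* b)%C; apply/cvgrPdist_lt => _ /complex_gt0E[e e0 ->].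
  have e2 : 0 < e / 2 by rewrite divr_gt0.
  near=> gamma; apply: le_lt_trans (normc_le_ReIm_aux _) _.
  rewrite ltcR [ltRHS]splitr; apply: ltrD; rewrite raddfB /=; near: gamma.
    exact: Fa.
  exact: Fb.
have H := @norm_hausdorff _ R[i].
have f1 g : `|f g| = 1.
  have c1 : (fun gamma => `|dual_fun gamma g|) @ F --> `|f g|.
    exact: cvg_norm.
  apply: (cvg_unique H c1).
  have -> : (fun gamma => `|dual_fun gamma g|) = cst (1 : R[i]).
    by apply/funext => gamma; rewrite dual_norm1.
  exact: cvg_cst.
have fM g h : f (g * h)%g = f g * f h.
  apply: (cvg_unique H (fP _)).
  have -> : (fun gamma => dual_fun gamma (g * h)%g) =
      (fun gamma => dual_fun gamma g * dual_fun gamma h).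
    by apply/funext => gamma; rewrite dualM.
  exact: cvgM.
exists (Dual f1 fM); split=> //; exact: cvg_dual.
Unshelve. all: by end_near. Qed.

End dual_topology.

(** * The group C*-algebra *)

Section group_algebra.
Variables (R : realType) (CG : cstarAlgType R) (i : R[i] -> CG) (v : Qpos -> CG).
Hypothesis hCG : is_crossed_product (fun _ : Qpos => id) i v.

Let hi : star_hom i. Proof. by case: hCG => -[]. Qed.
Let hv : unitary_representation v. Proof. by case: hCG => -[]. Qed.

Lemma group_algebra_scalar z : i z = z *: cone.
Proof.
have [li i1 _ _] := hi; rewrite -i1 -(linZ li); congr i.
by rewrite -[RHS]/(z * 1) mulr1.
Qed.

Lemma group_algebra_gen p : crossed_gen i v p = p.2 *: v p.1.
Proof. by rewrite /crossed_gen group_algebra_scalar cmulZr cmul1r. Qed.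

Lemma group_algebra_comm (x y : CG) : x *c y = y *c x.
Proof.
have [_ vM _ _] := hv.
have xT z : closed_span (range (crossed_gen i v)) z by rewrite (crossed_span hCG).
have cy z : closed_subspace [set w : CG | w *c z = z *c w].
  by apply: closed_subspace_eq (linear_cmulr z) (linear_cmull z) _ _;
    [exact: bounded_cmulr|exact: bounded_cmull].
apply: (closed_span_min (cy y) _ (xT x)) => _ [p _ <-] /=; apply/esym.
apply: (closed_span_min (cy _) _ (xT y)) => _ [q _ <-] /=.
rewrite !group_algebra_gen !cmulZl !cmulZr -!vM Qpos_mulC !scalerA.
by rewrite mulrC.
Qed.

Variable eps : dual R Qpos -> CG -> R[i].
Hypothesis heps : forall gamma, star_hom (eps gamma) /\
  forall a, eps gamma (v a) = dual_fun gamma a.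

Lemma eps_hom gamma : star_hom (eps gamma). Proof. by have [] := heps gamma. Qed.

Lemma eps_gen gamma p : eps gamma (crossed_gen i v p) = p.2 * gamma p.1.
Proof.
have [[le _ _ _] ev] := heps gamma.
by rewrite group_algebra_gen (linZ le) ev.
Qed.

Lemma eps_lcomb gamma l :
  eps gamma (lcomb (crossed_gen i v) l) = \sum_(p <- l) p.1 * (p.2.2 * gamma p.2.1).
Proof.
have [le _ _ _] := eps_hom gamma.
by rewrite (lin_lcomb _ _ le) /lcomb; apply: eq_bigr => p _; rewrite /comp eps_gen.
Qed.

(** Averages of gamma(g)^-1 eps_gamma over finite families recover the Fourier coefficient at g, so
    all coefficients of [c] vanish. *)
Lemma eps_separates (c : CG) : (forall gamma, eps gamma c = 0) -> c = 0.
Proof.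
move=> c0; have [E [lE bE EE _]] := expectation_exists hCG.
apply: (fourier_mem hCG lE bE EE (M := [set 0])); first exact: closed_subspace0.
move=> g; suff -> : fcoef v E g c = 0 by rewrite /= cmul0r.
apply: nrm_eq0_le => e e0.
have cT : closed_span (range (crossed_gen i v)) c by rewrite (crossed_span hCG).
have [l cl] := closed_span_lcomb cT (e := e / 2) ltac:(by rewrite divr_gt0).
set c1 := lcomb _ l in cl.
have [Gamma [G0 GP]] := dual_average R [seq (g^-1 * p.2.1)%g | p <- l].
pose L x : R[i] := (size Gamma)%:R^-1 * \sum_(gamma <- Gamma) (gamma g^-1%g * eps gamma x).
have n0 : ((size Gamma)%:R : R[i]) != 0 by rewrite pnatr_eq0 -lt0n.
have fE : fcoef v E g c1 = L c1 *: cone.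
  rewrite (lin_lcomb _ _ (fcoef_linear v lE g)) /L.
  rewrite (eq_bigr (fun gamma : dual R Qpos => \sum_(p <- l)
     p.1 * (p.2.2 * gamma (g^-1 * p.2.1)%g))); last first.
    move=> gamma _; rewrite eps_lcomb mulr_sumr; apply: eq_bigr => p _.
    by rewrite dualM; ring.
  rewrite exchange_big mulr_sumr scaler_suml /lcomb !big_seq; apply: eq_bigr => p pl.
  rewrite /comp (fcoef_gen hCG EE) -mulr_sumr -mulr_sumr.
  have [->|pg] := eqVneq p.2.1 g.
    rewrite mulVg (eq_bigr (fun=> 1)) => [|gamma _]; last exact: dual_one.
    by rewrite sum_same group_algebra_scalar scalerA; congr (_ *: _); field.
  rewrite GP ?mulr0 ?scale0r ?scaler0//; first by apply/mapP; exists p.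
  by rewrite -(inj_eq (@mulgI _ g)) mulgA mulgV mul1g mulg1.
have Lc x : nrm (L x) <= nrm x.
  rewrite nrmcM nrm_natV mulrC ler_pdivrMr ?ltr0n// mulrC.
  apply: le_trans (nrm_sum _ _ _) _.
  apply: (@le_trans _ _ (\sum_(gamma <- Gamma) nrm x)).
    apply: ler_sum => gamma _; rewrite nrmcM /nrm dual_norm1 mul1r.
    by have := star_hom_bounded (eps_hom gamma) x; rewrite mul1r.
  by rewrite big_const_seq count_predT iter_addr_0 mulr_natl.
have Lc1 : nrm (L c1) <= e / 2.
  have Lc0 : L c1 = L (c1 - c).
    rewrite /L; congr (_ * _); apply: eq_bigr => gamma _.
    by have [le _ _ _] := eps_hom gamma; rewrite (linB le) c0 subr0.
  by rewrite Lc0; apply: le_trans (Lc _) _; rewrite nrm_distC ltW.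
rewrite -[fcoef _ _ _ _](subrK (fcoef v E g c1)); apply: le_trans (nrmD _ _) _.
rewrite [e]splitr lerD//.
  rewrite -(linB (fcoef_linear v lE g)).
  by apply: le_trans (fcoef_bounded hCG bE _ _) _; rewrite mul1r ltW.
rewrite fE nrm_scale; apply: le_trans Lc1.
by rewrite -[leRHS]mulr1 ler_wpM2l ?nrm_ge0// nrm_cone.
Qed.

(** On a finite combination this is a finite sum of evaluations; characters being contractive, the
    approximation of [c] is uniform in [gamma]. *)
Lemma eps_continuous (c : CG) : continuous (fun gamma => eps gamma c).
Proof.
move=> gamma0; apply/(cvgrPdist_lt (FF := nbhs_filter gamma0)) => _ /complex_gt0E[e e0 ->].
have e3 : 0 < e / 3 by rewrite divr_gt0.
have cT : closed_span (range (crossed_gen i v)) c by rewrite (crossed_span hCG).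
have [l cl] := closed_span_lcomb cT e3.
set c1 := lcomb _ l in cl.
have near_c1 gamma : nrm (eps gamma c - eps gamma c1) < e / 3.
  have he := eps_hom gamma; have [le _ _ _] := he.
  rewrite -(linB le); apply: le_lt_trans cl.
  by have := star_hom_bounded he (c - c1); rewrite mul1r.
have ev g : (fun gamma => dual_fun gamma g) @ nbhs gamma0 --> gamma0 g.
  exact: dual_eval_continuous.
move: (nbhs gamma0) (nbhs_filter gamma0) ev => F FF ev.
have : (fun gamma => eps gamma c1) @ F --> eps gamma0 c1.
  have -> : (fun gamma => eps gamma c1) =
      (fun gamma => \sum_(p <- l) p.1 * (p.2.2 * dual_fun gamma p.2.1)).
    by apply/funext => gamma; rewrite /c1 eps_lcomb.
  rewrite /c1 eps_lcomb; elim: (l) => [|p m IH].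
    under eq_fun do rewrite big_nil; rewrite big_nil; exact: cvg_cst.
  under eq_fun do rewrite big_cons; rewrite big_cons.
  have c2 : (fun gamma => p.1 * (p.2.2 * dual_fun gamma p.2.1)) @ F -->
      p.1 * (p.2.2 * gamma0 p.2.1).
    apply: cvgM; first exact: cvg_cst.
    by apply: cvgM; [exact: cvg_cst | exact: ev].
  exact: (cvgD c2 IH).
move=> /cvgrPdist_lt/(_ ((e / 3)%:C)%C); rewrite ltcR => /(_ e3).
apply: filterS => gamma; rewrite /= !nrmE !ltcR => h.
apply: le_lt_trans (nrm_tri (eps gamma0 c1) _ _) _.
have := nrm_tri (eps gamma c1) (eps gamma0 c1) (eps gamma c).
have := near_c1 gamma0; have := near_c1 gamma; rewrite (nrm_distC (eps gamma c)).
by move: h; lra.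
Qed.

Lemma character_ge0 (chi : CG -> R[i]) z : star_hom chi -> z^*c = z -> 0 <= chi (z *c z).
Proof.
move=> [_ _ cM cs] zs; rewrite -{1}zs cM cs.
by rewrite -[_ *c _]/((chi z)^*%C * chi z) mulrC mul_conj lecR sqr_ge0.
Qed.

(* The separating element is [x + |x|], where [x = delta - sum_a |v_a -
   gamma0(a)|^2] is positive at [gamma0] and negative far from it. *)
Lemma eps_separating gamma0 U : nbhs gamma0 U ->
  exists2 c, eps gamma0 c != 0 & forall gamma, ~ U gamma -> eps gamma c = 0.
Proof.
move=> /dual_nbhs[l [r [r0 lU]]].
pose w a := v a - gamma0 a *: cone.
pose h := (((r ^+ 2)%:C)%C *: cone - \sum_(a <- l) (w a)^*c *c w a) : CG.
pose s := (nrm h + 1)^-1.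
have s0 : 0 < s by rewrite invr_gt0 ltr_wpDl ?nrm_ge0.
pose x := (s%:C)%C *: h.
have hs : h^*c = h.
  rewrite /h starB starZ star1 conjc_real; congr (_ - _).
  rewrite (big_morph (@star R CG) (@starD _ _) (@star0 _ _)); apply: eq_bigr => a _.
  by rewrite starM starK.
have xs : x^*c = x by rewrite /x starZ conjc_real hs.
have x1 : nrm x <= 1.
  rewrite /x nrm_real_mul ?(ltW s0)// mulrC /s ler_pdivrMr ?ltr_wpDl ?nrm_ge0//.
  by rewrite mul1r lerDl.
have [z [zs zz _]] := cstar_abs xs x1.
have xE gamma : eps gamma x =
    ((s * (r ^+ 2 - \sum_(a <- l) nrm (gamma a - gamma0 a) ^+ 2))%:C)%C.
  have [[le e1 eM es] ev] := heps gamma.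
  rewrite /x (linZ le) /h (linB le) (linZ le) e1 (lin_sum le).
  rewrite [RHS]rmorphM [X in _ = _ * X]rmorphB rmorph_sum.
  congr (_ * (_ - _)); first exact: mulr1.
  apply: eq_bigr => a _; rewrite eM es /w (linB le) ev (linZ le) e1.
  rewrite -[_ *: cone]/(gamma0 a * 1) mulr1.
  exact: etrans (mulrC _ _) (mul_conj _).
have sq gamma : (eps gamma (z *c z) == eps gamma x) || (eps gamma (z *c z) == - eps gamma x).
  have [_ _ eM _] := eps_hom gamma.
  rewrite -subr_eq0 -addr_eq0 -mulf_eq0 -subr_sqr subr_eq0 !expr2.
  by apply/eqP; rewrite -[LHS]eM -[RHS]eM zz.
exists (x + z *c z).
  have [le _ _ _] := eps_hom gamma0.
  rewrite (linD le) gt_eqF// ltr_wpDr//; first exact: character_ge0 (eps_hom _) zs.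
  rewrite xE ltcR mulr_gt0// big1 ?subr0 ?exprn_gt0// => a _.
  by rewrite subrr nrm0 expr0n.
move=> gamma Ug; have [le _ _ _] := eps_hom gamma.
have [a al ra] : exists2 a, a \in l & r <= nrm (gamma a - gamma0 a).
  apply: contrapT => /forall2NP al; apply: Ug; apply: lU => a ha.
  by rewrite ltNge; apply/negP => ra; have [] := al a.
have [y y0 xy] : exists2 y : R, y <= 0 & eps gamma x = (y%:C)%C.
  exists (s * (r ^+ 2 - \sum_(a <- l) nrm (gamma a - gamma0 a) ^+ 2)) => //.
  rewrite pmulr_rle0// subr_le0 (big_rem a al)/=.
  rewrite -[leLHS]addr0 lerD// ?sumr_ge0// => [|k _]; last exact: sqr_ge0.
  by rewrite ler_sqr ?nnegrE ?nrm_ge0 ?(ltW r0).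
have := character_ge0 (eps_hom gamma) zs.
rewrite (linD le); have /orP[/eqP ->|/eqP -> _] := sq gamma; last by rewrite subrr.
rewrite xy lecR => y0'; have -> : y = 0 by apply/eqP; rewrite eq_le y0.
by rewrite addr0.
Qed.

End group_algebra.

(** * The primitive ideal space *)

Section kernels.
Variable R : realType.

Lemma star_hom_kernel (D E : cstarAlgType R) (f : D -> E) : star_hom f ->
  closed_ideal_in setT (ker f).
Proof.
move=> hf; have [lf _ fM _] := hf; split=> //.
  exact: closed_subspace_preimage lf (star_hom_bounded hf) (@closed_subspace0 _ _).
by move=> x y _ /= y0; rewrite /ker /= !fM y0 cmul0l cmul0r.
Qed.

Lemma prim_eq (D : cstarAlgType R) (P Q : prim D) :
  prim_ideal P = prim_ideal Q -> P = Q.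
Proof.
case: P Q => P hP [Q hQ] /= PQ; move: hP hQ; rewrite PQ => hP hQ.
by congr Prim; exact: Prop_irrelevance.
Qed.

Lemma open_hull_compl (D : cstarAlgType R) (J : set D) : open (~` hk_hull J).
Proof.
move=> P; rewrite setCK => PJ x Jx; apply: PJ => Q; exact.
Qed.

Lemma open_hullE (D : cstarAlgType R) (U : set (prim D)) : open U ->
  ~` U = hk_hull (hk_kernel (~` U)).
Proof.
by move=> oU; apply/seteqP; split=> [P nU x|]; [exact|exact: oU].
Qed.

End kernels.

Section primitive_ideals.
Variables (R : realType) (A : cstarAlgType R) (T : {nonneg rat} -> A).
Hypothesis hT : is_toeplitz T.
Variable alpha : Qpos -> A -> A.
Hypothesis halpha : is_action alpha.
Hypothesis halphaT : forall a r, alpha a (T r) = T (Qscale a r).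
Variables (B : cstarAlgType R) (j : A -> B) (u : Qpos -> B).
Hypothesis hB : is_crossed_product alpha j u.
Local Notation V := (tshift T).
Local Notation I0 := (crossed_ideal j u (@commutator_ideal R A)).

Let hj : star_hom j. Proof. by case: hB => -[]. Qed.
Let hu : unitary_representation u. Proof. by case: hB => -[]. Qed.

Lemma I0_sub_ideal (J : set B) b : closed_subspace J ->
  (forall x y, I0 x -> J y -> J (x *c y) /\ J (y *c x)) ->
  J b -> J (b^*c *c b) -> b != 0 -> I0 `<=` J.
Proof.
move=> cJ JI Jb Jbb b0; have [E [lE bE EE Epos]] := expectation_exists hB.
exact: (ideal_contains_commutator hT halpha halphaT hB cJ JI lE bE EE Epos Jb Jbb b0).
Qed.

(** A nonzero kernel of the representation on l^2 of the nonnegative rationals would contain [I0],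
    but P_1 fixes e_0. Hence this irreducible representation is faithful. *)
Lemma natural_nonzero : j (defect T 1) != 0 /\ primitive [set (0 : B)].
Proof.
have [H [e [pi [be hpi iso piV piu]]]] := natural_rep hT halpha halphaT hB.
have [lj j1 jM _] := hj; have [lp p1 pM _] := hpi; have [ee _] := be.
have e0 : pi (j (defect T 1)) (e (nng 0)) = e (nng 0).
  rewrite /defect (linB lj) (linB lp) j1 p1 bopBE jM pM bopME bop1E.
  rewrite piV nngE// addr0 oppr_ge0 leNgt ltr01 (lin0 (@bop_linear _ _ _)) subr0.
  by [].
have enz : 0 <> e (nng 0).
  move=> e0'; have := ee (nng 0) (nng 0); rewrite -e0' hdot0l eqxx => /eqP.
  by rewrite eq_sym oner_eq0.
have n0 : j (defect T 1) != 0.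
  by apply/eqP => j0; apply: enz; rewrite -e0 j0 (lin0 lp) bop0E.
split=> //; suff <- : ker pi = [set 0] by exact: (natural_primitive hT hB be hpi piV).
have [_ cK KI] := star_hom_kernel hpi.
apply/seteqP; split=> [b Kb /=|_ ->]; last exact: (lin0 lp).
apply: contrapT => /eqP b0.
have h : I0 `<=` ker pi.
  apply: (I0_sub_ideal cK _ Kb _ b0) => [x y _ Ky|]; first exact: KI.
  by have [] := KI (b^*c) b I Kb.
have : ker pi (j (defect T 1)).
  by apply: h; apply: (crossed_ideal_j hB); exact: (defect_in_commutator hT ler01).
by rewrite /ker /= => k0; apply: enz; rewrite -e0 k0 bop0E.
Qed.

Section kernel.
Variable N : set B.
Variable kappa : B -> B.
Variable d : R.
Hypotheses (iN : closed_ideal_in setT N) (lk : linear kappa) (bk : bounded_by d kappa).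
Hypothesis kE : forall p, kappa (monomial T j u p) = u p.1.
Hypothesis Nk : forall b, N b -> kappa b = 0.
Hypothesis NV : forall x, 0 <= x -> N (j (V x) - cone).

Lemma kernel_sub_ideal (J : set B) b : closed_subspace J -> I0 `<=` J ->
  (forall x y, N x -> J y -> J (x *c y) /\ J (y *c x)) ->
  J (b^*c *c b) -> ~ I0 b -> N `<=` J.
Proof.
move=> cJ IJ JN Jb nb; have [E [lE bE EE Epos]] := expectation_exists hB.
exact: (ideal_contains_kernel hT halpha halphaT hB iN lk bk kE Nk NV cJ IJ JN lE bE EE Epos Jb nb).
Qed.

(** Translations are unitary, so the kernel contains P_1 and with it [I0]; were it larger it would
    contain [N], hence V_1 - 1, which moves the basis vectors. *)
Lemma translation_kernel : exists (H : hilbertType R) (rho : B -> bop H),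
  [/\ star_hom rho, ker rho = I0, primitive I0 & ~ I0 (j (V 1) - cone)].
Proof.
have [H [e [pi [be hpi piV piu _]]]] := translation_rep hT halpha halphaT hB.
exists H, pi; have [lj j1 jM _] := hj; have [lp p1 pM _] := hpi; have [ee _] := be.
have [_ cK KI] := star_hom_kernel hpi.
have nV : ~ ker pi (j (V 1) - cone).
  rewrite /ker /= => /(congr1 (fun f : bop H => hdot (f (e 0)) (e 0))).
  rewrite (linB lp) p1 bopBE piV bop1E bop0E hdot0l hdotBl !ee addr0 eqxx oner_eq0.
  by rewrite sub0r => /eqP; rewrite oppr_eq0 oner_eq0.
have [n0 _] := natural_nonzero.
have IK : I0 `<=` ker pi.
  have K1 : ker pi (j (defect T 1)).
    rewrite /ker /=; apply: (bop_eq_basis be) => q.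
    rewrite /defect (linB lj) (linB lp) j1 p1 bopBE jM pM bopME bop1E bop0E.
    by rewrite !piV addrA subrr add0r subrr.
  apply: (I0_sub_ideal cK _ K1 _ n0) => [x y _ Ky|]; first exact: KI.
  by have [] := KI ((j (defect T 1))^*c) _ I K1.
have KE : ker pi = I0.
  apply/seteqP; split=> // b Kb; apply: contrapT => nb; apply: nV.
  apply: (kernel_sub_ideal cK IK _ _ nb); last exact: (NV ler01).
    by move=> x y _ Ky; exact: KI.
  by have [] := KI (b^*c) b I Kb.
split=> //; last by rewrite -KE.
by rewrite -KE; exact: (translation_primitive hT hB be hpi piV piu).
Qed.

End kernel.

End primitive_ideals.

(** * The group algebra as a quotient, and the list of primitive ideals *)

Section spectrum.
Variables (R : realType) (A : cstarAlgType R) (T : {nonneg rat} -> A).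
Hypothesis hT : is_toeplitz T.
Variable alpha : Qpos -> A -> A.
Hypothesis halpha : is_action alpha.
Hypothesis halphaT : forall a r, alpha a (T r) = T (Qscale a r).
Variable psi : A -> R[i].
Hypotheses (hpsi : star_hom psi) (hpsiT : forall r, psi (T r) = 1).
Variables (B : cstarAlgType R) (j : A -> B) (u : Qpos -> B).
Hypothesis hB : is_crossed_product alpha j u.
Variables (CG : cstarAlgType R) (i : R[i] -> CG) (v : Qpos -> CG).
Hypothesis hCG : is_crossed_product (fun _ : Qpos => id) i v.
Local Notation V := (tshift T).
Local Notation I0 := (crossed_ideal j u (@commutator_ideal R A)).

Let hj : star_hom j. Proof. by case: hB => -[]. Qed.
Let hu : unitary_representation u. Proof. by case: hB => -[]. Qed.
Let hi : star_hom i. Proof. by case: hCG => -[]. Qed.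
Let hv : unitary_representation v. Proof. by case: hCG => -[]. Qed.

Lemma psi_tshift x : 0 <= x -> psi (V x) = 1.
Proof. by move=> x0; rewrite -(nngE x0) tshift_nng. Qed.

Lemma psi_gen p : psi (toeplitz_gen T p) = 1.
Proof.
have [_ _ pM ps] := hpsi.
rewrite /toeplitz_gen pM (tshiftN hT) ps !psi_tshift//.
by rewrite -[_ *c _]/(1 * (1^*)%C) conjc1 mulr1.
Qed.

Lemma psi_alpha a x : psi (alpha a x) = psi x.
Proof.
have h := star_hom_comp (alpha_star_hom halpha a) hpsi.
have := toeplitz_hom_eq hT h hpsi; move=> /(_ _)/(congr1 (fun f => f x)); apply.
move=> y y0 /=; rewrite (alpha_tshift hT halpha halphaT) !psi_tshift//.
by rewrite mulr_ge0.
Qed.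

(** [sigma] comes from the universal property of the group algebra applied to the unitaries u_a. As
    [Phi] after [sigma] is the identity on generators, surjectivity follows without an appeal to
    closed ranges of homomorphisms. *)
Lemma quotient_map : exists (Phi : B -> CG) (sigma : CG -> B),
  [/\ star_hom Phi, range Phi = setT,
      forall a x, Phi (u a *c j x) = v a *c i (psi x),
      star_hom sigma & forall a, sigma (v a) = u a].
Proof.
have cov1 : covariant alpha (i \o psi) v.
  split=> //; first exact: star_hom_comp.
  move=> g x; have [_ _ _ vv] := hv; rewrite /= psi_alpha (group_algebra_scalar hCG).
  by rewrite cmulZr cmul1r cmulZl vv.
have hsc : star_hom (fun z : R[i] => z *: (cone : B)).
  split=> [a x y||x y|x].
  - by rewrite scalerA -scalerDl.
  - by rewrite scale1r.
  - by rewrite cmulZl cmulZr cmul1l scalerA.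
  - by rewrite starZ star1.
have cov2 : covariant (fun _ : Qpos => id) (fun z : R[i] => z *: (cone : B)) u.
  by split=> // g z; have [_ _ _ uu] := hu; rewrite cmulZr cmul1r cmulZl uu.
have [_ _ /(_ _ _ _ cov1)[Phi [hPhi Pj Pu]]] := hB.
have [_ _ /(_ _ _ _ cov2)[sigma [hsig Sj Su]]] := hCG.
have Pu' a : Phi (u a) = v a by rewrite -Pu.
have Su' a : sigma (v a) = u a by rewrite -Su.
have Sj' z : sigma (i z) = z *: cone by rewrite -[LHS]/((sigma \o i) z) Sj.
have [lP P1 PM _] := hPhi; have hPS := star_hom_comp hsig hPhi.
exists Phi, sigma; split=> // [|a x]; last by rewrite PM Pu' -[Phi (j x)]/((Phi \o j) x) Pj.
apply/seteqP; split=> // c _; exists (sigma c) => //.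
have cT : closed_span (range (crossed_gen i v)) c by rewrite (crossed_span hCG).
have b1 : bounded_by 1 (@id CG) by move=> x; rewrite mul1r.
have l1 : linear (@id CG) by [].
have cs := closed_subspace_eq (star_hom_lin hPS) l1 (star_hom_bounded hPS) b1.
apply: (closed_span_min cs _ cT) => _ [p _ <-] /=; have [_ _ SM _] := hsig.
by rewrite /crossed_gen SM Su' Sj' PM Pu' (linZ lP) P1 (group_algebra_scalar hCG).
Qed.

Variables (Phi : B -> CG) (sigma : CG -> B).
Hypotheses (hPhi : star_hom Phi) (rPhi : range Phi = setT)
  (PhiE : forall a x, Phi (u a *c j x) = v a *c i (psi x))
  (hsigma : star_hom sigma) (sigmaE : forall a, sigma (v a) = u a).

Let lP : linear Phi. Proof. by case: hPhi. Qed.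
Let u1 : u 1%g = cone. Proof. by case: hu. Qed.
Let v1 : v 1%g = cone. Proof. by case: hv. Qed.

Lemma Phi_u a : Phi (u a) = v a.
Proof.
have [_ j1 _ _] := hj; have [_ i1 _ _] := hi; have [_ p1 _ _] := hpsi.
by rewrite -[u a]cmul1r -j1 PhiE p1 i1 cmul1r.
Qed.

Lemma Phi_j x : Phi (j x) = psi x *: cone.
Proof. by rewrite -[j x]cmul1l -u1 PhiE v1 cmul1l (group_algebra_scalar hCG). Qed.

Lemma ker_tshift x : 0 <= x -> ker Phi (j (V x) - cone).
Proof.
have [_ P1 _ _] := hPhi.
by move=> x0; rewrite /ker /= (linB lP) P1 Phi_j psi_tshift// scale1r subrr.
Qed.

Let iN : closed_ideal_in setT (ker Phi) := star_hom_kernel hPhi.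
Let kappa := sigma \o Phi.
Let hk : star_hom kappa := star_hom_comp hPhi hsigma.

Let kE p : kappa (monomial T j u p) = u p.1.
Proof.
have [_ i1 _ _] := hi.
by rewrite /kappa /= /monomial PhiE psi_gen i1 cmul1r sigmaE.
Qed.

Let Nk b : ker Phi b -> kappa b = 0.
Proof. by move=> b0; rewrite /kappa /= b0 (lin0 (star_hom_lin hsigma)). Qed.

Lemma kernel_minimal (J : set B) b : closed_subspace J -> I0 `<=` J ->
  (forall x y, ker Phi x -> J y -> J (x *c y) /\ J (y *c x)) ->
  J (b^*c *c b) -> ~ I0 b -> ker Phi `<=` J.
Proof.
exact: (kernel_sub_ideal hT halpha halphaT hB iN (star_hom_lin hk)
  (star_hom_bounded hk) kE Nk ker_tshift).
Qed.

Lemma I0_rep : exists (H : hilbertType R) (rho : B -> bop H),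
  [/\ star_hom rho, ker rho = I0, primitive I0 & ~ I0 (j (V 1) - cone)].
Proof.
exact: (translation_kernel hT halpha halphaT hB iN (star_hom_lin hk)
  (star_hom_bounded hk) kE Nk ker_tshift).
Qed.

Lemma defect_I0 : I0 (j (defect T 1)).
Proof. by apply: (crossed_ideal_j hB); exact: (defect_in_commutator hT ler01). Qed.

(** The kernel contains the nonzero defect P_1, so the minimality of [I0] applies. *)
Lemma I0_kernel : I0 `<=` ker Phi.
Proof.
have [n0 _] := natural_nonzero hT halpha halphaT hB.
have [_ cK KI] := iN; have [lj j1 jM _] := hj; have [_ P1 PM _] := hPhi.
have K1 : ker Phi (j (defect T 1)).
  have [lp p1 pM ps] := hpsi.
  have p0 : psi (defect T 1) = 0.
    rewrite /defect (linB lp) p1 pM (tshiftN hT) ps psi_tshift//.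
    by rewrite -[_ *c _]/(1 * (1^*)%C) conjc1 mulr1 -[cone]/1 subrr.
  by rewrite /ker /= Phi_j p0 scale0r.
apply: (I0_sub_ideal hT halpha halphaT hB cK _ K1 _ n0) => [x y _ Ky|]; first exact: KI.
by have [] := KI ((j (defect T 1))^*c) _ I K1.
Qed.

Lemma primitive_cases (P : prim B) :
  [\/ prim_ideal P = [set 0], prim_ideal P = I0 | I0 `<=` prim_ideal P /\ ker Phi `<=` prim_ideal P].
Proof.
have [H [rho [hrho rP _ _]]] := primitive_star_hom (primP P).
have := star_hom_kernel hrho; rewrite rP => -[_ cP PI]; have P0 := cP.2.1.
have [[b Pb /eqP b0]|nb] := pselect (exists2 b, prim_ideal P b & b <> 0); last first.
  apply: Or31; apply/seteqP; split=> [b Pb|_ ->//].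
  by apply: contrapT => b0; apply: nb; exists b.
have IP : I0 `<=` prim_ideal P.
  apply: (I0_sub_ideal hT halpha halphaT hB cP _ Pb _ b0) => [x y _ Ky|]; first exact: PI.
  by have [] := PI (b^*c) b I Pb.
have [[c Pc nc]|nc] := pselect (exists2 c, prim_ideal P c & ~ I0 c); last first.
  apply: Or32; apply/seteqP; split=> // c Pc.
  by apply: contrapT => Ic; apply: nc; exists c.
apply: Or33; split=> //; apply: (kernel_minimal cP IP _ _ nc) => [x y _ Ky|]; first exact: PI.
by have [] := PI (c^*c) c I Pc.
Qed.

Lemma simple_I0 : simple_cstar I0.
Proof.
have [H [rho [hrho rI _ _]]] := I0_rep.
split; first by exists (j (defect T 1)); [exact: defect_I0|have [] := natural_nonzero hT halpha halphaT hB].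
move=> J [JI cJ JIJ]; have J0 := cJ.2.1.
have [[b Jb /eqP b0]|nb] := pselect (exists2 b, J b & b <> 0); last first.
  left; apply/seteqP; split=> [b Jb|_ ->//].
  by apply: contrapT => b0; apply: nb; exists b.
right; apply/seteqP; split=> //.
apply: (I0_sub_ideal hT halpha halphaT hB cJ _ Jb _ b0) => [x y Ix Jy|]; first exact: JIJ.
(* [J] is an ideal of [I0] only, so b^* must be known to lie in [I0]; the latter is a kernel, hence
   selfadjoint. *)
apply: (JIJ _ _ _ Jb).1; have := JI _ Jb; rewrite -rI /ker /= => rb.
by have [_ _ _ rs] := hrho; rewrite rs rb star0.
Qed.

(** The preimage of [L] contains [I0] and absorbs products with [ker Phi], which is the form of
    hypothesis in [kernel_minimal]. *)
Lemma simple_quotient (Q : cstarAlgType R) (q : B -> Q) :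
  is_quotient I0 q -> simple_cstar (q @` ker Phi).
Proof.
move=> [hq rq kq]; have [lq _ qM qs] := hq; have [_ [_ [_ _ _ nV]]] := I0_rep.
have Iq b : I0 b <-> q b = 0 by rewrite -kq.
split.
  exists (q (j (V 1) - cone)); first by exists (j (V 1) - cone) => //; exact: ker_tshift.
  by apply/eqP => q0; apply: nV; apply/Iq.
move=> L [Lq cL LI]; have L0 := cL.2.1.
have [[l Ll /eqP l0]|nl] := pselect (exists2 l, L l & l <> 0); last first.
  left; apply/seteqP; split=> [l Ll|_ ->//].
  by apply: contrapT => l0; apply: nl; exists l.
right; apply/seteqP; split=> // _ [x Nx <-].
have [b Nb qb] := Lq _ Ll.
have [_ _ NI] := iN.
have c1 := closed_subspace_preimage lq (star_hom_bounded hq) cL.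
apply: (kernel_minimal c1 _ _ _ _ Nx (b := b)) => [y Iy|y z Ny /= Lz||Ib].
- by rewrite /= (Iq y).1.
- by rewrite !qM; apply: LI => //; exists y.
- rewrite /= qM qs; apply: (LI _ _ _ _).1; last by rewrite qb.
  exists b^*c; last by rewrite qs.
  by have [_ _ _ Ps] := hPhi; rewrite /ker /= Ps Nb star0.
- by move: l0; rewrite -qb (Iq b).1// eqxx.
Qed.

Variable eps : dual R Qpos -> CG -> R[i].
Hypothesis heps : forall gamma, star_hom (eps gamma) /\
  forall a, eps gamma (v a) = dual_fun gamma a.

(** The group algebra is commutative, so commutators lie in the ideal and [primitive_character]
    applies; gamma is the restriction of the resulting character to the u_g. *)
Lemma character_exists (P : prim B) : ker Phi `<=` prim_ideal P ->
  exists gamma, prim_ideal P = ker (eps gamma \o Phi).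
Proof.
move=> NP; have [lP' P1 PM Ps] := hPhi.
have [|chi hchi chiE] := primitive_character (primP P).
  move=> x y; apply: NP; rewrite /ker /= (linB lP) !PM (group_algebra_comm hCG).
  exact: subrr.
have [lc c1 cM cs] := hchi; have [_ uM uu _] := hu.
have gM g h : chi (u (g * h)%g) = chi (u g) * chi (u h) by rewrite uM cM.
have g1 g : `|chi (u g)| = 1.
  have : (chi (u g))^*c *c chi (u g) = 1 by rewrite -cs -cM uu c1.
  rewrite -[_ *c _]/((chi (u g))^*%C * chi (u g)) mulrC -sqr_normc => /eqP.
  by rewrite sqrp_eq1// => /eqP.
exists (Dual g1 gM); rewrite -chiE; congr ker.
have [he ev] := heps (Dual g1 gM); have [le e1 eM _] := he.
have heP := star_hom_comp hPhi he.
apply: (lin_eq_dense lc (star_hom_lin heP) (star_hom_bounded hchi) (star_hom_bounded heP)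
  (crossed_span hB)).
move=> _ [[g x] _ <-]; rewrite /crossed_gen cM /= PhiE eM ev /=; congr (_ *c _).
have : ker chi (j x - psi x *: cone).
  rewrite chiE; apply: NP; rewrite /ker /= (linB lP) (linZ lP) P1 Phi_j.
  exact: subrr.
rewrite /ker /= (linB lc) (linZ lc) c1 (group_algebra_scalar hCG) (linZ le) e1.
by move=> /subr0_eq.
Qed.

End spectrum.

Theorem theorem6p1 (R : realType)
    (* the Toeplitz algebra A with its generating isometries T *)
    (A : cstarAlgType R) (T : {nonneg rat} -> A) (hT : is_toeplitz T)
    (alpha : Qpos -> A -> A) (halpha : is_action alpha)
    (halphaT : forall a r, alpha a (T r) = T (Qscale a r))
    (psi : A -> R[i]) (hpsi : star_hom psi) (hpsiT : forall r, psi (T r) = 1)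
    (* B is the crossed product of A by alpha *)
    (B : cstarAlgType R) (j : A -> B) (u : Qpos -> B)
    (hB : is_crossed_product alpha j u)
    (* CG is the group C*-algebra, i.e. the crossed product of the complex
       numbers by the trivial action *)
    (CG : cstarAlgType R) (i : R[i] -> CG) (v : Qpos -> CG)
    (hCG : is_crossed_product (fun _ : Qpos => id) i v)
    (eps : dual R Qpos -> CG -> R[i])
    (heps : forall gamma, star_hom (eps gamma) /\
              forall a, eps gamma (v a) = dual_fun gamma a) :
  exists Phi : B -> CG,
    [/\ star_hom Phi, range Phi = setT
      & forall a x, Phi (u a *c j x) = v a *c i (psi x)] /\
    exists (f : dual R Qpos -> prim B) (O I : prim B),
      let F := range f in
      let PrimO : set (prim B) := ~` [set O] in
      [/\ (* (1) *)
          [/\ forall gamma, prim_ideal (f gamma) = ker (eps gamma \o Phi),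
              compact [set: dual R Qpos],
              homeo_onto f F, closed F & hk_kernel F = ker Phi],
          (* (2) *)
          [/\ prim_ideal O = [set 0],
              prim_ideal I = crossed_ideal j u (@commutator_ideal R A)
            & ~` F = [set O; I]],
          (* (3), where PrimO carries the subspace topology *)
          [/\ open [set O], dense [set O],
              open (set_val @^-1` [set I] : set PrimO)
            & dense (set_val @^-1` [set I] : set PrimO)]
        & (* (4) *)
          simple_cstar (prim_ideal I) /\
          forall (Q : cstarAlgType R) (q : B -> Q),
            is_quotient (prim_ideal I) q -> simple_cstar (q @` ker Phi)].
Proof.
have [Phi [sigma [hPhi rPhi PhiE hsig sigE]]] :=
  quotient_map hT halpha halphaT hpsi hpsiT hB hCG.
exists Phi; split=> //; have [lP _ _ _] := hPhi.
have hf gamma : star_hom (eps gamma \o Phi).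
  by apply: star_hom_comp hPhi _; have [] := heps gamma.
pose f gamma : prim B := Prim (character_primitive (hf gamma)).
have [n0 O0] := natural_nonzero hT halpha halphaT hB.
have [H [rho [hrho rI pI nV]]] := I0_rep hT halpha halphaT hpsi hpsiT hB hCG hPhi PhiE hsig sigE.
pose O := Prim O0; pose I := Prim pI.
exists f, O, I => F PrimO.
pose kV := ker_tshift hpsiT hB hCG hPhi PhiE ler01.
have nI0 : ~ (crossed_ideal j u (@commutator_ideal R A) `<=` [set 0]).
  move=> h; have := h _ (defect_I0 hT hB) => /= d0.
  by move: n0; rewrite d0 eqxx.
have IN := I0_kernel hT halpha halphaT hpsi hpsiT hB hCG hPhi PhiE.
have NF P : ker Phi `<=` prim_ideal P <-> F P.
  split=> [NP|[gamma _ <-] b]; last first.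
    move=> b0; have [[le _ _ _] _] := heps gamma; change (eps gamma (Phi b) = 0).
    by rewrite (b0 : Phi b = 0) (lin0 le).
  have [gamma gE] := character_exists hB hCG hPhi PhiE heps NP.
  by exists gamma => //; apply: prim_eq.
have cases P : [\/ P = O, P = I | F P].
  have [P0|PI|[_ NP]] := primitive_cases hT halpha halphaT hpsi hpsiT hB hCG hPhi PhiE hsig sigE P.
  - by apply: Or31; exact: prim_eq.
  - by apply: Or32; exact: prim_eq.
  - by apply: Or33; exact/NF.
have FO : ~ F O.
  by move=> /NF NO; apply: nI0 => b /IN /NO.
have FI : ~ F I by move=> /NF NI; apply: nV; exact: (NI _ kV).
have IP P : P <> O -> prim_ideal I `<=` prim_ideal P.
  move=> PO; case: (cases P) => [/PO|->|/NF NP]//.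
  by move=> b /IN /NP.
have kF : hk_kernel F = ker Phi.
  apply/seteqP; split=> [b Fb|b Nb P /NF]; last exact.
  apply: (eps_separates hCG heps) => gamma.
  by apply: (Fb (f gamma)); exists gamma.
have FE : F = hk_hull (ker Phi) by apply/seteqP; split=> P /NF.
have oF : open (~` F) by rewrite FE; exact: open_hull_compl.
have OI : O <> I by move=> /(congr1 (@prim_ideal R B)) /= e; apply: nI0; rewrite -e.
have CF : ~` F = [set O; I].
  apply/seteqP; split=> [P nF|P [->|->]//].
  by case: (cases P) => [->|->|//]; [left|right].
split; first split=> //.
- exact: compact_dual.
- split=> //.
  + move=> gamma delta fe; suff gd : dual_fun gamma = dual_fun delta.
      case: gamma delta {fe} gd => g g1 gM [d d1 dM] /= gd.
      move: g1 gM d1 dM; rewrite gd => g1 gM d1 dM.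
      by congr Dual; exact: Prop_irrelevance.
    apply/funext => a.
    (* u_a - gamma(a) 1 lies in the ideal at [gamma], so this ideal determines gamma(a). *)
    have : ker (eps delta \o Phi) (u a - gamma a *: cone).
      move: fe => /(congr1 (@prim_ideal R B)) /= <-.
      have [le e1 _ _] := hf gamma; have [_ ev] := heps gamma.
      change ((eps gamma \o Phi) (u a - gamma a *: cone) = 0).
      rewrite (linB le) (linZ le) e1 /= (Phi_u hpsi hB hCG PhiE) ev.
      by rewrite -[_ *: cone]/(gamma a * 1) mulr1 subrr.
    have [le e1 _ _] := hf delta; have [_ ev] := heps delta.
    move=> k0; apply/esym/subr0_eq; rewrite -[RHS](k0 : (eps delta \o Phi) _ = 0).
    rewrite (linB le) (linZ le) e1 /= (Phi_u hpsi hB hCG PhiE) ev.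
    by rewrite -[_ *: cone]/(gamma a * 1) mulr1.
  (* A closed set is the hull of some [K]; its preimage is the common zero set of the continuous
     functions gamma |-> eps_gamma(Phi b) with b in [K]. *)
  + apply/continuousP => U oU; rewrite -(setCK U) (open_hullE oU) preimage_setC openC.
    set K := hk_kernel _.
    rewrite [X in closed X](_ : _ = \bigcap_(b in K) [set gamma | eps gamma (Phi b) = 0]); last first.
      by apply/seteqP; split=> gamma h b Kb; exact: h.
    apply: closed_bigI => b _.
    have ec := @eps_continuous _ _ _ _ hCG _ heps (Phi b).
    apply: (@closed_comp _ _ (fun gamma => eps gamma (Phi b)) [set 0]) => [gamma _|].
      exact: ec.
    exact/accessible_closed_set1/hausdorff_accessible/norm_hausdorff.
  (* Openness onto the image: an element of the group algebra that is nonzero at [gamma0] and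
     vanishes outside [U] lifts to some b in all ideals outside [U] but not in the one at
     [gamma0]. *)
  + move=> U oU; exists (~` hk_hull (hk_kernel (f @` (~` U)))); first exact: open_hull_compl.
    apply/seteqP; split=> [_ [gamma0 Ug <-]|P [nP [gamma _ fP]]].
      split; last by exists gamma0.
      have /(eps_separating heps)[c c0 cU] : nbhs gamma0 U by exact: open_nbhs_nbhs.
      have : range Phi c by rewrite rPhi.
      move=> [b _ bc] h; move/eqP: c0; apply; rewrite -bc.
      apply: (h b) => _ [gamma nU <-]; rewrite /= /ker /= bc.
      exact: cU.
    exists gamma => //; apply: contrapT => nU; apply: nP => b; rewrite -fP; apply.
    by exists gamma.
- by rewrite -openC.
- by [].
- split.
  (* If O were in the closure of the other points, it would contain their intersection, hence
     [I]. *)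
  + move=> P kP PO; apply: nI0; rewrite -[X in _ `<=` X]/(prim_ideal O) -PO.
    by move=> b Ib; apply: kP => Q QO; exact: (IP Q).
  (* An open set that misses O is empty: the intersection of the ideals in its complement is 0, so
     the complement is the whole space. *)
  + move=> U [P UP] oU; exists O; split=> //; apply: contrapT => nO.
    have PO : P <> O by move=> PO; apply: nO; rewrite -PO.
    have : (~` U) P by apply: oU => b /(_ O nO) ->; apply: (IP _ PO); exact: (closed_span_closed _).2.1.
    exact.
  + have : open (set_val @^-1` (~` F) : set PrimO).
      by apply: open_comp oF => x _; exact: initial_continuous.
    suff -> : set_val @^-1` (~` F) = set_val @^-1` [set I] :> set PrimO by [].
    rewrite CF; apply/seteqP; split=> [x [/= xO|//]|x xI]; last by right.
    by have := set_valP x; rewrite /PrimO /= xO.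
  (* The same argument for an open set [W] that induces [U], with [I], contained in every ideal
     other than O, in place of 0. *)
  + move=> U [x Ux] [W oW WU].
    have IPrimO : PrimO I by move=> IO; exact: OI.
    exists (SigSub (mem_set IPrimO)); split=> //.
    rewrite -WU /=; apply: contrapT => nI.
    have : (~` W) (set_val x).
      apply: oW => b /(_ I nI) Ib; apply: (IP _ _ _ Ib).
      exact: set_valP x.
    by apply; rewrite -[W _]/((set_val @^-1` W) x) WU.
- split; first exact: (simple_I0 hT halpha halphaT hpsi hpsiT hB hCG hPhi PhiE hsig sigE).
  exact: (simple_quotient hT halpha halphaT hpsi hpsiT hB hCG hPhi PhiE hsig sigE).
Qed.
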